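(* For every $s\in[0,1]$, the operator $(L^{(s)*}+L^{(s)})\restriction\mathcal X$ is essentially self-adjoint on $\mathcal B_2(\mathsf h)$.
   Context: $\mathsf h=\Gamma(\mathbb C)$ is the one-mode bosonic Fock space with orthonormal basis $(e_n)_{n\ge0}$; $ae_n=\sqrt n\,e_{n-1}$ ($ae_0=0$), $a^\dagger e_n=\sqrt{n+1}\,e_{n+1}$, $N=a^\dagger a$; $W(z)=\exp(za^\dagger-\overline z a)$, $z\in\mathbb C$. $\mathcal B(\mathsf h)$, $\mathcal B_2(\mathsf h)$ are the bounded and Hilbert--Schmidt operators, with $\langle X,Y\rangle_2=\mathrm{Tr}(X^*Y)$. Gaussian QMS: let $\Omega\in\mathbb R$, $\kappa,\zeta,u_1,u_2,v_1,v_2\in\mathbb C$, $\gamma=\frac12\sum_{\ell=1}^2(|v_\ell|^2-|u_\ell|^2)$, and define real-linear operators on $\mathbb C$ by $Zz=(\mathrm i\Omega-\gamma)z+\mathrm i\kappa\overline z$ and $Cz=\sum_{\ell=1}^2\big((|u_\ell|^2+|v_\ell|^2)z+2v_\ell u_\ell\overline z\big)$. The Gaussian quantum Markov semigroup $(\mathcal T_t)_{t\ge0}$ is the weak$^*$-continuous semigroup of normal, completely positive, identity-preserving maps on $\mathcal B(\mathsf h)$ determined by $$\mathcal T_t(W(z))=\exp\Big\{-\tfrac12\int_0^t\Re\big(\overline{e^{rZ}z}\,C(e^{rZ}z)\big)dr+\mathrm i\int_0^t\Re\big(\overline\zeta\,e^{rZ}z\big)dr\Big\}W(e^{tZ}z).$$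 Drift matrix: $\mathbf Z=\begin{pmatrix}-\gamma-\Im\kappa&\Re\kappa-\Omega\\ \Re\kappa+\Omega&-\gamma+\Im\kappa\end{pmatrix}$. Standing assumptions: $\mathbf Z$ is stable (eigenvalues with strictly negative real parts); the unique normal invariant state $\rho$ is faithful; and (standardization) $\zeta=0$, $\kappa=\mathrm i\tanh(\beta/2)\sum_\ell u_\ell v_\ell$ with $\beta=-\log\big(\sum_\ell|u_\ell|^2/\sum_\ell|v_\ell|^2\big)>0$, so that $\rho=(1-e^{-\beta})e^{-\beta N}$. Induced semigroup: for $s\in[0,1]$, $T_t^{(s)}(\rho^{s/2}X\rho^{(1-s)/2})=\rho^{s/2}\mathcal T_t(X)\rho^{(1-s)/2}$, $X\in\mathcal B(\mathsf h)$, extends uniquely to a strongly continuous contraction semigroup on $\mathcal B_2(\mathsf h)$, with generator $L^{(s)}$. Embedded polynomials: $\mathcal X\subset\mathcal B_2(\mathsf h)$ is the dense space of all $\rho^{s/2}P(a,a^\dagger)\rho^{(1-s)/2}$ with $P$ a noncommutative polynomial (initially defined on the span of the $e_n$ and extended by continuity); $\mathcal X\subset\operatorname{Dom}L^{(s)}\cap\operatorname{Dom}L^{(s)*}$, and $L^{(s)*}+L^{(s)}$ is defined on $\mathcal X$ as the sum. *)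

(* Defs.v *)
From Stdlib Require Import Reals Factorial Lra Lia FunctionalExtensionality ProofIrrelevance.
From Coquelicot Require Import Coquelicot.

Open Scope R_scope.

(* Inner products are conjugate linear in the first argument. *)
Record is_inner {E : ModuleSpace C_AbsRing} (ip : E -> E -> C) : Prop := {
  ip_plus_r : forall x y z, ip x (plus y z) = Cplus (ip x y) (ip x z);
  ip_scal_r : forall c x y, ip x (scal c y) = Cmult c (ip x y);
  ip_conj : forall x y, ip y x = Cconj (ip x y);
  ip_pos : forall x, 0 <= Re (ip x x);
  ip_def : forall x, ip x x = RtoC 0 -> x = zero
}.

Definition ip_norm {E : ModuleSpace C_AbsRing} (ip : E -> E -> C) (x : E) : R :=
  sqrt (Re (ip x x)).

Lemma Ceq (z w : C) : Re z = Re w -> Im z = Im w -> z = w.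
Proof. destruct z, w; unfold Re, Im; simpl; intros; subst; reflexivity. Qed.

Lemma ip_plus_l {E : ModuleSpace C_AbsRing} (ip : E -> E -> C) (H : is_inner ip) x y z :
  ip (plus x y) z = Cplus (ip x z) (ip y z).
Proof.
  rewrite (ip_conj _ H z (plus x y)), (ip_plus_r _ H), Cplus_conj.
  now rewrite <- !(ip_conj _ H).
Qed.

Lemma ip_scal_l {E : ModuleSpace C_AbsRing} (ip : E -> E -> C) (H : is_inner ip) c x z :
  ip (scal c x) z = Cmult (Cconj c) (ip x z).
Proof.
  rewrite (ip_conj _ H z (scal c x)), (ip_scal_r _ H), Cmult_conj.
  now rewrite <- (ip_conj _ H).
Qed.

Lemma ip_im {E : ModuleSpace C_AbsRing} (ip : E -> E -> C) (H : is_inner ip) x :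
  Im (ip x x) = 0.
Proof.
  assert (h := f_equal Im (ip_conj _ H x x)). rewrite im_conj in h. lra.
Qed.

Lemma ip_zero_r {E : ModuleSpace C_AbsRing} (ip : E -> E -> C) (H : is_inner ip) x :
  ip x zero = RtoC 0.
Proof.
  rewrite <- (scal_zero_l (K := C_AbsRing) (x : E)), (ip_scal_r _ H).
  apply Cmult_0_l.
Qed.

Lemma ip_CS2 {E : ModuleSpace C_AbsRing} (ip : E -> E -> C) (H : is_inner ip) x y :
  (Re (ip x y))^2 + (Im (ip x y))^2 <= Re (ip x x) * Re (ip y y).
Proof.
  set (a := Re (ip x x)). set (b := Re (ip y y)). set (c := ip x y).
  assert (Ha : 0 <= a) by apply (ip_pos _ H).
  assert (Hb : 0 <= b) by apply (ip_pos _ H).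
  destruct (Req_dec b 0) as [Hb0|Hb0].
  - assert (Hy : y = zero).
    { apply (ip_def _ H). apply Ceq; [exact Hb0|]. rewrite (ip_im _ H). reflexivity. }
    unfold c. rewrite Hy, (ip_zero_r _ H). unfold Re, Im; simpl. rewrite Hb0. lra.
  - assert (Hp := ip_pos _ H (plus (scal (RtoC b) x) (scal (Copp (Cconj c)) y))).
    rewrite (ip_plus_l _ H), !(ip_plus_r _ H), !(ip_scal_l _ H), !(ip_scal_r _ H) in Hp.
    rewrite (ip_conj _ H x y) in Hp. fold c in Hp.
    assert (Hx : ip x x = RtoC a) by (apply Ceq; [reflexivity | apply (ip_im _ H)]).
    assert (Hy : ip y y = RtoC b) by (apply Ceq; [reflexivity | apply (ip_im _ H)]).
    rewrite Hx, Hy in Hp.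
    assert (Hq : 0 <= b * (a * b - ((Re c)^2 + (Im c)^2))).
    { revert Hp. destruct c as [c1 c2]. unfold Re, Im, Cconj, Copp, Cmult, Cplus, RtoC; simpl.
      intros Hp. eapply Rle_trans; [exact Hp|]. right; ring. }
    assert (0 < b) by lra.
    assert (0 <= a * b - ((Re c)^2 + (Im c)^2)).
    { apply Rmult_le_reg_l with b; lra. }
    lra.
Qed.

Lemma ip_norm_ge0 {E : ModuleSpace C_AbsRing} (ip : E -> E -> C) x : 0 <= ip_norm ip x.
Proof. apply sqrt_pos. Qed.

Lemma ip_norm_sq {E : ModuleSpace C_AbsRing} (ip : E -> E -> C) (H : is_inner ip) x :
  ip_norm ip x ^ 2 = Re (ip x x).
Proof. unfold ip_norm. rewrite pow2_sqrt; auto. apply (ip_pos _ H). Qed.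

Lemma ip_CS {E : ModuleSpace C_AbsRing} (ip : E -> E -> C) (H : is_inner ip) x y :
  Cmod (ip x y) <= ip_norm ip x * ip_norm ip y.
Proof.
  unfold Cmod, ip_norm. rewrite <- sqrt_mult by apply (ip_pos _ H).
  apply sqrt_le_1_alt, (ip_CS2 _ H).
Qed.

Lemma ip_norm_triangle {E : ModuleSpace C_AbsRing} (ip : E -> E -> C) (H : is_inner ip) x y :
  ip_norm ip (plus x y) <= ip_norm ip x + ip_norm ip y.
Proof.
  apply Rsqr_incr_0_var.
  2: { generalize (ip_norm_ge0 ip x) (ip_norm_ge0 ip y); lra. }
  rewrite !Rsqr_pow2, (ip_norm_sq _ H), (ip_plus_l _ H), !(ip_plus_r _ H).
  replace ((ip_norm ip x + ip_norm ip y) ^ 2)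
    with (ip_norm ip x ^ 2 + ip_norm ip y ^ 2 + 2 * (ip_norm ip x * ip_norm ip y)) by ring.
  rewrite !(ip_norm_sq _ H), (ip_conj _ H x y).
  assert (h := ip_CS _ H x y). assert (h2 := re_le_Cmod (ip x y)).
  apply Rabs_le_between in h2.
  unfold Cplus, Re, Cconj in *; simpl in *. lra.
Qed.

Lemma ip_norm_scal {E : ModuleSpace C_AbsRing} (ip : E -> E -> C) (H : is_inner ip)
    (c : C_AbsRing) (x : E) : ip_norm ip (scal c x) <= abs c * ip_norm ip x.
Proof.
  right. apply Rsqr_inj.
  - apply ip_norm_ge0.
  - apply Rmult_le_pos; [apply abs_ge_0 | apply ip_norm_ge0].
  - rewrite !Rsqr_pow2, Rpow_mult_distr, !(ip_norm_sq _ H).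
    rewrite (ip_scal_l _ H), (ip_scal_r _ H).
    assert (Hx : ip x x = RtoC (Re (ip x x))).
    { apply Ceq; [reflexivity | apply (ip_im _ H)]. }
    change (abs c) with (Cmod c). rewrite Hx. generalize (Re (ip x x)); intros a.
    unfold Cmod. rewrite pow2_sqrt by nra.
    destruct c; unfold Re, RtoC, Cconj, Cmult; simpl; ring.
Qed.

Lemma ip_norm_zero {E : ModuleSpace C_AbsRing} (ip : E -> E -> C) (H : is_inner ip) :
  ip_norm ip zero = 0.
Proof. unfold ip_norm. rewrite (ip_zero_r _ H). apply sqrt_0. Qed.

Lemma ip_norm_eq0 {E : ModuleSpace C_AbsRing} (ip : E -> E -> C) (H : is_inner ip) x :
  ip_norm ip x = 0 -> x = zero.
Proof.
  intros h. apply (ip_def _ H). apply Ceq; [|apply (ip_im _ H)].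
  rewrite <- (ip_norm_sq _ H), h. unfold Re; simpl; ring.
Qed.

Lemma ip_norm_opp {E : ModuleSpace C_AbsRing} (ip : E -> E -> C) (H : is_inner ip) x :
  ip_norm ip (opp x) = ip_norm ip x.
Proof.
  assert (forall y, ip_norm ip (opp y) <= ip_norm ip y) as h.
  { intros y. rewrite <- (scal_opp_one (K := C_AbsRing) y).
    eapply Rle_trans; [apply (ip_norm_scal _ H)|].
    rewrite abs_opp_one. lra. }
  apply Rle_antisym; auto. rewrite <- (opp_opp x) at 1. auto.
Qed.

Lemma ip_ball_center {E : ModuleSpace C_AbsRing} (ip : E -> E -> C) (H : is_inner ip)
    (x : E) (e : posreal) : ip_norm ip (minus x x) < e.
Proof.
  rewrite minus_eq_zero. eapply Rle_lt_trans; [right; exact (ip_norm_zero _ H)|].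
  apply cond_pos.
Qed.

Lemma ip_ball_sym {E : ModuleSpace C_AbsRing} (ip : E -> E -> C) (H : is_inner ip)
    (x y : E) (e : R) : ip_norm ip (minus y x) < e -> ip_norm ip (minus x y) < e.
Proof. rewrite <- (ip_norm_opp _ H), opp_minus. trivial. Qed.

Lemma ip_ball_triangle {E : ModuleSpace C_AbsRing} (ip : E -> E -> C) (H : is_inner ip)
    (x y z : E) (e1 e2 : R) : ip_norm ip (minus y x) < e1 ->
  ip_norm ip (minus z y) < e2 -> ip_norm ip (minus z x) < e1 + e2.
Proof.
  intros h1 h2. rewrite (minus_trans y z x).
  eapply Rle_lt_trans; [apply (ip_norm_triangle _ H)|]. lra.
Qed.

Definition ip_UniformSpace_mixin {E : ModuleSpace C_AbsRing} (ip : E -> E -> C)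
    (H : is_inner ip) : UniformSpace.mixin_of E :=
  UniformSpace.Mixin E zero (fun x e y => ip_norm ip (minus y x) < e)
    (ip_ball_center _ H) (ip_ball_sym _ H) (ip_ball_triangle _ H).

Definition CSeries (a : nat -> C) : C :=
  (Series (fun n => Re (a n)), Series (fun n => Im (a n))).

Lemma ex_CSeries_le (a : nat -> C) (b : nat -> R) :
  (forall n, Cmod (a n) <= b n) -> ex_series b ->
  ex_series (fun n => Re (a n)) /\ ex_series (fun n => Im (a n)).
Proof.
  intros h hb. split; apply (ex_series_le (K := R_AbsRing) (V := R_CompleteNormedModule)) with b;
    trivial; intros n; (eapply Rle_trans; [|apply h]).
  - apply re_le_Cmod.
  - eapply Rle_trans; [|apply (Rmax_Cmod (a n))]. apply Rmax_r.
Qed.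

Lemma ex_series_scal_R (c : R) (a : nat -> R) :
  ex_series a -> ex_series (fun n => c * a n).
Proof. exact (ex_series_scal (K := R_AbsRing) (V := R_NormedModule) c a). Qed.

Lemma Series_ge0 (a : nat -> R) : (forall n, 0 <= a n) -> ex_series a -> 0 <= Series a.
Proof.
  intros h ha. rewrite <- (Rmult_0_l (Series a)), <- Series_scal_l.
  apply Series_le; trivial. intros n. specialize (h n). lra.
Qed.

Lemma Series_ge_term (a : nat -> R) (n : nat) :
  (forall n, 0 <= a n) -> ex_series a -> a n <= Series a.
Proof.
  intros h ha.
  assert (H : sum_n a n <= Series a).
  { apply (is_lim_seq_incr_compare (sum_n a)).
    - apply Series_correct in ha. exact ha.
    - intros k. rewrite sum_Sn. unfold plus; simpl. specialize (h (S k)). lra. }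
  eapply Rle_trans; [|exact H]. destruct n.
  - rewrite sum_O. lra.
  - rewrite sum_Sn. unfold plus; simpl.
    assert (0 <= sum_n a n); [|lra].
    clear H. induction n; [rewrite sum_O; auto|].
    rewrite sum_Sn. unfold plus; simpl. specialize (h (S n)). lra.
Qed.

Lemma ip_sq_plus {E : ModuleSpace C_AbsRing} (ip : E -> E -> C) (H : is_inner ip) x y :
  ip_norm ip (plus x y) ^ 2 <= 2 * (ip_norm ip x ^ 2 + ip_norm ip y ^ 2).
Proof.
  assert (h := ip_norm_triangle _ H x y).
  assert (h0 := ip_norm_ge0 ip (plus x y)).
  set (p := ip_norm ip (plus x y)) in *. set (a := ip_norm ip x) in *.
  set (b := ip_norm ip y) in *.
  assert (p ^ 2 <= (a + b) ^ 2) by (apply pow_incr; lra).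
  assert (0 <= (a - b) ^ 2) by apply pow2_ge_0. nra.
Qed.

Lemma is_inner_l2 {V E : ModuleSpace C_AbsRing} (ip : E -> E -> C) (j : V -> nat -> E) :
  is_inner ip ->
  (forall x, ex_series (fun n => ip_norm ip (j x n) ^ 2)) ->
  (forall x y n, j (plus x y) n = plus (j x n) (j y n)) ->
  (forall c x n, j (scal c x) n = scal c (j x n)) ->
  (forall x, (forall n, j x n = zero) -> x = zero) ->
  is_inner (fun x y => CSeries (fun n => ip (j x n) (j y n))).
Proof.
  intros H hs hp hc h0.
  assert (hex : forall x y, ex_series (fun n => Re (ip (j x n) (j y n))) /\
                            ex_series (fun n => Im (ip (j x n) (j y n)))).
  { intros x y. apply ex_CSeries_le with
      (fun n => ip_norm ip (j x n) ^ 2 + ip_norm ip (j y n) ^ 2).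
    - intros n. eapply Rle_trans; [apply (ip_CS _ H)|].
      assert (0 <= (ip_norm ip (j x n) - ip_norm ip (j y n)) ^ 2) by apply pow2_ge_0.
      assert (0 <= (ip_norm ip (j x n) + ip_norm ip (j y n)) ^ 2) by apply pow2_ge_0.
      nra.
    - apply (ex_series_plus (V := R_NormedModule)); apply hs. }
  constructor.
  - intros x y z. destruct (hex x y), (hex x z).
    apply Ceq; unfold CSeries, Cplus, Re, Im; simpl;
      rewrite <- Series_plus by assumption; apply Series_ext; intros n;
      rewrite hp, (ip_plus_r _ H); reflexivity.
  - intros c x y. destruct (hex x y) as [h1 h2].
    apply Ceq; unfold CSeries, Cmult; simpl.
    + rewrite <- !Series_scal_l, <- Series_minus.
      * apply Series_ext; intros n; rewrite hc, (ip_scal_r _ H); reflexivity.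
      * apply ex_series_scal_R; exact h1.
      * apply ex_series_scal_R; exact h2.
    + rewrite <- !Series_scal_l, <- Series_plus.
      * apply Series_ext; intros n; rewrite hc, (ip_scal_r _ H); reflexivity.
      * apply ex_series_scal_R; exact h2.
      * apply ex_series_scal_R; exact h1.
  - intros x y. apply Ceq; unfold CSeries, Cconj; simpl.
    + apply Series_ext; intros n. now rewrite (ip_conj _ H (j x n)), re_conj.
    + rewrite <- Series_opp.
      apply Series_ext; intros n. now rewrite (ip_conj _ H (j x n)), im_conj.
  - intros x. apply Series_ge0; [|apply hex]. intros n. apply (ip_pos _ H).
  - intros x hx. apply h0. intros n.
    apply (ip_norm_eq0 _ H). unfold ip_norm.
    replace (Re (ip (j x n) (j x n))) with 0; [apply sqrt_0|].
    apply Rle_antisym; [apply (ip_pos _ H)|].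
    replace 0 with (Series (fun n => Re (ip (j x n) (j x n)))).
    + apply (Series_ge_term (fun n => Re (ip (j x n) (j x n)))); [|apply hex].
      intros k; apply (ip_pos _ H).
    + exact (f_equal Re hx).
Qed.

Record fock := mk_fock {
  coef :> nat -> C;
  coef_sq : ex_series (fun n => Cmod (coef n) ^ 2)
}.

Lemma fock_ext (x y : fock) : (forall n, x n = y n) -> x = y.
Proof.
  destruct x as [x hx], y as [y hy]; simpl; intros h.
  apply functional_extensionality in h. subst y. f_equal. apply proof_irrelevance.
Qed.

Definition C_ip (x y : C) : C := Cmult (Cconj x) y.

Lemma C_ip_inner : is_inner (E := C_ModuleSpace) C_ip.
Proof.
  constructor; unfold C_ip.
  - intros x y z. apply Cmult_plus_distr_l.
  - intros c x y. change (Cmult (Cconj x) (Cmult c y) = Cmult c (Cmult (Cconj x) y)). ring.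
  - intros x y. rewrite Cmult_conj, Cconj_conj. ring.
  - intros [a b]. unfold Re, Cmult, Cconj; simpl. nra.
  - intros [a b] h. injection h as h1 h2.
    assert (a = 0 /\ b = 0) as [-> ->] by (split; nra). reflexivity.
Qed.

Lemma C_ip_norm (x : C) : ip_norm (E := C_ModuleSpace) C_ip x = Cmod x.
Proof.
  unfold ip_norm, Cmod. f_equal. destruct x; unfold C_ip, Re, Cmult, Cconj; simpl. ring.
Qed.

Lemma sq_plus (x y : nat -> C) :
  ex_series (fun n => Cmod (x n) ^ 2) -> ex_series (fun n => Cmod (y n) ^ 2) ->
  ex_series (fun n => Cmod (Cplus (x n) (y n)) ^ 2).
Proof.
  intros hx hy.
  apply (ex_series_le (K := R_AbsRing) (V := R_CompleteNormedModule)) with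
    (fun n => 2 * (Cmod (x n) ^ 2 + Cmod (y n) ^ 2)).
  - intros n. unfold norm; simpl. unfold abs; simpl. rewrite Rabs_pos_eq by nra.
    generalize (ip_sq_plus _ C_ip_inner (x n) (y n)). now rewrite !C_ip_norm.
  - apply (ex_series_scal_R 2).
    now apply (ex_series_plus (V := R_NormedModule)).
Qed.

Lemma sq_scal (c : C) (x : nat -> C) : ex_series (fun n => Cmod (x n) ^ 2) ->
  ex_series (fun n => Cmod (Cmult c (x n)) ^ 2).
Proof.
  intros hx. apply ex_series_ext with (fun n => Cmod c ^ 2 * Cmod (x n) ^ 2).
  - intros n. rewrite Cmod_mult. symmetry; apply Rpow_mult_distr.
  - now apply ex_series_scal_R.
Qed.

Lemma sq_opp (x : nat -> C) : ex_series (fun n => Cmod (x n) ^ 2) ->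
  ex_series (fun n => Cmod (Copp (x n)) ^ 2).
Proof. apply ex_series_ext. intros n. now rewrite Cmod_opp. Qed.

Lemma sq_finite (N : nat) (x : nat -> C) : (forall n, (N <= n)%nat -> x n = RtoC 0) ->
  ex_series (fun n => Cmod (x n) ^ 2).
Proof.
  intros h. apply (ex_series_incr_n _ N).
  exists 0. apply is_series_ext with (fun _ : nat => 0).
  - intros n. rewrite h by lia. rewrite Cmod_0. change (0 = 0 ^ 2). ring.
  - apply filterlim_ext with (fun _ : nat => 0).
    + intros n. rewrite sum_n_const. change (0 = INR (S n) * 0). ring.
    + apply filterlim_const.
Qed.

Definition fock_plus (x y : fock) : fock := mk_fock _ (sq_plus x y (coef_sq x) (coef_sq y)).
Definition fock_scal (c : C) (x : fock) : fock := mk_fock _ (sq_scal c x (coef_sq x)).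
Definition fock_opp (x : fock) : fock := mk_fock _ (sq_opp x (coef_sq x)).
Definition fock_zero : fock := mk_fock _ (sq_finite 0 (fun _ => RtoC 0) (fun _ _ => eq_refl)).

Lemma fock_plus_comm x y : fock_plus x y = fock_plus y x.
Proof. apply fock_ext; intros n; apply Cplus_comm. Qed.
Lemma fock_plus_assoc x y z : fock_plus x (fock_plus y z) = fock_plus (fock_plus x y) z.
Proof. apply fock_ext; intros n; apply Cplus_assoc. Qed.
Lemma fock_plus_0 x : fock_plus x fock_zero = x.
Proof. apply fock_ext; intros n; apply Cplus_0_r. Qed.
Lemma fock_plus_opp x : fock_plus x (fock_opp x) = fock_zero.
Proof. apply fock_ext; intros n; apply Cplus_opp_r. Qed.
Lemma fock_scal_assoc (a b : C) x : fock_scal a (fock_scal b x) = fock_scal (Cmult a b) x.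
Proof. apply fock_ext; intros n; apply Cmult_assoc. Qed.
Lemma fock_scal_1 x : fock_scal (RtoC 1) x = x.
Proof. apply fock_ext; intros n; apply Cmult_1_l. Qed.
Lemma fock_scal_plus_r (a : C) x y :
  fock_scal a (fock_plus x y) = fock_plus (fock_scal a x) (fock_scal a y).
Proof. apply fock_ext; intros n; apply Cmult_plus_distr_l. Qed.
Lemma fock_scal_plus_l (a b : C) x :
  fock_scal (Cplus a b) x = fock_plus (fock_scal a x) (fock_scal b x).
Proof. apply fock_ext; intros n; apply Cmult_plus_distr_r. Qed.

Definition fock_AbelianMonoid_mixin :=
  AbelianMonoid.Mixin fock fock_plus fock_zero fock_plus_comm fock_plus_assoc fock_plus_0.
Canonical fock_AbelianMonoid := AbelianMonoid.Pack fock fock_AbelianMonoid_mixin fock.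
Definition fock_AbelianGroup_mixin :=
  AbelianGroup.Mixin fock_AbelianMonoid fock_opp fock_plus_opp.
Canonical fock_AbelianGroup := AbelianGroup.Pack fock
  (AbelianGroup.Class fock fock_AbelianMonoid_mixin fock_AbelianGroup_mixin) fock.
Definition fock_ModuleSpace_mixin :=
  ModuleSpace.Mixin C_AbsRing fock_AbelianGroup fock_scal fock_scal_assoc fock_scal_1
    fock_scal_plus_r fock_scal_plus_l.
Canonical fock_ModuleSpace := ModuleSpace.Pack C_AbsRing fock
  (ModuleSpace.Class C_AbsRing fock (AbelianGroup.class fock_AbelianGroup)
     fock_ModuleSpace_mixin) fock.

Definition fock_ip (x y : fock) : C := CSeries (fun n => C_ip (x n) (y n)).

Lemma fock_ip_inner : is_inner fock_ip.
Proof.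
  apply (is_inner_l2 (V := fock_ModuleSpace) (E := C_ModuleSpace) C_ip coef).
  - apply C_ip_inner.
  - intros x. generalize (coef_sq x). apply ex_series_ext. intros n. now rewrite C_ip_norm.
  - reflexivity.
  - reflexivity.
  - intros x h. now apply fock_ext.
Qed.

Canonical fock_UniformSpace :=
  UniformSpace.Pack fock (ip_UniformSpace_mixin fock_ip fock_ip_inner) fock.
Canonical fock_NormedModuleAux := NormedModuleAux.Pack C_AbsRing fock
  (NormedModuleAux.Class C_AbsRing fock (ModuleSpace.class _ fock_ModuleSpace)
     (UniformSpace.class fock_UniformSpace)) fock.
Lemma fock_norm_ball (x y : fock) (e : posreal) :
  ball x e y -> ip_norm fock_ip (minus y x) < 1 * e.
Proof. rewrite Rmult_1_l. exact (fun h => h). Qed.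
Definition fock_NormedModule_mixin : NormedModule.mixin_of C_AbsRing fock_NormedModuleAux :=
  NormedModule.Mixin C_AbsRing fock_NormedModuleAux (ip_norm fock_ip) 1
    (ip_norm_triangle _ fock_ip_inner) (ip_norm_scal _ fock_ip_inner)
    (fun x y e h => h) fock_norm_ball (ip_norm_eq0 _ fock_ip_inner).
Canonical fock_NormedModule := NormedModule.Pack C_AbsRing fock
  (NormedModule.Class C_AbsRing fock (NormedModuleAux.class _ fock_NormedModuleAux)
     fock_NormedModule_mixin) fock.

Lemma basis_sq (n : nat) :
  ex_series (fun m => Cmod (if Nat.eqb m n then RtoC 1 else RtoC 0) ^ 2).
Proof.
  apply (sq_finite (S n)). intros m h.
  destruct (Nat.eqb_spec m n); [lia | reflexivity].
Qed.

Definition basis (n : nat) : fock :=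
  mk_fock (fun m => if Nat.eqb m n then RtoC 1 else RtoC 0) (basis_sq n).

(* Coquelicot's [is_linear] includes boundedness. *)
Record bounded_op := mk_bop {
  bop_fun :> fock -> fock;
  bop_lin : is_linear bop_fun
}.

Lemma bop_ext (X Y : bounded_op) : (forall x, X x = Y x) -> X = Y.
Proof.
  destruct X as [X hX], Y as [Y hY]; simpl; intros h.
  apply functional_extensionality in h. subst Y. f_equal. apply proof_irrelevance.
Qed.

Lemma lin_plus (X Y : fock -> fock) : is_linear X -> is_linear Y ->
  is_linear (fun x => plus (X x) (Y x)).
Proof.
  intros [hX1 hX2 [M [hM0 hM]]] [hY1 hY2 [M' [hM0' hM']]]. split.
  - intros x y. rewrite hX1, hY1. rewrite <- !plus_assoc. f_equal.
    rewrite !plus_assoc. f_equal. apply plus_comm.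
  - intros c x. rewrite hX2, hY2. symmetry. apply fock_scal_plus_r.
  - exists (M + M'). split; [lra|]. intros x.
    eapply Rle_trans; [apply (norm_triangle (V := fock_NormedModule))|].
    specialize (hM x). specialize (hM' x). lra.
Qed.

Lemma lin_scal (c : C) (X : fock -> fock) : is_linear X -> is_linear (fun x => scal c (X x)).
Proof.
  intros [hX1 hX2 [M [hM0 hM]]]. split.
  - intros x y. rewrite hX1. apply fock_scal_plus_r.
  - intros d x. rewrite hX2. etransitivity; [apply fock_scal_assoc|].
    rewrite Cmult_comm. symmetry. apply fock_scal_assoc.
  - exists (Cmod c * M + 1). assert (h := Cmod_ge_0 c). split; [nra|]. intros x.
    eapply Rle_trans; [apply (norm_scal (K := C_AbsRing) c (X x))|].
    change (abs c) with (Cmod c). specialize (hM x). assert (h2 := norm_ge_0 x). nra.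
Qed.

Lemma lin_opp (X : fock -> fock) : is_linear X -> is_linear (fun x => opp (X x)).
Proof.
  intros [hX1 hX2 [M [hM0 hM]]]. split.
  - intros x y. rewrite hX1. apply fock_ext; intros n; apply Copp_plus_distr.
  - intros d x. rewrite hX2. apply fock_ext; intros n.
    change (Copp (Cmult d (X x n)) = Cmult d (Copp (X x n))). ring.
  - exists M. split; trivial. intros x.
    rewrite (norm_opp (V := fock_NormedModule)). apply hM.
Qed.

Lemma lin_zero : is_linear (fun _ : fock => zero : fock).
Proof.
  split.
  - intros. symmetry. apply fock_plus_0.
  - intros c x. apply fock_ext; intros n.
    symmetry. apply Cmult_0_r.
  - exists 1. split; [lra|]. intros x.
    rewrite Rmult_1_l. eapply Rle_trans; [|apply norm_ge_0].
    right. exact (norm_zero (V := fock_NormedModule)).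
Qed.

Lemma lin_id : is_linear (fun x : fock => x).
Proof. split; trivial. exists 1. split; [lra|]. intros; lra. Qed.

Definition bop_plus (X Y : bounded_op) : bounded_op :=
  mk_bop _ (lin_plus X Y (bop_lin X) (bop_lin Y)).
Definition bop_scal (c : C) (X : bounded_op) : bounded_op := mk_bop _ (lin_scal c X (bop_lin X)).
Definition bop_opp (X : bounded_op) : bounded_op := mk_bop _ (lin_opp X (bop_lin X)).
Definition bop_zero : bounded_op := mk_bop _ lin_zero.
Definition bop_one : bounded_op := mk_bop _ lin_id.

Lemma bop_plus_comm X Y : bop_plus X Y = bop_plus Y X.
Proof. apply bop_ext; intros x; apply plus_comm. Qed.
Lemma bop_plus_assoc X Y Z : bop_plus X (bop_plus Y Z) = bop_plus (bop_plus X Y) Z.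
Proof. apply bop_ext; intros x; apply plus_assoc. Qed.
Lemma bop_plus_0 X : bop_plus X bop_zero = X.
Proof. apply bop_ext; intros x; apply plus_zero_r. Qed.
Lemma bop_plus_opp X : bop_plus X (bop_opp X) = bop_zero.
Proof. apply bop_ext; intros x; exact (fock_plus_opp (X x)). Qed.
Lemma bop_scal_assoc (a b : C) X : bop_scal a (bop_scal b X) = bop_scal (Cmult a b) X.
Proof. apply bop_ext; intros x. apply fock_scal_assoc. Qed.
Lemma bop_scal_1 X : bop_scal (RtoC 1) X = X.
Proof. apply bop_ext; intros x; apply fock_scal_1. Qed.
Lemma bop_scal_plus_r (a : C) X Y :
  bop_scal a (bop_plus X Y) = bop_plus (bop_scal a X) (bop_scal a Y).
Proof. apply bop_ext; intros x; apply fock_scal_plus_r. Qed.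
Lemma bop_scal_plus_l (a b : C) X :
  bop_scal (Cplus a b) X = bop_plus (bop_scal a X) (bop_scal b X).
Proof. apply bop_ext; intros x; apply fock_scal_plus_l. Qed.

Definition bop_AbelianMonoid_mixin :=
  AbelianMonoid.Mixin bounded_op bop_plus bop_zero bop_plus_comm bop_plus_assoc bop_plus_0.
Canonical bop_AbelianMonoid := AbelianMonoid.Pack bounded_op bop_AbelianMonoid_mixin bounded_op.
Definition bop_AbelianGroup_mixin :=
  AbelianGroup.Mixin bop_AbelianMonoid bop_opp bop_plus_opp.
Canonical bop_AbelianGroup := AbelianGroup.Pack bounded_op
  (AbelianGroup.Class bounded_op bop_AbelianMonoid_mixin bop_AbelianGroup_mixin) bounded_op.
Definition bop_ModuleSpace_mixin :=
  ModuleSpace.Mixin C_AbsRing bop_AbelianGroup bop_scal bop_scal_assoc bop_scal_1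
    bop_scal_plus_r bop_scal_plus_l.
Canonical bop_ModuleSpace := ModuleSpace.Pack C_AbsRing bounded_op
  (ModuleSpace.Class C_AbsRing bounded_op (AbelianGroup.class bop_AbelianGroup)
     bop_ModuleSpace_mixin) bounded_op.

Record hs := mk_hs {
  hs_op :> bounded_op;
  hs_sq : ex_series (fun n => norm (hs_op (basis n)) ^ 2)
}.

Lemma hs_ext (X Y : hs) : (forall x, X x = Y x) -> X = Y.
Proof.
  destruct X as [X hX], Y as [Y hY]; simpl; intros h.
  apply bop_ext in h. subst Y. f_equal. apply proof_irrelevance.
Qed.

Lemma hs_sq_plus (X Y : hs) : ex_series (fun n => norm (plus (X : bounded_op) Y (basis n)) ^ 2).
Proof.
  apply (ex_series_le (K := R_AbsRing) (V := R_CompleteNormedModule)) with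
    (fun n => 2 * (norm (X (basis n)) ^ 2 + norm (Y (basis n)) ^ 2)).
  - intros n. unfold norm at 1; simpl. unfold abs; simpl.
    rewrite Rabs_pos_eq by nra.
    exact (ip_sq_plus _ fock_ip_inner (X (basis n)) (Y (basis n))).
  - apply (ex_series_scal_R 2).
    apply (ex_series_plus (V := R_NormedModule)); apply hs_sq.
Qed.

Lemma fock_norm_scal (c : C) (x : fock) : norm (fock_scal c x) ^ 2 = Cmod c ^ 2 * norm x ^ 2.
Proof.
  change (ip_norm fock_ip (scal c x) ^ 2 = Cmod c ^ 2 * ip_norm fock_ip x ^ 2).
  rewrite !(ip_norm_sq _ fock_ip_inner), (ip_scal_l _ fock_ip_inner), (ip_scal_r _ fock_ip_inner).
  assert (Hx : fock_ip x x = RtoC (Re (fock_ip x x))).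
  { apply Ceq; [reflexivity | apply (ip_im _ fock_ip_inner)]. }
  rewrite Hx. generalize (Re (fock_ip x x)); intros a.
  unfold Cmod. rewrite pow2_sqrt by nra.
  destruct c; unfold Re, RtoC, Cconj, Cmult; simpl; ring.
Qed.

Lemma hs_sq_scal (c : C) (X : hs) : ex_series (fun n => norm (bop_scal c X (basis n)) ^ 2).
Proof.
  apply ex_series_ext with (fun n => Cmod c ^ 2 * norm (X (basis n)) ^ 2).
  - intros n. symmetry. apply fock_norm_scal.
  - apply ex_series_scal_R, hs_sq.
Qed.

Lemma hs_sq_opp (X : hs) : ex_series (fun n => norm (opp (X : bounded_op) (basis n)) ^ 2).
Proof.
  generalize (hs_sq X). apply ex_series_ext. intros n. f_equal. symmetry.
  exact (norm_opp (V := fock_NormedModule) (X (basis n))).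
Qed.

Lemma hs_sq_zero : ex_series (fun n => norm (bop_zero (basis n)) ^ 2).
Proof.
  apply ex_series_ext with (fun _ => Cmod (RtoC 0) ^ 2).
  - intros n. rewrite Cmod_0. f_equal. symmetry. exact (norm_zero (V := fock_NormedModule)).
  - exact (coef_sq fock_zero).
Qed.

Definition hs_plus (X Y : hs) : hs := mk_hs _ (hs_sq_plus X Y).
Definition hs_scal (c : C) (X : hs) : hs := mk_hs _ (hs_sq_scal c X).
Definition hs_opp (X : hs) : hs := mk_hs _ (hs_sq_opp X).
Definition hs_zero : hs := mk_hs _ hs_sq_zero.

Lemma hs_plus_comm X Y : hs_plus X Y = hs_plus Y X.
Proof. apply hs_ext; intros x; apply fock_plus_comm. Qed.
Lemma hs_plus_assoc X Y Z : hs_plus X (hs_plus Y Z) = hs_plus (hs_plus X Y) Z.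
Proof. apply hs_ext; intros x; apply fock_plus_assoc. Qed.
Lemma hs_plus_0 X : hs_plus X hs_zero = X.
Proof. apply hs_ext; intros x; apply fock_plus_0. Qed.
Lemma hs_plus_opp X : hs_plus X (hs_opp X) = hs_zero.
Proof. apply hs_ext; intros x; apply fock_plus_opp. Qed.
Lemma hs_scal_assoc (a b : C) X : hs_scal a (hs_scal b X) = hs_scal (Cmult a b) X.
Proof. apply hs_ext; intros x. apply fock_scal_assoc. Qed.
Lemma hs_scal_1 X : hs_scal (RtoC 1) X = X.
Proof. apply hs_ext; intros x; apply fock_scal_1. Qed.
Lemma hs_scal_plus_r (a : C) X Y :
  hs_scal a (hs_plus X Y) = hs_plus (hs_scal a X) (hs_scal a Y).
Proof. apply hs_ext; intros x; apply fock_scal_plus_r. Qed.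
Lemma hs_scal_plus_l (a b : C) X :
  hs_scal (Cplus a b) X = hs_plus (hs_scal a X) (hs_scal b X).
Proof. apply hs_ext; intros x; apply fock_scal_plus_l. Qed.

Definition hs_AbelianMonoid_mixin :=
  AbelianMonoid.Mixin hs hs_plus hs_zero hs_plus_comm hs_plus_assoc hs_plus_0.
Canonical hs_AbelianMonoid := AbelianMonoid.Pack hs hs_AbelianMonoid_mixin hs.
Definition hs_AbelianGroup_mixin :=
  AbelianGroup.Mixin hs_AbelianMonoid hs_opp hs_plus_opp.
Canonical hs_AbelianGroup := AbelianGroup.Pack hs
  (AbelianGroup.Class hs hs_AbelianMonoid_mixin hs_AbelianGroup_mixin) hs.
Definition hs_ModuleSpace_mixin :=
  ModuleSpace.Mixin C_AbsRing hs_AbelianGroup hs_scal hs_scal_assoc hs_scal_1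
    hs_scal_plus_r hs_scal_plus_l.
Canonical hs_ModuleSpace := ModuleSpace.Pack C_AbsRing hs
  (ModuleSpace.Class C_AbsRing hs (AbelianGroup.class hs_AbelianGroup)
     hs_ModuleSpace_mixin) hs.

(* Tr(X^* Y) = \sum_n <X e_n, Y e_n> *)
Definition hs_ip (X Y : hs) : C :=
  CSeries (fun n => fock_ip (X (basis n)) (Y (basis n))).

Lemma fock_trunc_norm (x : fock) (N : nat) (y : fock) :
  (forall n, (n < N)%nat -> y n = RtoC 0) -> (forall n, (N <= n)%nat -> y n = x n) ->
  norm y ^ 2 = Series (fun n => Cmod (x (N + n)%nat) ^ 2).
Proof.
  intros h1 h2. change (norm y) with (ip_norm fock_ip y).
  rewrite (ip_norm_sq _ fock_ip_inner).
  change (Series (fun n => Re (C_ip (y n) (y n))) = Series (fun n => Cmod (x (N + n)%nat) ^ 2)).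
  assert (he : forall n, Re (C_ip (y n) (y n)) = Cmod (y n) ^ 2).
  { intros n. now rewrite <- C_ip_norm, (ip_norm_sq _ C_ip_inner). }
  rewrite (Series_ext _ _ he).
  destruct N.
  - apply Series_ext. intros n. rewrite h2 by lia. reflexivity.
  - rewrite (Series_incr_n _ (S N)); [|lia|apply coef_sq].
    replace (sum_f_R0 _ _) with 0.
    + rewrite Rplus_0_l. apply Series_ext. intros n. rewrite h2 by lia. reflexivity.
    + symmetry. apply sum_eq_R0. intros n hn. simpl in hn. rewrite h1 by lia.
      rewrite Cmod_0. ring.
Qed.

Lemma Series_tail (a : nat -> R) (e : R) : ex_series a -> 0 < e ->
  exists N, Rabs (Series (fun n => a (N + n)%nat)) < e.
Proof.
  intros ha he.
  assert (h := Series_correct _ ha).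
  assert (hb : locally (Series a) (ball (Series a) (mkposreal e he))) by apply locally_ball.
  destruct (h _ hb) as [N hN]. specialize (hN N (Nat.le_refl N)).
  exists (S N). rewrite (Series_incr_n a (S N)) in hN; [|lia|assumption].
  rewrite <- sum_n_Reals in hN. simpl pred in hN.
  unfold ball in hN; simpl in hN. unfold AbsRing_ball, abs, minus, plus, opp in hN; simpl in hN.
  rewrite <- Rabs_Ropp. eapply Rle_lt_trans; [|exact hN]. right. f_equal.
  change (fun n => a (S N + n)%nat) with (fun n => a (S (N + n))).
  set (u := sum_n a N). set (v := Series _).
  change (- v = u + - (u + v)). ring.
Qed.

Lemma bop_zero_on_basis (X : bounded_op) : (forall n, X (basis n) = zero) -> forall x, X x = zero.
Proof.
  intros h0 x. destruct (bop_lin X) as [hp hc [M [hM0 hM]]].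
  assert (hdec : forall N, exists y, X y = X x /\
     (forall n, (n < N)%nat -> y n = RtoC 0) /\ (forall n, (N <= n)%nat -> y n = x n)).
  { induction N as [|N [y [hy1 [hy2 hy3]]]].
    - exists x. repeat split; trivial. intros; lia.
    - exists (plus y (scal (Copp (y N)) (basis N))). split; [|split].
      + rewrite hp, hc, h0, <- hy1. apply fock_ext; intros n.
        change (Cplus (X y n) (Cmult (Copp (y N)) (RtoC 0)) = X y n). ring.
      + intros n hn. change (Cplus (y n) (Cmult (Copp (y N))
           (if Nat.eqb n N then RtoC 1 else RtoC 0)) = RtoC 0).
        destruct (Nat.eqb_spec n N) as [->|]; [ring|]. rewrite hy2 by lia. ring.
      + intros n hn. change (Cplus (y n) (Cmult (Copp (y N))
           (if Nat.eqb n N then RtoC 1 else RtoC 0)) = x n).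
        destruct (Nat.eqb_spec n N); [lia|]. rewrite hy3 by lia. ring. }
  apply (norm_eq_zero (V := fock_NormedModule)).
  destruct (Req_dec (norm (X x)) 0) as [|hn]; trivial. exfalso.
  assert (hpos : 0 < norm (X x)) by (generalize (norm_ge_0 (X x)); lra).
  destruct (Series_tail (fun n => Cmod (x n) ^ 2) ((norm (X x) / M) ^ 2)) as [N hN].
  - apply coef_sq.
  - apply pow_lt, Rdiv_lt_0_compat; lra.
  - destruct (hdec N) as [y [hy1 [hy2 hy3]]].
    rewrite <- (fock_trunc_norm x N y hy2 hy3) in hN.
    assert (h1 := hM y). rewrite hy1 in h1.
    apply Rabs_def2 in hN. destruct hN as [hN _].
    assert (norm (X x) / M <= norm y).
    { apply Rmult_le_reg_l with M; trivial. field_simplify; lra. }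
    assert ((norm (X x) / M) ^ 2 <= norm y ^ 2).
    { apply pow_incr. split; trivial. apply Rlt_le, Rdiv_lt_0_compat; lra. }
    lra.
Qed.

Lemma hs_ip_inner : is_inner hs_ip.
Proof.
  apply (is_inner_l2 (V := hs_ModuleSpace) (E := fock_ModuleSpace) fock_ip
           (fun X n => X (basis n))).
  - apply fock_ip_inner.
  - intros X. exact (hs_sq X).
  - reflexivity.
  - reflexivity.
  - intros X h. apply hs_ext. exact (bop_zero_on_basis X h).
Qed.

Canonical hs_UniformSpace :=
  UniformSpace.Pack hs (ip_UniformSpace_mixin hs_ip hs_ip_inner) hs.
Canonical hs_NormedModuleAux := NormedModuleAux.Pack C_AbsRing hs
  (NormedModuleAux.Class C_AbsRing hs (ModuleSpace.class _ hs_ModuleSpace)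
     (UniformSpace.class hs_UniformSpace)) hs.
Lemma hs_norm_ball (x y : hs) (e : posreal) :
  ball x e y -> ip_norm hs_ip (minus y x) < 1 * e.
Proof. rewrite Rmult_1_l. exact (fun h => h). Qed.
Definition hs_NormedModule_mixin : NormedModule.mixin_of C_AbsRing hs_NormedModuleAux :=
  NormedModule.Mixin C_AbsRing hs_NormedModuleAux (ip_norm hs_ip) 1
    (ip_norm_triangle _ hs_ip_inner) (ip_norm_scal _ hs_ip_inner)
    (fun x y e h => h) hs_norm_ball (ip_norm_eq0 _ hs_ip_inner).
Canonical hs_NormedModule := NormedModule.Pack C_AbsRing hs
  (NormedModule.Class C_AbsRing hs (NormedModuleAux.class _ hs_NormedModuleAux)
     hs_NormedModule_mixin) hs.

(* [a], [a^dagger] and their polynomials act on arbitrary coefficient sequences; on the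
   finitely supported ones (the span of the e_n) these are the operators on the Fock space. *)
Definition annih (x : nat -> C) : nat -> C :=
  fun n => Cmult (RtoC (sqrt (INR (S n)))) (x (S n)).

Definition creat (x : nat -> C) : nat -> C := fun n =>
  match n with
  | O => RtoC 0
  | S m => Cmult (RtoC (sqrt (INR (S m)))) (x m)
  end.

Inductive ncpoly :=
  | nc_const (c : C)
  | nc_annih
  | nc_creat
  | nc_add (P Q : ncpoly)
  | nc_mul (P Q : ncpoly).

Fixpoint nc_eval (P : ncpoly) (x : nat -> C) : nat -> C :=
  match P with
  | nc_const c => fun n => Cmult c (x n)
  | nc_annih => annih x
  | nc_creat => creat x
  | nc_add P Q => fun n => Cplus (nc_eval P x n) (nc_eval Q x n)
  | nc_mul P Q => nc_eval P (nc_eval Q x)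
  end.

Definition weyl_exponent (z : C) (x : nat -> C) : nat -> C :=
  fun n => Cminus (Cmult z (creat x n)) (Cmult (Cconj z) (annih x n)).

(* W = exp (z a^dagger - conj z a): the e_n are analytic vectors of the exponent, so the
   exponential series converges on them in norm and determines the bounded operator W. *)
Definition is_weyl (z : C) (W : bounded_op) : Prop :=
  forall n, exists u : nat -> fock,
    (forall k m, u k m =
       Cmult (RtoC (/ INR (fact k))) (Nat.iter k (weyl_exponent z) (basis n) m)) /\
    is_series u (W (basis n)).

Definition Cnonneg (z : C) : Prop := 0 <= Re z /\ Im z = 0.

(* X \mapsto Tr (omega X), with omega = \sum_k |y_k><x_k| an arbitrary trace class operator;
   these are the weak-star continuous functionals. *)
Definition normal_functional (phi : bounded_op -> C) : Prop :=
  exists x y : nat -> fock,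
    ex_series (fun k => norm (x k) ^ 2) /\ ex_series (fun k => norm (y k) ^ 2) /\
    forall X : bounded_op,
      is_series (V := C_NormedModule) (fun k => fock_ip (x k) (X (y k))) (phi X).

Definition normal_map (F : bounded_op -> bounded_op) : Prop :=
  forall phi, normal_functional phi -> normal_functional (fun X => phi (F X)).

Definition positive_op (X : bounded_op) : Prop := forall x, Cnonneg (fock_ip x (X x)).

(* Positivity of the block operator (X_ij)_{0 <= i, j <= k} on the direct sum of k + 1
   copies of the Fock space. *)
Definition positive_block (k : nat) (X : nat -> nat -> bounded_op) : Prop :=
  forall x : nat -> fock,
    Cnonneg (sum_n (G := C_AbelianMonoid) (fun i =>
      sum_n (G := C_AbelianMonoid) (fun j => fock_ip (x i) (X i j (x j))) k) k).

Definition completely_positive (F : bounded_op -> bounded_op) : Prop :=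
  forall k X, positive_block k X -> positive_block k (fun i j => F (X i j)).

Record is_qms (T : R -> bounded_op -> bounded_op) : Prop := {
  qms_plus : forall t X Y, 0 <= t -> T t (plus X Y) = plus (T t X) (T t Y);
  qms_scal : forall t (c : C) X, 0 <= t -> T t (scal c X) = scal c (T t X);
  qms_normal : forall t, 0 <= t -> normal_map (T t);
  qms_cp : forall t, 0 <= t -> completely_positive (T t);
  qms_one : forall t, 0 <= t -> T t bop_one = bop_one;
  qms_at0 : forall X, T 0 X = X;
  qms_semigroup : forall t u X, 0 <= t -> 0 <= u -> T (t + u) X = T t (T u X);
  qms_cont : forall phi (X : bounded_op) t, normal_functional phi -> 0 <= t ->
    filterlim (fun u => phi (T u X)) (within (Rle 0) (locally t)) (locally (phi (T t X)))
}.

(* Normal states are represented by their functionals X \mapsto Tr (rho X). *)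
Definition normal_state (phi : bounded_op -> C) : Prop :=
  normal_functional phi /\ (forall X, positive_op X -> Cnonneg (phi X)) /\
  phi bop_one = RtoC 1.

Definition invariant_normal_state (T : R -> bounded_op -> bounded_op)
    (phi : bounded_op -> C) : Prop :=
  normal_state phi /\ forall t X, 0 <= t -> phi (T t X) = phi X.

Definition unique_invariant_normal_state (T : R -> bounded_op -> bounded_op)
    (phi : bounded_op -> C) : Prop :=
  invariant_normal_state T phi /\
  forall psi, invariant_normal_state T psi -> forall X, psi X = phi X.

Definition faithful (phi : bounded_op -> C) : Prop :=
  forall X, positive_op X -> phi X = RtoC 0 -> X = zero.

Record gaussian_data := {
  Omega : R; kappa : C; zeta : C; u1 : C; u2 : C; v1 : C; v2 : C
}.

Definition u_sq (g : gaussian_data) : R := Cmod (u1 g) ^ 2 + Cmod (u2 g) ^ 2.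
Definition v_sq (g : gaussian_data) : R := Cmod (v1 g) ^ 2 + Cmod (v2 g) ^ 2.
Definition gamma (g : gaussian_data) : R :=
  / 2 * ((Cmod (v1 g) ^ 2 - Cmod (u1 g) ^ 2) + (Cmod (v2 g) ^ 2 - Cmod (u2 g) ^ 2)).

Definition drift (g : gaussian_data) (z : C) : C :=
  ((Ci * RtoC (Omega g) - RtoC (gamma g)) * z + Ci * kappa g * Cconj z)%C.

Definition diffusion (g : gaussian_data) (z : C) : C :=
  ((RtoC (Cmod (u1 g) ^ 2 + Cmod (v1 g) ^ 2) * z + 2 * v1 g * u1 g * Cconj z) +
   (RtoC (Cmod (u2 g) ^ 2 + Cmod (v2 g) ^ 2) * z + 2 * v2 g * u2 g * Cconj z))%C.

(* exp (r Z) z *)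
Definition drift_flow (g : gaussian_data) (r : R) (z : C) : C :=
  CSeries (fun k => Cmult (RtoC (r ^ k / INR (fact k))) (Nat.iter k (drift g) z)).

Definition polar_exp (a b : R) : C := Cmult (RtoC (exp a)) (cos b, sin b).

Definition weyl_factor (g : gaussian_data) (t : R) (z : C) : C :=
  polar_exp
    (- (/ 2) * RInt (fun r =>
       Re (Cmult (Cconj (drift_flow g r z)) (diffusion g (drift_flow g r z)))) 0 t)
    (RInt (fun r => Re (Cmult (Cconj (zeta g)) (drift_flow g r z))) 0 t).

Definition gaussian_qms (g : gaussian_data) (W : C -> bounded_op)
    (T : R -> bounded_op -> bounded_op) : Prop :=
  is_qms T /\
  forall t z, 0 <= t -> T t (W z) = scal (weyl_factor g t z) (W (drift_flow g t z)).

Definition drift_matrix (g : gaussian_data) (i j : nat) : R :=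
  match i, j with
  | 0, 0 => - gamma g - Im (kappa g)
  | 0, _ => Re (kappa g) - Omega g
  | _, 0 => Re (kappa g) + Omega g
  | _, _ => - gamma g + Im (kappa g)
  end.

Definition drift_eigenvalue (g : gaussian_data) (l : C) : Prop :=
  exists x y : C, (x <> RtoC 0 \/ y <> RtoC 0) /\
    (RtoC (drift_matrix g 0 0) * x + RtoC (drift_matrix g 0 1) * y = l * x)%C /\
    (RtoC (drift_matrix g 1 0) * x + RtoC (drift_matrix g 1 1) * y = l * y)%C.

Definition stable (g : gaussian_data) : Prop :=
  forall l, drift_eigenvalue g l -> Re l < 0.

(* beta > 0 excludes the degenerate values u_sq g = 0 and v_sq g = 0, for which the
   conventions ln 0 = 0 and x / 0 = 0 give beta = 0. *)
Record standardized (g : gaussian_data) (beta : R) : Prop := {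
  std_zeta : zeta g = RtoC 0;
  std_beta : beta = - ln (u_sq g / v_sq g);
  std_pos : 0 < beta;
  std_kappa : kappa g = (Ci * RtoC (tanh (beta / 2)) * (u1 g * v1 g + u2 g * v2 g))%C
}.

(* Eigenvalue on e_n of rho = (1 - e^{-beta}) e^{-beta N} *)
Definition rho (beta : R) (n : nat) : R := (1 - exp (- beta)) * exp (- beta * INR n).

(* X \mapsto Tr (rho X) *)
Definition rho_state (beta : R) (X : bounded_op) : C :=
  CSeries (fun n => Cmult (RtoC (rho beta n)) (fock_ip (basis n) (X (basis n)))).

(* Y = rho^{s/2} A rho^{(1-s)/2}, where [A n] lists the coefficients of A e_n *)
Definition is_embedding (beta s : R) (A : nat -> nat -> C) (Y : hs) : Prop :=
  forall n m, Y (basis n) m =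
    Cmult (RtoC (Rpower (rho beta m) (s / 2)))
      (Cmult (RtoC (Rpower (rho beta n) ((1 - s) / 2))) (A n m)).

Definition embedded_polynomial (beta s : R) (Y : hs) : Prop :=
  exists P : ncpoly, is_embedding beta s (fun n => nc_eval P (basis n)) Y.

Record contraction_semigroup {E : NormedModule C_AbsRing} (S : R -> E -> E) : Prop := {
  cs_linear : forall t, 0 <= t -> is_linear (S t);
  cs_contraction : forall t x, 0 <= t -> norm (S t x) <= norm x;
  cs_at0 : forall x, S 0 x = x;
  cs_semigroup : forall t u x, 0 <= t -> 0 <= u -> S (t + u) x = S t (S u x);
  cs_cont : forall x, filterlim (fun t => S t x) (at_right 0) (locally x)
}.

Definition induced_semigroup (beta s : R) (T : R -> bounded_op -> bounded_op)
    (S : R -> hs -> hs) : Prop :=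
  contraction_semigroup S /\
  forall t (X : bounded_op) Y, 0 <= t -> is_embedding beta s (fun n => X (basis n)) Y ->
    is_embedding beta s (fun n => T t X (basis n)) (S t Y).

(* Unbounded operators are represented by their graphs. *)
Definition graph (E : Type) := E -> E -> Prop.

Definition dom {E : Type} (A : graph E) (x : E) : Prop := exists y, A x y.

Definition generator {E : NormedModule C_AbsRing} (S : R -> E -> E) : graph E :=
  fun x y => filterlim (fun t => scal (RtoC (/ t)) (minus (S t x) x)) (at_right 0) (locally y).

Definition adjoint {E : Type} (ip : E -> E -> C) (A : graph E) : graph E :=
  fun y w => forall x v, A x v -> ip y v = ip w x.

Definition graph_plus {E : NormedModule C_AbsRing} (A B : graph E) : graph E :=
  fun x y => exists y1 y2, A x y1 /\ B x y2 /\ y = plus y1 y2.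

Definition restrict {E : Type} (A : graph E) (D : E -> Prop) : graph E :=
  fun x y => D x /\ A x y.

Definition dense {E : UniformSpace} (D : E -> Prop) : Prop :=
  forall x (eps : posreal), exists y, D y /\ ball x eps y.

Definition graph_closure {E : UniformSpace} (A : graph E) : graph E :=
  fun x y => forall eps : posreal, exists x' y', A x' y' /\ ball x eps x' /\ ball y eps y'.

Definition symmetric {E : Type} (ip : E -> E -> C) (A : graph E) : Prop :=
  forall x v y w, A x v -> A y w -> ip v y = ip x w.

Definition self_adjoint {E : UniformSpace} (ip : E -> E -> C) (A : graph E) : Prop :=
  dense (dom A) /\ forall x y, A x y <-> adjoint ip A x y.

(* The restriction of A to D, which has to lie in the domain of A, is a densely defined
   symmetric operator with self-adjoint closure. *)
Definition essentially_self_adjoint_on {E : UniformSpace} (ip : E -> E -> C)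
    (A : graph E) (D : E -> Prop) : Prop :=
  (forall x, D x -> dom A x) /\ dense D /\ symmetric ip (restrict A D) /\
  self_adjoint ip (graph_closure (restrict A D)).

(* Main.v *)
Require Import Defs.
From Stdlib Require Import Reals Lra Lia Factorial Classical FunctionalExtensionality.
From Coquelicot Require Import Coquelicot.
Open Scope R_scope.

(** The standardized Gaussian semigroup is a second quantization.  Put
    [nu = 1 / (exp beta - 1)] and let [wick j k] be the embedding of the coefficient of
    [x^j y^k] in [exp (- nu x y) exp (x a^dagger) exp (y a)].  These vectors form an orthogonal
    basis of the Hilbert-Schmidt operators, with squared norm [mode1^j mode2^k / (j! k!)], and
    those with [j + k <= K] span the embedded polynomials of degree at most [K].  The vectors
    [exp ((1 + 2 nu) |z|^2 / 2) rho^{s/2} W(z) rho^{(1-s)/2} = sum z^j (- conj z)^k wick j k] are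
    the exponential vectors of this Fock space, and since [(1 + 2 nu) |z|^2] solves the Lyapunov
    equation of the drift [Z] and the diffusion [C], the induced semigroup maps the exponential
    vector at [z] to the one at [e^{tZ} z].  Comparing homogeneous parts in [z], it leaves the
    finite-dimensional span of the [wick j k] with [j + k = K] invariant, for each [K]; these
    spans being mutually orthogonal, its adjoint does so too.  Hence the symmetric operator
    [A = L^* + L] maps the embedded polynomials of degree at most [K] to themselves.  If [Q_K] is
    the orthogonal projection onto this space and [A^* y = w], then [A (Q_K y) = Q_K w], and
    [K -> oo] puts [(y, w)] in the closure of [A]. *)

(** * Hilbert-Schmidt operators as square-summable matrices *)

(** The value of [nu] is forced. Up to a factor, [j] is raised by
    [X -> (1 + nu) a^dagger X - nu X a^dagger], and moving ladder operators through the powers of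
    [rho] turns the adjoint of this map into [X -> (1 + nu) left_ratio a X - (nu / right_ratio) X
    a]. It is a multiple of the commutator with [a], which lowers [j], exactly when [nu / (1 + nu) =
    left_ratio right_ratio = exp (- beta)]. The parameter [s] drops out of this condition, so the
    same monomials are orthogonal for every [s]; only their norms depend on it, through [mode1] and
    [mode2]. Two obstacles shape the rest. Completeness does not come from a density theorem but
    from explicit limits of the matrix entries of the projections. And the adjoint of the generator
    has to be tested against every vector of the domain, not only against polynomials: that it
    preserves a level rests on the invariance of the orthogonal complement of the level under the
    semigroup, and this again uses completeness. *)

Lemma bounded_nonneg_series (a : nat -> R) (c : R) :
  (forall n, 0 <= a n) -> (forall N, sum_f_R0 a N <= c) -> ex_series a /\ Series a <= c.
Proof.
  intros ha hc.
  destruct (ex_finite_lim_seq_incr (sum_n a) c) as [l hl].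
  - intros n. rewrite sum_Sn. unfold plus; simpl. specialize (ha (S n)). lra.
  - intros n. rewrite sum_n_Reals. apply hc.
  - assert (hs : is_series a l) by exact hl.
    split; [now exists l|]. rewrite (is_series_unique _ _ hs).
    apply (is_lim_seq_le (sum_n a) (fun _ => c) l c); trivial.
    + intros n. rewrite sum_n_Reals. apply hc.
    + apply is_lim_seq_const.
Qed.

Lemma partial_sum_le_Series (a : nat -> R) (N : nat) :
  (forall n, 0 <= a n) -> ex_series a -> sum_f_R0 a N <= Series a.
Proof.
  intros h ha. rewrite <- sum_n_Reals.
  apply (is_lim_seq_incr_compare (sum_n a)).
  - apply Series_correct in ha. exact ha.
  - intros k. rewrite sum_Sn. unfold plus; simpl. specialize (h (S k)). lra.
Qed.

Lemma sum_f_R0_Series (a : nat -> nat -> R) (N : nat) :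
  (forall n, ex_series (a n)) ->
  ex_series (fun m => sum_f_R0 (fun n => a n m) N) /\
  sum_f_R0 (fun n => Series (a n)) N = Series (fun m => sum_f_R0 (fun n => a n m) N).
Proof.
  intros h. induction N as [|N [h1 h2]]; simpl; [split; auto; apply h|]. split.
  - apply (ex_series_plus (V := R_NormedModule)); auto.
  - rewrite h2, <- Series_plus; auto.
Qed.

Lemma Series_single (n : nat) (a : nat -> R) :
  (forall k, k <> n -> a k = 0) -> is_series a (a n).
Proof.
  intros h. change (is_lim_seq (sum_n a) (a n)).
  apply is_lim_seq_ext_loc with (fun _ => a n); [|apply is_lim_seq_const].
  exists n. intros N hN. rewrite sum_n_Reals.
  assert (forall M, (M < n)%nat -> sum_f_R0 a M = 0) as h0.
  { intros M hM. apply sum_eq_R0. intros k hk. apply h. lia. }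
  induction N as [|N IH].
  - replace n with 0%nat by lia. reflexivity.
  - simpl. destruct (Nat.eq_dec n (S N)) as [->|hne].
    + rewrite h0 by lia. lra.
    + rewrite <- IH by lia. rewrite (h (S N)) by lia. lra.
Qed.

Lemma CSeries_single (n : nat) (a : nat -> C) :
  (forall k, k <> n -> a k = RtoC 0) -> CSeries a = a n.
Proof.
  intros h. unfold CSeries. rewrite (surjective_pairing (a n)). f_equal.
  - apply is_series_unique, (Series_single n (fun k => Re (a k))).
    intros k hk. now rewrite h.
  - apply is_series_unique, (Series_single n (fun k => Im (a k))).
    intros k hk. now rewrite h.
Qed.

Lemma fock_ip_basis (x : fock) (n : nat) : fock_ip x (basis n) = Cconj (x n).
Proof.
  unfold fock_ip. rewrite (CSeries_single n).
  - unfold C_ip, basis; simpl. rewrite Nat.eqb_refl. ring.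
  - intros k hk. unfold C_ip, basis; simpl. apply Nat.eqb_neq in hk. rewrite hk. ring.
Qed.

Lemma fock_norm2 (x : fock) : norm x ^ 2 = Series (fun n => Cmod (x n) ^ 2).
Proof. exact (fock_trunc_norm x 0 x (fun n h => match Nat.nlt_0_r n h with end)
  (fun n h => eq_refl)). Qed.

(* The matrix coefficient of [Y] in row [m] and column [n] *)
Definition ent (Y : hs) (n m : nat) : C := Y (basis n) m.

Lemma hs_ext_ent (X Y : hs) : (forall n m, ent X n m = ent Y n m) -> X = Y.
Proof.
  intros h.
  assert (h0 : forall x, (plus (X : bounded_op) (opp (Y : bounded_op))) x = zero).
  { apply bop_zero_on_basis. intros n. apply fock_ext. intros m.
    change (Cplus (ent X n m) (Copp (ent Y n m)) = RtoC 0). rewrite h. ring. }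
  apply hs_ext. intros x. specialize (h0 x).
  change (plus (X x) (opp (Y x)) = zero) in h0.
  apply (plus_reg_r (opp (Y x))). etransitivity; [exact h0|].
  symmetry. exact (plus_opp_r (Y x)).
Qed.

Lemma ent_plus (X Y : hs) n m : ent (plus X Y) n m = Cplus (ent X n m) (ent Y n m).
Proof. reflexivity. Qed.
Lemma ent_scal (c : C) (X : hs) n m : ent (scal c X) n m = Cmult c (ent X n m).
Proof. reflexivity. Qed.
Lemma ent_opp (X : hs) n m : ent (opp X) n m = Copp (ent X n m).
Proof. reflexivity. Qed.
Lemma ent_minus (X Y : hs) n m : ent (minus X Y) n m = Cminus (ent X n m) (ent Y n m).
Proof. reflexivity. Qed.
Lemma ent_zero n m : ent zero n m = RtoC 0.
Proof. reflexivity. Qed.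

(** Identities between linear combinations of operators are checked on matrix entries, where they
    become ring identities in [C]. *)
Ltac hs_ring := apply hs_ext_ent; intros ? ?;
  repeat rewrite ?ent_plus, ?ent_scal, ?ent_opp, ?ent_minus, ?ent_zero; ring.

(** Bounds on sums over finite rectangles stand in for the double series: they are symmetric in rows
    and columns and pass to entrywise limits. *)
Definition box (x : nat -> nat -> C) (A B : nat) : R :=
  sum_f_R0 (fun n => sum_f_R0 (fun m => Cmod (x n m) ^ 2) B) A.

Lemma sum_f_R0_ge0 (a : nat -> R) N : (forall n, 0 <= a n) -> 0 <= sum_f_R0 a N.
Proof. intros h. apply cond_pos_sum, h. Qed.

Lemma term_le_sum_f_R0 (a : nat -> R) n N :
  (n <= N)%nat -> (forall n, 0 <= a n) -> a n <= sum_f_R0 a N.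
Proof.
  intros hn h. induction N.
  - replace n with 0%nat by lia. simpl. lra.
  - simpl. destruct (Nat.eq_dec n (S N)) as [->|].
    + assert (h1 := sum_f_R0_ge0 a N h). lra.
    + assert (h1 := h (S N)). assert (a n <= sum_f_R0 a N) by (apply IHN; lia). lra.
Qed.

Lemma sum_f_R0_swap (a : nat -> nat -> R) A B :
  sum_f_R0 (fun n => sum_f_R0 (fun m => a n m) B) A =
  sum_f_R0 (fun m => sum_f_R0 (fun n => a n m) A) B.
Proof.
  induction A; simpl; trivial. rewrite IHA, <- plus_sum. reflexivity.
Qed.

Lemma box_col (x : nat -> nat -> C) c : (forall A B, box x A B <= c) ->
  forall n, ex_series (fun m => Cmod (x n m) ^ 2).
Proof.
  intros h n. apply (bounded_nonneg_series _ c).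
  - intros m. apply pow2_ge_0.
  - intros N. eapply Rle_trans; [|apply (h n N)].
    apply (term_le_sum_f_R0 (fun n => sum_f_R0 (fun m => Cmod (x n m) ^ 2) N)); trivial.
    intros k. apply sum_f_R0_ge0. intros; apply pow2_ge_0.
Qed.

Lemma box_col_sum (x : nat -> nat -> C) c : (forall A B, box x A B <= c) ->
  forall A, sum_f_R0 (fun n => Series (fun m => Cmod (x n m) ^ 2)) A <= c.
Proof.
  intros h A.
  destruct (sum_f_R0_Series (fun n m => Cmod (x n m) ^ 2) A) as [h1 ->].
  { now apply box_col with c. }
  apply bounded_nonneg_series.
  - intros m. apply sum_f_R0_ge0. intros; apply pow2_ge_0.
  - intros B. rewrite <- (sum_f_R0_swap (fun n m => Cmod (x n m) ^ 2) A B). apply h.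
Qed.

(** * Operators built from matrices with bounded boxes *)

Section matrix_operator.

Context (x : nat -> nat -> C) (bounded : exists c, forall A B, box x A B <= c).

Lemma box_conj_transpose A B : box (fun m n => Cconj (x n m)) A B = box x B A.
Proof.
  unfold box. rewrite sum_f_R0_swap. apply sum_eq; intros n _. apply sum_eq; intros m _.
  now rewrite Cmod_conj.
Qed.

Lemma mat_row_sq m : ex_series (fun n => Cmod (Cconj (x n m)) ^ 2).
Proof.
  destruct bounded as [c h]. apply (box_col (fun m n => Cconj (x n m)) c).
  intros. rewrite box_conj_transpose. apply h.
Qed.

(** The row is conjugated because [fock_ip] is conjugate linear in its first argument; its product
    with [v] is then coordinate [m] of the matrix-vector product. *)
Definition mat_row m : fock := mk_fock _ (mat_row_sq m).

(** Cauchy-Schwarz in each row; the squared norms of the rows are summed by the box bound for the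
    transpose. *)
Lemma mat_vec_bound : exists c, forall (v : fock) N,
  sum_f_R0 (fun m => Cmod (fock_ip (mat_row m) v) ^ 2) N <= norm v ^ 2 * c.
Proof.
  destruct bounded as [c h]. exists c. intros v N.
  apply Rle_trans with (norm v ^ 2 * sum_f_R0 (fun m => norm (mat_row m) ^ 2) N).
  - rewrite scal_sum. apply sum_Rle. intros m _. rewrite <- Rpow_mult_distr.
    apply pow_incr. split; [apply Cmod_ge_0 | apply (ip_CS _ fock_ip_inner)].
  - apply Rmult_le_compat_l; [apply pow2_ge_0|].
    erewrite sum_eq; [apply (box_col_sum (fun m n => Cconj (x n m)))|].
    + intros. rewrite box_conj_transpose. apply h.
    + intros m _. simpl. exact (fock_norm2 (mat_row m)).
Qed.

Lemma mat_vec_sq (v : fock) : ex_series (fun m => Cmod (fock_ip (mat_row m) v) ^ 2).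
Proof.
  destruct mat_vec_bound as [c h]. apply (bounded_nonneg_series _ (norm v ^ 2 * c)).
  - intros. apply pow2_ge_0.
  - intros. apply h.
Qed.

Definition mat_vec (v : fock) : fock := mk_fock _ (mat_vec_sq v).

Lemma mat_vec_lin : is_linear mat_vec.
Proof.
  split.
  - intros u v. apply fock_ext. intros m. exact (ip_plus_r _ fock_ip_inner (mat_row m) u v).
  - intros k v. apply fock_ext. intros m. exact (ip_scal_r _ fock_ip_inner k (mat_row m) v).
  (* [is_linear] asks for a strictly positive bound, hence the [+ 1]; [Rmax c 0] is there because
     the sign of [c] is not recorded. *)
  - destruct mat_vec_bound as [c h]. exists (sqrt (Rmax c 0) + 1). split.
    { generalize (sqrt_pos (Rmax c 0)); lra. }
    intros v.
    assert (hv := norm_ge_0 v).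
    apply Rle_trans with (sqrt (Rmax c 0) * norm v);
      [|generalize (sqrt_pos (Rmax c 0)); nra].
    apply Rsqr_incr_0_var; [|apply Rmult_le_pos; trivial; apply sqrt_pos].
    rewrite !Rsqr_pow2, Rpow_mult_distr, pow2_sqrt by apply Rmax_r.
    rewrite (fock_norm2 (mat_vec v)).
    apply Rle_trans with (norm v ^ 2 * c).
    + apply (bounded_nonneg_series (fun m => Cmod (fock_ip (mat_row m) v) ^ 2)).
      * intros. apply pow2_ge_0.
      * intros. apply h.
    + rewrite Rmult_comm. apply Rmult_le_compat_r; [apply pow2_ge_0 | apply Rmax_l].
Qed.

Lemma mat_vec_basis n m : mat_vec (basis n) m = x n m.
Proof. simpl. rewrite fock_ip_basis. simpl. apply Cconj_conj. Qed.

Lemma mat_hs_sq : ex_series (fun n => norm (mk_bop _ mat_vec_lin (basis n)) ^ 2).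
Proof.
  destruct bounded as [c h].
  apply ex_series_ext with (fun n => Series (fun m => Cmod (x n m) ^ 2)).
  - intros n. rewrite fock_norm2. apply Series_ext. intros m. f_equal. f_equal.
    symmetry. apply mat_vec_basis.
  - apply (bounded_nonneg_series _ c).
    + intros n. apply Series_ge0; [intros; apply pow2_ge_0 | now apply box_col with c].
    + now apply box_col_sum.
Qed.

Definition mat_hs : hs := mk_hs _ mat_hs_sq.

Lemma ent_mat_hs n m : ent mat_hs n m = x n m.
Proof. apply mat_vec_basis. Qed.

End matrix_operator.

Notation hs_norm := (ip_norm hs_ip).

Lemma hs_norm2 (Y : hs) :
  hs_norm Y ^ 2 = Series (fun n => Series (fun m => Cmod (ent Y n m) ^ 2)).
Proof.
  rewrite (ip_norm_sq _ hs_ip_inner). unfold hs_ip, CSeries; simpl.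
  apply Series_ext. intros n.
  transitivity (norm (Y (basis n)) ^ 2); [|exact (fock_norm2 (Y (basis n)))].
  symmetry. exact (ip_norm_sq _ fock_ip_inner (Y (basis n))).
Qed.

Lemma box_le_norm (Y : hs) A B : box (ent Y) A B <= hs_norm Y ^ 2.
Proof.
  rewrite hs_norm2.
  apply Rle_trans with (sum_f_R0 (fun n => Series (fun m => Cmod (ent Y n m) ^ 2)) A).
  - apply sum_Rle. intros n _. apply partial_sum_le_Series.
    + intros; apply pow2_ge_0.
    + apply (coef_sq (Y (basis n))).
  - apply partial_sum_le_Series.
    + intros n. apply Series_ge0; [intros; apply pow2_ge_0 | apply (coef_sq (Y (basis n)))].
    + generalize (hs_sq Y). apply ex_series_ext. intros n. apply fock_norm2.
Qed.

Lemma norm_le_box (Y : hs) c : (forall A B, box (ent Y) A B <= c) -> hs_norm Y ^ 2 <= c.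
Proof.
  intros h. rewrite hs_norm2. apply bounded_nonneg_series.
  - intros n. apply Series_ge0; [intros; apply pow2_ge_0 | apply (coef_sq (Y (basis n)))].
  - now apply box_col_sum.
Qed.

Lemma ent_le_norm (Y : hs) n m : Cmod (ent Y n m) <= hs_norm Y.
Proof.
  apply Rsqr_incr_0_var; [|apply ip_norm_ge0]. rewrite !Rsqr_pow2.
  eapply Rle_trans; [|apply (box_le_norm Y n m)].
  apply Rle_trans with (sum_f_R0 (fun m => Cmod (ent Y n m) ^ 2) m).
  - apply (term_le_sum_f_R0 (fun m => Cmod (ent Y n m) ^ 2)); [lia|].
    intros; apply pow2_ge_0.
  - apply (term_le_sum_f_R0 (fun n => sum_f_R0 (fun m => Cmod (ent Y n m) ^ 2) m)); [lia|].
    intros. apply sum_f_R0_ge0. intros; apply pow2_ge_0.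
Qed.

(** * Limits and spans of Hilbert-Schmidt operators *)

Fixpoint csum (u : nat -> C) (N : nat) : C :=
  match N with
  | O => u 0%nat
  | S N' => Cplus (csum u N') (u N)
  end.

Fixpoint hsum (u : nat -> hs) (N : nat) : hs :=
  match N with
  | O => u 0%nat
  | S N' => plus (hsum u N') (u N)
  end.

Lemma csum_ext (u v : nat -> C) N : (forall n, (n <= N)%nat -> u n = v n) -> csum u N = csum v N.
Proof.
  induction N as [|N IH]; intros h; simpl; [apply h; lia|].
  rewrite IH, (h (S N)); [reflexivity | lia | intros; apply h; lia].
Qed.

Lemma hsum_ext (u v : nat -> hs) N : (forall n, (n <= N)%nat -> u n = v n) -> hsum u N = hsum v N.
Proof.
  induction N as [|N IH]; intros h; simpl; [apply h; lia|].
  rewrite IH, (h (S N)); [reflexivity | lia | intros; apply h; lia].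
Qed.

Lemma csum_plus (u v : nat -> C) N :
  csum (fun n => Cplus (u n) (v n)) N = Cplus (csum u N) (csum v N).
Proof. induction N as [|N IH]; simpl; [|rewrite IH]; ring. Qed.

Lemma csum_scal (c : C) (u : nat -> C) N :
  csum (fun n => Cmult c (u n)) N = Cmult c (csum u N).
Proof. induction N as [|N IH]; simpl; [|rewrite IH]; ring. Qed.

Lemma csum_zero (u : nat -> C) N : (forall n, (n <= N)%nat -> u n = RtoC 0) -> csum u N = RtoC 0.
Proof.
  induction N as [|N IH]; intros h; simpl; [apply h; lia|].
  rewrite IH, (h (S N)); [ring | lia | intros; apply h; lia].
Qed.

Lemma csum_single (u : nat -> C) n N : (n <= N)%nat ->
  (forall k, (k <= N)%nat -> k <> n -> u k = RtoC 0) -> csum u N = u n.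
Proof.
  induction N as [|N IH]; intros hn h; simpl.
  - now replace n with 0%nat by lia.
  - destruct (Nat.eq_dec n (S N)) as [->|].
    + rewrite csum_zero; [ring|]. intros; apply h; lia.
    + rewrite IH, (h (S N)); [ring | lia | lia | lia | intros; apply h; lia].
Qed.

Lemma csum_first (u : nat -> C) N :
  csum u (S N) = Cplus (u 0%nat) (csum (fun n => u (S n)) N).
Proof. induction N as [|N IH]; [reflexivity|]. simpl in *. rewrite IH. ring. Qed.

Lemma re_csum (u : nat -> C) N : Re (csum u N) = sum_f_R0 (fun n => Re (u n)) N.
Proof. induction N; simpl; trivial. now rewrite <- IHN. Qed.

Lemma im_csum (u : nat -> C) N : Im (csum u N) = sum_f_R0 (fun n => Im (u n)) N.
Proof. induction N; simpl; trivial. now rewrite <- IHN. Qed.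

Lemma ent_hsum (u : nat -> hs) N n m : ent (hsum u N) n m = csum (fun k => ent (u k) n m) N.
Proof. induction N as [|N IH]; simpl; trivial. now rewrite ent_plus, IH. Qed.

Lemma ip_hsum_r (x : hs) (u : nat -> hs) N : hs_ip x (hsum u N) = csum (fun k => hs_ip x (u k)) N.
Proof. induction N as [|N IH]; simpl; trivial. now rewrite (ip_plus_r _ hs_ip_inner), IH. Qed.

Lemma norm_hsum_le (u : nat -> hs) N : hs_norm (hsum u N) <= sum_f_R0 (fun k => hs_norm (u k)) N.
Proof.
  induction N as [|N IH]; simpl; [lra|].
  eapply Rle_trans; [apply (ip_norm_triangle _ hs_ip_inner)|]. lra.
Qed.

Definition Clim (u : nat -> C) (l : C) : Prop :=
  is_lim_seq (fun K => Re (u K)) (Re l) /\ is_lim_seq (fun K => Im (u K)) (Im l).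

Definition hs_lim (Y : nat -> hs) (y : hs) : Prop :=
  is_lim_seq (fun K => hs_norm (minus (Y K) y)) 0.

Lemma Clim_of_Cmod (u : nat -> C) (l : C) :
  is_lim_seq (fun K => Cmod (Cminus (u K) l)) 0 -> Clim u l.
Proof.
  intros h. split.
  - apply is_lim_seq_ext with (fun K => (Re (u K) - Re l) + Re l); [intros; lra|].
    replace (Finite (Re l)) with (Finite (0 + Re l)) by (f_equal; lra).
    apply is_lim_seq_plus'; [|apply is_lim_seq_const].
    apply is_lim_seq_abs_0. apply is_lim_seq_le_le with (fun _ => 0) (fun K => Cmod (Cminus (u K) l));
      trivial; [|apply is_lim_seq_const].
    intros K. split; [apply Rabs_pos|]. exact (re_le_Cmod (Cminus (u K) l)).
  - apply is_lim_seq_ext with (fun K => (Im (u K) - Im l) + Im l); [intros; lra|].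
    replace (Finite (Im l)) with (Finite (0 + Im l)) by (f_equal; lra).
    apply is_lim_seq_plus'; [|apply is_lim_seq_const].
    apply is_lim_seq_abs_0. apply is_lim_seq_le_le with (fun _ => 0) (fun K => Cmod (Cminus (u K) l));
      trivial; [|apply is_lim_seq_const].
    intros K. split; [apply Rabs_pos|].
    eapply Rle_trans; [|exact (Rmax_Cmod (Cminus (u K) l))]. apply Rmax_r.
Qed.

Lemma Clim_unique u l l' : Clim u l -> Clim u l' -> l = l'.
Proof.
  intros [h1 h2] [h3 h4]. apply is_lim_seq_unique in h1, h2, h3, h4.
  apply Ceq; apply Rbar_finite_eq; congruence.
Qed.

Lemma Clim_ext u v l : (forall K, u K = v K) -> Clim u l -> Clim v l.
Proof.
  intros h [h1 h2]. split; [generalize h1 | generalize h2]; apply is_lim_seq_ext;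
    intros; now rewrite h.
Qed.

Lemma Clim_const l : Clim (fun _ => l) l.
Proof. split; apply is_lim_seq_const. Qed.

Lemma is_lim_seq_0_le (u v : nat -> R) :
  (forall K, 0 <= u K <= v K) -> is_lim_seq v 0 -> is_lim_seq u 0.
Proof.
  intros h hv. apply is_lim_seq_le_le with (fun _ => 0) v; trivial.
  apply is_lim_seq_const.
Qed.

Lemma is_lim_seq_scal_0 (c : R) (u : nat -> R) : is_lim_seq u 0 -> is_lim_seq (fun K => c * u K) 0.
Proof.
  intros h. replace (Finite 0) with (Rbar_mult c 0) by (simpl; f_equal; lra).
  now apply is_lim_seq_scal_l.
Qed.

Lemma hs_minus_scal (y z : hs) : minus y z = plus y (scal (Copp (RtoC 1)) z).
Proof. hs_ring. Qed.

Lemma ip_minus_r (x y z : hs) : hs_ip x (minus y z) = Cminus (hs_ip x y) (hs_ip x z).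
Proof.
  rewrite hs_minus_scal, (ip_plus_r _ hs_ip_inner), (ip_scal_r _ hs_ip_inner). ring.
Qed.

Lemma hs_norm_minus_sym (x y : hs) : hs_norm (minus x y) = hs_norm (minus y x).
Proof. rewrite <- (ip_norm_opp _ hs_ip_inner). f_equal. hs_ring. Qed.

Lemma hs_lim_ip (x : hs) (Y : nat -> hs) y : hs_lim Y y -> Clim (fun K => hs_ip x (Y K)) (hs_ip x y).
Proof.
  intros h. apply Clim_of_Cmod.
  apply is_lim_seq_0_le with (fun K => hs_norm x * hs_norm (minus (Y K) y)).
  - intros K. split; [apply Cmod_ge_0|]. rewrite <- ip_minus_r. apply (ip_CS _ hs_ip_inner).
  - now apply is_lim_seq_scal_0.
Qed.

Lemma hs_lim_ent (Y : nat -> hs) y n m : hs_lim Y y -> Clim (fun K => ent (Y K) n m) (ent y n m).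
Proof.
  intros h. apply Clim_of_Cmod. apply is_lim_seq_0_le with (fun K => hs_norm (minus (Y K) y)); trivial.
  intros K. split; [apply Cmod_ge_0|]. rewrite <- ent_minus. apply ent_le_norm.
Qed.

Lemma is_lim_seq_sum_f_R0 (a : nat -> nat -> R) (l : nat -> R) N :
  (forall n, is_lim_seq (a n) (l n)) ->
  is_lim_seq (fun K => sum_f_R0 (fun n => a n K) N) (sum_f_R0 l N).
Proof.
  intros h. induction N; simpl; [apply h|]. now apply is_lim_seq_plus'.
Qed.

Lemma box_lim (X : nat -> nat -> nat -> C) (x : nat -> nat -> C) A B :
  (forall n m, Clim (fun K => X K n m) (x n m)) ->
  is_lim_seq (fun K => box (X K) A B) (box x A B).
Proof.
  intros h. unfold box.
  apply (is_lim_seq_sum_f_R0 (fun n K => sum_f_R0 (fun m => Cmod (X K n m) ^ 2) B)).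
  intros n. apply (is_lim_seq_sum_f_R0 (fun m K => Cmod (X K n m) ^ 2)). intros m.
  destruct (h n m) as [h1 h2]. rewrite Cmod2_alt.
  apply is_lim_seq_ext with (fun K => Re (X K n m) * Re (X K n m) + Im (X K n m) * Im (X K n m)).
  - intros K. rewrite Cmod2_alt. ring.
  - replace (Re (x n m) ^ 2 + Im (x n m) ^ 2) with
      (Re (x n m) * Re (x n m) + Im (x n m) * Im (x n m)) by ring.
    apply is_lim_seq_plus'; now apply is_lim_seq_mult'.
Qed.

Lemma box_lim_le (X : nat -> nat -> nat -> C) (x : nat -> nat -> C) A B c M :
  (forall n m, Clim (fun K => X K n m) (x n m)) ->
  (forall K, (M <= K)%nat -> box (X K) A B <= c) -> box x A B <= c.
Proof.
  intros h hc.
  apply (is_lim_seq_le_loc (fun K => box (X K) A B) (fun _ => c) (box x A B) c).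
  - exists M. exact hc.
  - now apply box_lim.
  - apply is_lim_seq_const.
Qed.

Lemma Clim_minus u v l l' : Clim u l -> Clim v l' -> Clim (fun K => Cminus (u K) (v K)) (Cminus l l').
Proof.
  intros [h1 h2] [h3 h4]. split.
  - exact (is_lim_seq_minus' _ _ _ _ h1 h3).
  - exact (is_lim_seq_minus' _ _ _ _ h2 h4).
Qed.

(** Completeness in the form needed below. The entrywise limit is given; the box bounds of the
    partial sums pass to it, so it is the matrix of an operator, and the box bounds of
    [hsum Y K - hsum Y M] pass to the limit in [M], so the tails of [c] control the distance to
    it. *)
Lemma hs_series (Y : nat -> hs) (c : nat -> R) (x : nat -> nat -> C) :
  (forall N, hs_norm (Y N) <= c N) -> ex_series c ->
  (forall n m, Clim (csum (fun N => ent (Y N) n m)) (x n m)) ->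
  exists Z, (forall n m, ent Z n m = x n m) /\ hs_lim (hsum Y) Z.
Proof.
  intros hY hc hx.
  assert (hc0 : forall n, 0 <= c n).
  { intros n. eapply Rle_trans; [|apply hY]. apply ip_norm_ge0. }
  assert (hS : forall K, sum_f_R0 c K <= Series c).
  { intros. now apply partial_sum_le_Series. }
  assert (hx' : forall n m, Clim (fun K => ent (hsum Y K) n m) (x n m)).
  { intros n m. generalize (hx n m). apply Clim_ext. intros; symmetry; apply ent_hsum. }
  assert (hb : forall A B, box x A B <= Series c ^ 2).
  { intros A B. apply (box_lim_le (fun K => ent (hsum Y K)) x A B _ 0); trivial.
    intros K _. eapply Rle_trans; [apply box_le_norm|]. apply pow_incr.
    split; [apply ip_norm_ge0|]. eapply Rle_trans; [apply norm_hsum_le|].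
    eapply Rle_trans; [|apply (hS K)]. apply sum_Rle. intros; apply hY. }
  set (Z := mat_hs x (ex_intro _ _ hb)).
  assert (hZ : forall n m, ent Z n m = x n m) by (intros; apply ent_mat_hs).
  exists Z. split; trivial.
  assert (hd : forall K M, hs_norm (minus (hsum Y (K + M)) (hsum Y K)) <=
                 sum_f_R0 c (K + M) - sum_f_R0 c K).
  { intros K. induction M as [|M IH].
    - rewrite Nat.add_0_r, minus_eq_zero.
      eapply Rle_trans; [right; exact (ip_norm_zero _ hs_ip_inner) | lra].
    - rewrite Nat.add_succ_r. simpl.
      replace (minus (plus (hsum Y (K + M)) (Y (S (K + M)))) (hsum Y K)) with
        (plus (minus (hsum Y (K + M)) (hsum Y K)) (Y (S (K + M)))) by hs_ring.
      eapply Rle_trans; [apply (ip_norm_triangle _ hs_ip_inner)|].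
      generalize (hY (S (K + M))). lra. }
  apply is_lim_seq_0_le with (fun K => Series c - sum_f_R0 c K).
  - intros K. split; [apply ip_norm_ge0|].
    assert (0 <= Series c - sum_f_R0 c K) by (generalize (hS K); lra).
    apply Rsqr_incr_0_var; trivial. rewrite !Rsqr_pow2. apply norm_le_box. intros A B.
    apply (box_lim_le (fun M => ent (minus (hsum Y K) (hsum Y M))) _ A B _ K).
    + intros n m.
      apply Clim_ext with (fun M => Cminus (ent (hsum Y K) n m) (ent (hsum Y M) n m)).
      { intros; symmetry; apply ent_minus. }
      rewrite ent_minus, hZ. apply Clim_minus; [apply Clim_const | apply hx'].
    + intros M hM. eapply Rle_trans; [apply box_le_norm|]. apply pow_incr.
      split; [apply ip_norm_ge0|].
      rewrite hs_norm_minus_sym.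
      replace M with (K + (M - K))%nat by lia.
      eapply Rle_trans; [apply hd|]. generalize (hS (K + (M - K))%nat). lra.
  - replace 0 with (Series c - Series c) by lra.
    apply is_lim_seq_minus'; [apply is_lim_seq_const|].
    apply is_lim_seq_ext with (sum_n c); [intros; apply sum_n_Reals|].
    exact (Series_correct _ hc).
Qed.

Inductive span (G : hs -> Prop) : hs -> Prop :=
  | span_zero : span G zero
  | span_add c x y : G x -> span G y -> span G (plus (scal c x) y).

Ltac hs_as t := match goal with |- ?P _ => apply (eq_ind t P); [|hs_ring] end.

Lemma span_plus G x y : span G x -> span G y -> span G (plus x y).
Proof.
  intros hx hy. induction hx as [|c u v hu hv IH].
  - hs_as y. trivial.
  - hs_as (plus (scal c u) (plus v y)). now constructor.
Qed.

Lemma span_scal G (c : C) x : span G x -> span G (scal c x).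
Proof.
  intros hx. induction hx as [|d u v hu hv IH].
  - hs_as (zero : hs). constructor.
  - hs_as (plus (scal (Cmult c d) u) (scal c v)). now constructor.
Qed.

Lemma span_gen (G : hs -> Prop) x : G x -> span G x.
Proof.
  intros h. hs_as (plus (scal (RtoC 1) x) zero).
  constructor; trivial. constructor.
Qed.

Lemma span_hsum G (u : nat -> hs) N : (forall n, (n <= N)%nat -> span G (u n)) -> span G (hsum u N).
Proof.
  induction N as [|N IH]; intros h; simpl; [apply h; lia|].
  apply span_plus; [apply IH; intros; apply h; lia | apply h; lia].
Qed.

Lemma span_mono (G H : hs -> Prop) x : (forall y, G y -> H y) -> span G x -> span H x.
Proof. intros h hx. induction hx; constructor; auto. Qed.

Lemma span_ip_eq (G : hs -> Prop) (y z : hs) :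
  (forall g, G g -> hs_ip g y = hs_ip g z) -> forall x, span G x -> hs_ip x y = hs_ip x z.
Proof.
  intros h x hx. induction hx as [|c u v hu hv IH].
  - rewrite !(ip_conj _ hs_ip_inner _ zero), !(ip_zero_r _ hs_ip_inner). reflexivity.
  - now rewrite !(ip_plus_l _ hs_ip_inner), !(ip_scal_l _ hs_ip_inner), IH, h.
Qed.

(** The difference lies in the span and is orthogonal to the span, hence to itself. *)
Lemma span_eq (G : hs -> Prop) (y z : hs) : span G y -> span G z ->
  (forall g, G g -> hs_ip g y = hs_ip g z) -> y = z.
Proof.
  intros hy hz h.
  assert (hd : span G (minus y z)).
  { rewrite hs_minus_scal. now apply span_plus; [|apply span_scal]. }
  assert (h0 : minus y z = zero).
  { apply (ip_def _ hs_ip_inner). rewrite ip_minus_r, (span_ip_eq G y z h _ hd). ring. }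
  replace y with (plus (minus y z) z) by hs_ring. rewrite h0. hs_ring.
Qed.

(** * Embedded polynomials are Hilbert-Schmidt *)

Lemma sqrt_INR_S_le (n : nat) : 0 <= sqrt (INR (S n)) <= 1 + INR n.
Proof.
  split; [apply sqrt_pos|]. rewrite S_INR. assert (h := pos_INR n).
  rewrite <- (sqrt_pow2 (1 + INR n)) by lra. apply sqrt_le_1_alt. nra.
Qed.

(** A polynomial is a band matrix of half-width [w] whose entries grow at most like a power of the
    index; the exponential weights will dominate this growth. The support is tracked as an interval
    from [L] to [N] so that products can be treated by composition. *)
Lemma nc_eval_bound (P : ncpoly) : exists (K : R) (w d : nat), 0 <= K /\
  forall (L N : nat) (B : R) (x : nat -> C),
    (forall m, (m < L \/ N < m)%nat -> x m = RtoC 0) -> (forall m, Cmod (x m) <= B) ->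
    (forall m, (m + w < L \/ N + w < m)%nat -> nc_eval P x m = RtoC 0) /\
    (forall m, Cmod (nc_eval P x m) <= K * (1 + INR N) ^ d * B).
Proof.
  induction P as [c| | |P [K1 [w1 [d1 [hK1 h1]]]] Q [K2 [w2 [d2 [hK2 h2]]]]
                     |P [K1 [w1 [d1 [hK1 h1]]]] Q [K2 [w2 [d2 [hK2 h2]]]]].
  - exists (Cmod c), 0%nat, 0%nat. split; [apply Cmod_ge_0|]. intros L N B x hx hB. simpl.
    split; intros m.
    + intros hm. rewrite hx by lia. ring.
    + rewrite Cmod_mult, Rmult_1_r. apply Rmult_le_compat_l; [apply Cmod_ge_0 | apply hB].
  - exists 1, 1%nat, 1%nat. split; [lra|]. intros L N B x hx hB. simpl. unfold annih.
    split; intros m.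
    + intros hm. rewrite hx by lia. ring.
    + assert (h0 : 0 <= B) by (eapply Rle_trans; [apply Cmod_ge_0 | apply (hB 0%nat)]).
      assert (hN := pos_INR N).
      destruct (Nat.le_gt_cases (S m) N) as [h|h].
      * destruct (sqrt_INR_S_le m) as [h3 h4].
        rewrite Cmod_mult, Cmod_R, Rabs_pos_eq, Rmult_1_r, Rmult_1_l by trivial.
        apply Rmult_le_compat; auto using Cmod_ge_0.
        apply Rle_trans with (1 + INR m); trivial.
        assert (INR m <= INR N) by (apply le_INR; lia). lra.
      * rewrite hx by lia. rewrite Cmult_0_r, Cmod_0. apply Rmult_le_pos; trivial. lra.
  - exists 1, 1%nat, 1%nat. split; [lra|]. intros L N B x hx hB. simpl.
    split; intros [|m]; simpl.
    + trivial.
    + intros hm. rewrite hx by lia. ring.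
    + assert (h0 : 0 <= B) by (eapply Rle_trans; [apply Cmod_ge_0 | apply (hB 0%nat)]).
      assert (hN := pos_INR N). rewrite Cmod_0. apply Rmult_le_pos; trivial. lra.
    + assert (h0 : 0 <= B) by (eapply Rle_trans; [apply Cmod_ge_0 | apply (hB 0%nat)]).
      assert (hN := pos_INR N).
      destruct (Nat.le_gt_cases m N) as [h|h].
      * destruct (sqrt_INR_S_le m) as [h3 h4]. cbv beta iota delta [INR] in h3, h4.
        rewrite Cmod_mult, Cmod_R, Rabs_pos_eq, Rmult_1_r, Rmult_1_l by trivial.
        apply Rmult_le_compat; auto using Cmod_ge_0.
        eapply Rle_trans; [exact h4|].
        assert (INR m <= INR N) by (apply le_INR; lia). unfold INR in *. lra.
      * rewrite hx by lia. rewrite Cmult_0_r, Cmod_0. apply Rmult_le_pos; trivial. lra.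
  - exists (K1 + K2), (Nat.max w1 w2), (Nat.max d1 d2). split; [lra|].
    intros L N B x hx hB. simpl.
    destruct (h1 L N B x hx hB) as [h3 h4]. destruct (h2 L N B x hx hB) as [h5 h6].
    split; intros m.
    + intros hm. rewrite h3, h5 by lia. ring.
    + assert (h0 : 0 <= B) by (eapply Rle_trans; [apply Cmod_ge_0 | apply (hB 0%nat)]).
      assert (hN := pos_INR N).
      eapply Rle_trans; [apply Cmod_triangle|]. rewrite !Rmult_plus_distr_r.
      apply Rplus_le_compat; (eapply Rle_trans; [apply h4 || apply h6|]);
        apply Rmult_le_compat_r; trivial; apply Rmult_le_compat_l; trivial;
        apply Rle_pow; lra || lia.
  (* [Q] widens the support to [N + w2] before [P] acts, and [1 + N + w2 <= (1 + w2) (1 + N)]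
     produces the extra factor. *)
  - exists (K1 * K2 * (1 + INR w2) ^ d1), (w1 + w2)%nat, (d1 + d2)%nat.
    assert (hw := pos_INR w2).
    split. { apply Rmult_le_pos; [nra|]. apply pow_le; lra. }
    intros L N B x hx hB. simpl.
    assert (h0 : 0 <= B) by (eapply Rle_trans; [apply Cmod_ge_0 | apply (hB 0%nat)]).
    assert (hN := pos_INR N).
    destruct (h2 L N B x hx hB) as [h5 h6].
    destruct (h1 (L - w2)%nat (N + w2)%nat _ (nc_eval Q x)
      (fun m hm => h5 m ltac:(lia)) h6) as [h3 h4].
    split; intros m.
    + intros hm. apply h3. lia.
    + eapply Rle_trans; [apply h4|]. rewrite plus_INR.
      rewrite pow_add.
      apply Rle_trans with (K1 * ((1 + INR w2) * (1 + INR N)) ^ d1 * (K2 * (1 + INR N) ^ d2 * B)).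
      * apply Rmult_le_compat_r.
        { apply Rmult_le_pos; trivial. apply Rmult_le_pos; trivial. apply pow_le; lra. }
        apply Rmult_le_compat_l; trivial. apply pow_incr. nra.
      * right. rewrite Rpow_mult_distr. ring.
Qed.

Lemma poly_exp_summable (b : R) (p : nat) : 0 < b ->
  ex_series (fun n => (1 + INR n) ^ p * exp (- b * INR n)).
Proof.
  (* Half of the decay rate pays for the polynomial factor, by a single term of the Taylor series of
     the exponential; the other half leaves a geometric series. *)
  intros hb. set (d := b / 2). assert (hd : 0 < d) by (unfold d; lra).
  apply (ex_series_le (K := R_AbsRing) (V := R_CompleteNormedModule)) with
    (fun n => (INR (fact p) / d ^ p * exp d) * (exp (- d)) ^ n).
  - intros n. assert (hn := pos_INR n). unfold norm; simpl. unfold abs; simpl.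
    assert (hp : 0 <= (1 + INR n) ^ p) by (apply pow_le; lra).
    assert (he := exp_pos (- b * INR n)).
    rewrite Rabs_pos_eq by nra.
    assert (hf := INR_fact_lt_0 p). assert (hdp : 0 < d ^ p) by now apply pow_lt.
    assert (h1 : (d * (1 + INR n)) ^ p / INR (fact p) <= exp (d * (1 + INR n))).
    { assert (hx : 0 <= d * (1 + INR n)) by nra.
      eapply Rle_trans; [|apply (exp_ge_taylor _ p hx)].
      apply (term_le_sum_f_R0 (fun k => (d * (1 + INR n)) ^ k / INR (fact k))); [lia|].
      intros k. apply Rmult_le_pos; [now apply pow_le|].
      apply Rlt_le, Rinv_0_lt_compat, INR_fact_lt_0. }
    assert (h2 : (1 + INR n) ^ p <= INR (fact p) / d ^ p * exp (d * (1 + INR n))).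
    { rewrite Rpow_mult_distr in h1.
      replace ((1 + INR n) ^ p) with
        (INR (fact p) / d ^ p * (d ^ p * (1 + INR n) ^ p / INR (fact p))) by (field; lra).
      apply Rmult_le_compat_l; trivial.
      apply Rmult_le_pos; [lra|]. now apply Rlt_le, Rinv_0_lt_compat. }
    apply Rle_trans with (INR (fact p) / d ^ p * exp (d * (1 + INR n)) * exp (- b * INR n)).
    { apply Rmult_le_compat_r; lra. }
    right. rewrite !Rmult_assoc. f_equal. rewrite <- exp_plus.
    rewrite <- Rpower_pow by apply exp_pos.
    unfold Rpower. rewrite ln_exp, <- exp_plus. f_equal. unfold d. field.
  - apply ex_series_scal_R. apply ex_series_geom.
    rewrite Rabs_pos_eq by apply Rlt_le, exp_pos.
    rewrite <- exp_0. apply exp_increasing. lra.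
Qed.

Lemma sum_f_R0_support (a : nat -> R) (c : R) (M : nat) :
  0 <= c -> (forall m, a m <= c) -> (forall m, (M < m)%nat -> a m = 0) ->
  forall B, sum_f_R0 a B <= (1 + INR M) * c.
Proof.
  intros hc ha h0 B. assert (hM := pos_INR M).
  assert (h : sum_f_R0 a B <= INR (S (Nat.min B M)) * c).
  { induction B as [|B IH].
    - simpl. specialize (ha 0%nat). lra.
    - simpl sum_f_R0. destruct (Nat.le_gt_cases (S B) M).
      + replace (Nat.min (S B) M) with (S (Nat.min B M)) by lia.
        rewrite S_INR. specialize (ha (S B)). lra.
      + rewrite h0 by lia. replace (Nat.min (S B) M) with (Nat.min B M) by lia. lra. }
  eapply Rle_trans; [exact h|]. apply Rmult_le_compat_r; trivial.
  rewrite S_INR. assert (INR (Nat.min B M) <= INR M) by (apply le_INR; lia). lra.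
Qed.

Definition weight (beta s : R) (n m : nat) : R :=
  Rpower (rho beta m) (s / 2) * Rpower (rho beta n) ((1 - s) / 2).

Lemma weight_pos beta s n m : 0 < weight beta s n m.
Proof. apply Rmult_lt_0_compat; apply exp_pos. Qed.

Lemma exp_mono x y : x <= y -> exp x <= exp y.
Proof. intros [h| ->]; [now apply Rlt_le, exp_increasing | lra]. Qed.

Lemma exp_neg_lt1 beta : 0 < beta -> 0 < exp (- beta) < 1.
Proof.
  intros h. split; [apply exp_pos|]. rewrite <- exp_0. apply exp_increasing. lra.
Qed.

Lemma ln_rho beta n : 0 < beta -> ln (rho beta n) = ln (1 - exp (- beta)) + - beta * INR n.
Proof.
  intros h. assert (h1 := exp_neg_lt1 beta h). unfold rho.
  rewrite ln_mult, ln_exp; trivial; [lra | apply exp_pos].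
Qed.

Lemma weight_sq beta s n m : 0 < beta ->
  weight beta s n m ^ 2 = (1 - exp (- beta)) * exp (- beta * (s * INR m + (1 - s) * INR n)).
Proof.
  intros h. assert (h1 := exp_neg_lt1 beta h).
  unfold weight, Rpower. rewrite !ln_rho by trivial. rewrite <- exp_plus.
  replace (1 - exp (- beta)) with (exp (ln (1 - exp (- beta)))) at 3 by (apply exp_ln; lra).
  simpl. rewrite Rmult_1_r, <- !exp_plus. f_equal. field.
Qed.

Definition weighted (beta s : R) (A : nat -> nat -> C) (n m : nat) : C :=
  Cmult (RtoC (weight beta s n m)) (A n m).

(** The entries vanish unless [n <= m + w], and there [s m + (1 - s) n >= n - w] because
    [0 <= s <= 1]. Column [n] therefore decays like [exp (- beta n)] up to a power of [n], whatever
    [s] is. *)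
Lemma weighted_poly_bounded beta s P : 0 < beta -> 0 <= s <= 1 ->
  exists c, forall A B, box (weighted beta s (fun n => nc_eval P (basis n))) A B <= c.
Proof.
  intros hb hs. destruct (nc_eval_bound P) as [K [w [d [hK h]]]].
  set (b := fun n => exp (beta * INR w) * K ^ 2 * (1 + INR w) *
    ((1 + INR n) ^ (2 * d + 1) * exp (- beta * INR n))).
  assert (hex : ex_series b) by (apply ex_series_scal_R; now apply poly_exp_summable).
  assert (hb0 : forall n, 0 <= b n).
  { intros n. assert (hn := pos_INR n). assert (hw := pos_INR w).
    assert (h1 := exp_pos (beta * INR w)). assert (h2 := exp_pos (- beta * INR n)).
    unfold b. apply Rmult_le_pos; [|apply Rmult_le_pos; [apply pow_le|]; lra].
    apply Rmult_le_pos; [|lra]. apply Rmult_le_pos; [lra|apply pow2_ge_0]. }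
  exists (Series b). intros A B.
  apply Rle_trans with (sum_f_R0 b A); [|now apply partial_sum_le_Series].
  apply sum_Rle. intros n _.
  assert (hn := pos_INR n). assert (hw := pos_INR w).
  assert (hq := exp_neg_lt1 beta hb).
  destruct (h n n 1 (basis n)) as [h1 h2].
  { intros m hm. simpl. destruct (Nat.eqb_spec m n); [lia | reflexivity]. }
  { intros m. simpl. destruct (Nat.eqb m n); [rewrite Cmod_1 | rewrite Cmod_0]; lra. }
  set (c := exp (beta * INR w) * exp (- beta * INR n) * (K * (1 + INR n) ^ d) ^ 2).
  apply Rle_trans with ((1 + INR (n + w)) * c).
  - apply sum_f_R0_support.
    + unfold c. apply Rmult_le_pos; [|apply pow2_ge_0].
      apply Rlt_le, Rmult_lt_0_compat; apply exp_pos.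
    + intros m. unfold weighted. rewrite Cmod_mult, Cmod_R, Rpow_mult_distr.
      rewrite pow2_abs, weight_sq by trivial.
      destruct (Nat.le_gt_cases n (m + w)) as [hm|hm].
      * unfold c. apply Rmult_le_compat.
        { apply Rmult_le_pos; [lra | apply Rlt_le, exp_pos]. }
        { apply pow2_ge_0. }
        2: { apply pow_incr. split; [apply Cmod_ge_0|].
             eapply Rle_trans; [apply h2|]. lra. }
        rewrite <- exp_plus.
        apply Rle_trans with (1 * exp (- beta * (s * INR m + (1 - s) * INR n))).
        { apply Rmult_le_compat_r; [apply Rlt_le, exp_pos | lra]. }
        rewrite Rmult_1_l. apply exp_mono.
        assert (INR n <= INR m + INR w) by (rewrite <- plus_INR; now apply le_INR).
        assert (s * INR n <= s * INR m + INR w) by nra. nra.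
      * rewrite h1 by lia. rewrite Cmod_0. unfold c.
        apply Rle_trans with 0; [right; ring|].
        apply Rmult_le_pos; [|apply pow2_ge_0].
        apply Rlt_le, Rmult_lt_0_compat; apply exp_pos.
    + intros m hm. unfold weighted. rewrite h1 by lia. rewrite Cmult_0_r, Cmod_0. ring.
  - unfold b, c. rewrite plus_INR, pow_add, (Nat.mul_comm 2 d), pow_mult, pow_1, Rpow_mult_distr.
    set (u := ((1 + INR n) ^ d) ^ 2).
    assert (0 <= u) by apply pow2_ge_0.
    assert (h3 := exp_pos (beta * INR w)). assert (h4 := exp_pos (- beta * INR n)).
    set (e1 := exp (beta * INR w)) in *. set (e2 := exp (- beta * INR n)) in *.
    replace (e1 * K ^ 2 * (1 + INR w) * (u * (1 + INR n) * e2)) with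
      ((1 + INR w) * (1 + INR n) * (e1 * e2 * (K ^ 2 * u))) by ring.
    apply Rmult_le_compat_r; [|nra].
    apply Rmult_le_pos; [nra|]. apply Rmult_le_pos; trivial. apply pow2_ge_0.
Qed.

Definition emb (beta s : R) (hb : 0 < beta) (hs01 : 0 <= s <= 1) (P : ncpoly) : hs :=
  mat_hs _ (weighted_poly_bounded beta s P hb hs01).

Lemma ent_emb beta s hb hs01 P n m :
  ent (emb beta s hb hs01 P) n m = Cmult (RtoC (weight beta s n m)) (nc_eval P (basis n) m).
Proof. apply ent_mat_hs. Qed.

Lemma is_embedding_ent beta s A Y :
  is_embedding beta s A Y <-> forall n m, ent Y n m = weighted beta s A n m.
Proof.
  unfold is_embedding, weighted, weight, ent.
  split; intros h n m; rewrite h, RtoC_mult; ring.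
Qed.

Lemma is_embedding_unique beta s A Y Z :
  is_embedding beta s A Y -> is_embedding beta s A Z -> Y = Z.
Proof.
  rewrite !is_embedding_ent. intros h1 h2. apply hs_ext_ent. intros. now rewrite h1, h2.
Qed.

(** * Ordered monomials in the creation and annihilation operators *)

Lemma annih_plus x y : annih (fun n => Cplus (x n) (y n)) = fun n => Cplus (annih x n) (annih y n).
Proof. apply functional_extensionality; intros n. unfold annih. ring. Qed.

Lemma annih_scal c x : annih (fun n => Cmult c (x n)) = fun n => Cmult c (annih x n).
Proof. apply functional_extensionality; intros n. unfold annih. ring. Qed.

Lemma creat_plus x y : creat (fun n => Cplus (x n) (y n)) = fun n => Cplus (creat x n) (creat y n).
Proof. apply functional_extensionality; intros [|n]; simpl; ring. Qed.

Lemma creat_scal c x : creat (fun n => Cmult c (x n)) = fun n => Cmult c (creat x n).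
Proof. apply functional_extensionality; intros [|n]; simpl; ring. Qed.

Lemma nc_eval_scal P c x :
  nc_eval P (fun n => Cmult c (x n)) = fun n => Cmult c (nc_eval P x n).
Proof.
  revert x. induction P; intros x; simpl.
  - apply functional_extensionality; intros n. ring.
  - apply annih_scal.
  - apply creat_scal.
  - apply functional_extensionality; intros n. rewrite IHP1, IHP2. ring.
  - now rewrite IHP2, IHP1.
Qed.

Lemma sqrt_sq_C (n : nat) :
  Cmult (RtoC (sqrt (INR n))) (RtoC (sqrt (INR n))) = RtoC (INR n).
Proof. rewrite <- RtoC_mult, sqrt_sqrt; trivial. apply pos_INR. Qed.

Lemma annih_creat x n : annih (creat x) n = Cplus (creat (annih x) n) (x n).
Proof.
  unfold annih. destruct n as [|n]; cbn [creat]; unfold annih;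
    rewrite !Cmult_assoc, !sqrt_sq_C.
  - simpl. ring.
  - rewrite (S_INR (S n)), RtoC_plus. ring.
Qed.

(* Index shift that vanishes at [0]: it stands for a term with index [k - 1]. *)
Definition prev (u : nat -> C) (k : nat) : C :=
  match k with O => RtoC 0 | S k' => u k' end.

Fixpoint annih_poly (k : nat) : ncpoly :=
  match k with
  | O => nc_const (RtoC 1)
  | S k' => nc_mul (nc_const (RtoC (/ INR k))) (nc_mul nc_annih (annih_poly k'))
  end.

(* The coefficient of x^j y^k in exp (tau x y) exp (x a^dagger) exp (y a): it is normally
   ordered for tau = 0 and symmetrically (Weyl) ordered for tau = 1/2. *)
Fixpoint ordered (tau : R) (j k : nat) : ncpoly :=
  match j with
  | O => annih_poly k
  | S j' => nc_mul (nc_const (RtoC (/ INR j)))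
      (match k with
       | O => nc_mul nc_creat (ordered tau j' k)
       | S k' => nc_add (nc_mul nc_creat (ordered tau j' k))
                   (nc_mul (nc_const (RtoC tau)) (ordered tau j' k'))
       end)
  end.

Definition oev (tau : R) (j k : nat) (x : nat -> C) : nat -> C := nc_eval (ordered tau j k) x.

Lemma oev_S tau j k x m : oev tau (S j) k x m =
  Cmult (RtoC (/ INR (S j))) (Cplus (creat (oev tau j k x) m)
    (Cmult (RtoC tau) (prev (fun k' => oev tau j k' x m) k))).
Proof.
  unfold oev. destruct k; cbn -[INR]; trivial. f_equal. ring.
Qed.

Lemma INR_S_C n : RtoC (INR (S n)) = Cplus (RtoC (INR n)) (RtoC 1).
Proof. now rewrite S_INR, RtoC_plus. Qed.

Lemma INR_S_inv n : Cmult (RtoC (INR (S n))) (RtoC (/ INR (S n))) = RtoC 1.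
Proof. rewrite <- RtoC_mult, Rinv_r; trivial. apply not_0_INR. lia. Qed.

Lemma creat_oev tau j k x m : creat (oev tau j k x) m =
  Cminus (Cmult (RtoC (INR (S j))) (oev tau (S j) k x m))
    (Cmult (RtoC tau) (prev (fun k' => oev tau j k' x m) k)).
Proof.
  rewrite oev_S, Cmult_assoc, INR_S_inv. ring.
Qed.

Lemma oev_0_S tau k x m : oev tau 0 (S k) x m =
  Cmult (RtoC (/ INR (S k))) (annih (oev tau 0 k x) m).
Proof. reflexivity. Qed.

Lemma annih_oev_0 tau k x m : annih (oev tau 0 k x) m =
  Cmult (RtoC (INR (S k))) (oev tau 0 (S k) x m).
Proof. rewrite oev_0_S, Cmult_assoc, INR_S_inv. ring. Qed.

Lemma oev_00 tau x m : oev tau 0 0 x m = x m.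
Proof. unfold oev; simpl. ring. Qed.

Lemma creat_prev_r tau j k x m : creat (fun m => prev (fun k' => oev tau j k' x m) k) m =
  prev (fun k' => creat (oev tau j k' x) m) k.
Proof. destruct k; trivial. destruct m; simpl; trivial. ring. Qed.

Lemma creat_prev_l tau j k x m : creat (fun m => prev (fun j' => oev tau j' k x m) j) m =
  prev (fun j' => creat (oev tau j' k x) m) j.
Proof. destruct j; trivial. destruct m; simpl; trivial. ring. Qed.

Lemma annih_prev_r tau j k x m : annih (fun m => prev (fun k' => oev tau j k' x m) k) m =
  prev (fun k' => annih (oev tau j k' x) m) k.
Proof. destruct k; trivial. unfold annih; simpl. ring. Qed.

Lemma prev_ext (u v : nat -> C) k : (forall k, u k = v k) -> prev u k = prev v k.
Proof. intros h. destruct k; simpl; trivial. Qed.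

Lemma prev_plus (u v : nat -> C) k : prev (fun k => Cplus (u k) (v k)) k = Cplus (prev u k) (prev v k).
Proof. destruct k; simpl; trivial. ring. Qed.

Lemma prev_swap (u : nat -> nat -> C) j k :
  prev (fun j => prev (fun k => u j k) k) j = prev (fun k => prev (fun j => u j k) j) k.
Proof. destruct j, k; reflexivity. Qed.

(** In generating functions this is [a exp (x a^dagger) = exp (x a^dagger) (a + x)]: [a] commutes
    with the other factors, and multiplication by [x] shifts [j]. *)
Lemma annih_oev_comm tau j : forall k x m, annih (oev tau j k x) m =
  Cplus (oev tau j k (annih x) m) (prev (fun j' => oev tau j' k x m) j).
Proof.
  induction j as [|j IH]; intros k x m.
  - simpl. revert m. induction k as [|k IHk]; intros m.
    + rewrite oev_00. replace (oev tau 0 0 x) with x; [ring|].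
      apply functional_extensionality; intros; now rewrite oev_00.
    + replace (oev tau 0 (S k) x) with
        (fun m => Cmult (RtoC (/ INR (S k))) (annih (oev tau 0 k x) m))
        by (apply functional_extensionality; intros; now rewrite oev_0_S).
      rewrite annih_scal, oev_0_S.
      replace (annih (oev tau 0 k x)) with (oev tau 0 k (annih x)); [ring|].
      apply functional_extensionality; intros; rewrite IHk; ring.
  - replace (oev tau (S j) k x) with
      (fun m => Cmult (RtoC (/ INR (S j))) (Cplus (creat (oev tau j k x) m)
        (Cmult (RtoC tau) (prev (fun k' => oev tau j k' x m) k))))
      by (apply functional_extensionality; intros; now rewrite oev_S).
    rewrite annih_scal, annih_plus, annih_scal, annih_creat.
    replace (annih (oev tau j k x)) with
      (fun m => Cplus (oev tau j k (annih x) m) (prev (fun j' => oev tau j' k x m) j))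
      by (apply functional_extensionality; intros; now rewrite IH).
    rewrite creat_plus, annih_prev_r, creat_prev_l.
    rewrite (prev_ext (fun k' => annih (oev tau j k' x) m) (fun k' => Cplus (oev tau j k' (annih x) m)
      (prev (fun j' => oev tau j' k' x m) j))) by (intros; apply IH).
    rewrite prev_plus, oev_S, <- prev_swap.
    assert (h : Cplus (prev (fun j' => creat (oev tau j' k x) m) j)
        (Cmult (RtoC tau) (prev (fun j' => prev (fun k' => oev tau j' k' x m) k) j)) =
        Cmult (RtoC (INR j)) (oev tau j k x m)).
    { destruct j as [|j]; cbn [prev]; [simpl; ring|]. rewrite creat_oev. ring. }
    transitivity (Cplus (Cmult (RtoC (/ INR (S j)))
      (Cplus (creat (oev tau j k (annih x)) m)
         (Cmult (RtoC tau) (prev (fun k' => oev tau j k' (annih x) m) k))))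
      (Cmult (RtoC (/ INR (S j))) (Cplus (oev tau j k x m)
        (Cplus (prev (fun j' => creat (oev tau j' k x) m) j)
        (Cmult (RtoC tau) (prev (fun j' => prev (fun k' => oev tau j' k' x m) k) j)))))).
    { ring. }
    rewrite h. f_equal.
    transitivity (Cmult (Cmult (RtoC (INR (S j))) (RtoC (/ INR (S j)))) (oev tau j k x m)).
    { rewrite INR_S_C. ring. }
    rewrite INR_S_inv. simpl. ring.
Qed.

(** In generating functions this is [exp (y a) a^dagger = (a^dagger + y) exp (y a)]. *)
Lemma oev_creat_comm tau j : forall k x m, oev tau j k (creat x) m =
  Cplus (creat (oev tau j k x) m) (prev (fun k' => oev tau j k' x m) k).
Proof.
  induction j as [|j IH]; intros k x m.
  - revert m. induction k as [|k IHk]; intros m.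
    + rewrite oev_00. replace (oev tau 0 0 x) with x; [simpl; ring|].
      apply functional_extensionality; intros; now rewrite oev_00.
    + rewrite oev_0_S.
      replace (oev tau 0 k (creat x)) with
        (fun m => Cplus (creat (oev tau 0 k x) m) (prev (fun k' => oev tau 0 k' x m) k))
        by (apply functional_extensionality; intros; now rewrite IHk).
      rewrite annih_plus, annih_creat, annih_prev_r.
      replace (annih (oev tau 0 k x)) with
        (fun m => Cmult (RtoC (INR (S k))) (oev tau 0 (S k) x m))
        by (apply functional_extensionality; intros; now rewrite annih_oev_0).
      rewrite creat_scal.
      replace (prev (fun k' => annih (oev tau 0 k' x) m) k) with
        (Cmult (RtoC (INR k)) (oev tau 0 k x m))
        by (destruct k; cbn [prev]; [simpl; ring | now rewrite annih_oev_0]).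
      transitivity (Cmult (Cmult (RtoC (INR (S k))) (RtoC (/ INR (S k))))
        (Cplus (creat (oev tau 0 (S k) x) m) (oev tau 0 k x m))).
      { rewrite INR_S_C. ring. }
      rewrite INR_S_inv. simpl. ring.
  - rewrite oev_S.
    replace (oev tau j k (creat x)) with
      (fun m => Cplus (creat (oev tau j k x) m) (prev (fun k' => oev tau j k' x m) k))
      by (apply functional_extensionality; intros; now rewrite IH).
    rewrite (prev_ext (fun k' => oev tau j k' (creat x) m) (fun k' =>
      Cplus (creat (oev tau j k' x) m) (prev (fun k' => oev tau j k' x m) k')))
      by (intros; apply IH).
    rewrite creat_plus, prev_plus.
    replace (oev tau (S j) k x) with
      (fun m => Cmult (RtoC (/ INR (S j))) (Cplus (creat (oev tau j k x) m)
        (Cmult (RtoC tau) (prev (fun k' => oev tau j k' x m) k))))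
      by (apply functional_extensionality; intros; now rewrite oev_S).
    rewrite creat_scal, creat_plus, creat_scal, !creat_prev_r.
    destruct k as [|k]; cbn [prev]; [ring|]. rewrite oev_S. ring.
Qed.

(** Let [E] be the generating function. Its derivative in [y] is [tau x E + E a], and
    [a E = E a + x E]; eliminating [E a] gives [a E] as this derivative plus [(1 - tau) x E]. *)
Lemma annih_oev tau j : forall k x m, annih (oev tau j k x) m =
  Cplus (Cmult (RtoC (INR (S k))) (oev tau j (S k) x m))
    (Cmult (RtoC (1 - tau)) (prev (fun j' => oev tau j' k x m) j)).
Proof.
  induction j as [|j IH]; intros k x m.
  - rewrite annih_oev_0. simpl prev. ring.
  - replace (oev tau (S j) k x) with
      (fun m => Cmult (RtoC (/ INR (S j))) (Cplus (creat (oev tau j k x) m)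
        (Cmult (RtoC tau) (prev (fun k' => oev tau j k' x m) k))))
      by (apply functional_extensionality; intros; now rewrite oev_S).
    rewrite annih_scal, annih_plus, annih_scal, annih_creat, annih_prev_r.
    replace (annih (oev tau j k x)) with
      (fun m => Cplus (Cmult (RtoC (INR (S k))) (oev tau j (S k) x m))
         (Cmult (RtoC (1 - tau)) (prev (fun j' => oev tau j' k x m) j)))
      by (apply functional_extensionality; intros; now rewrite IH).
    rewrite creat_plus, !creat_scal, creat_prev_l, creat_oev. cbn [prev].
    replace (prev (fun k' => annih (oev tau j k' x) m) k) with
      (Cplus (Cmult (RtoC (INR k)) (oev tau j k x m))
         (Cmult (RtoC (1 - tau)) (prev (fun k' => prev (fun j' => oev tau j' k' x m) j) k)))
      by (destruct k; cbn [prev]; [simpl; ring | now rewrite IH]).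
    rewrite <- prev_swap.
    assert (h : prev (fun j' => creat (oev tau j' k x) m) j =
      Cminus (Cmult (RtoC (INR j)) (oev tau j k x m))
        (Cmult (RtoC tau) (prev (fun j' => prev (fun k' => oev tau j' k' x m) k) j))).
    { destruct j as [|j]; cbn [prev]; [simpl; ring | apply creat_oev]. }
    rewrite h. cbn [prev].
    transitivity (Cmult (Cmult (RtoC (INR (S j))) (RtoC (/ INR (S j))))
      (Cplus (Cmult (RtoC (INR (S k))) (oev tau (S j) (S k) x m))
         (Cmult (RtoC (1 - tau)) (oev tau j k x m)))).
    { rewrite !INR_S_C, !RtoC_minus. ring. }
    rewrite INR_S_inv. ring.
Qed.

(* The creation operators of the two modes of the Hilbert-Schmidt Fock space *)
Lemma creat1_oev tau j k x m : Cmult (RtoC (INR (S j))) (oev tau (S j) k x m) =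
  Cplus (Cmult (RtoC (1 - tau)) (creat (oev tau j k x) m))
    (Cmult (RtoC tau) (oev tau j k (creat x) m)).
Proof.
  rewrite oev_creat_comm, creat_oev, RtoC_minus. ring.
Qed.

Lemma creat2_oev tau j k x m : Cmult (RtoC (INR (S k))) (oev tau j (S k) x m) =
  Cplus (Cmult (RtoC (1 - tau)) (oev tau j k (annih x) m))
    (Cmult (RtoC tau) (annih (oev tau j k x) m)).
Proof.
  assert (h1 := annih_oev_comm tau j k x m). assert (h2 := annih_oev tau j k x m).
  rewrite RtoC_minus in *.
  replace (oev tau j k (annih x) m) with
    (Cminus (annih (oev tau j k x) m) (prev (fun j' => oev tau j' k x m) j))
    by (rewrite h1; ring).
  transitivity (Cminus (annih (oev tau j k x) m)
    (Cmult (Cminus (RtoC 1) (RtoC tau)) (prev (fun j' => oev tau j' k x m) j))).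
  - rewrite h2. ring.
  - ring.
Qed.

(** The ladder operators have real entries in the basis [e_n]. Hence the Wick ordered monomials have
    real entries, and the kernels studied below are real sums. *)
Lemma oev_conj tau j : forall k x m,
  oev tau j k (fun n => Cconj (x n)) m = Cconj (oev tau j k x m).
Proof.
  assert (hc : forall r : R, Cconj (RtoC r) = RtoC r).
  { intros r. unfold Cconj, RtoC; simpl. f_equal. lra. }
  induction j as [|j IH]; intros k x m.
  - revert m. induction k as [|k IHk]; intros m.
    + now rewrite !oev_00.
    + rewrite !oev_0_S, Cmult_conj, hc. f_equal. unfold annih.
      now rewrite IHk, Cmult_conj, hc.
  - rewrite !oev_S, Cmult_conj, Cplus_conj, Cmult_conj, !hc. f_equal. f_equal.
    + destruct m; simpl; [symmetry; apply hc|]. now rewrite IH, Cmult_conj, hc.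
    + f_equal. destruct k; simpl; [symmetry; apply hc | apply IH].
Qed.

(** * Orthogonality of the Wick ordered monomials *)

Lemma CSeries_ext a b : (forall n, a n = b n) -> CSeries a = CSeries b.
Proof. intros h. now rewrite (functional_extensionality a b h). Qed.

Lemma CSeries_scal_R (c : R) a : CSeries (fun n => Cmult (RtoC c) (a n)) = Cmult (RtoC c) (CSeries a).
Proof.
  apply Ceq; unfold CSeries, Cmult, RtoC; simpl.
  - rewrite Rmult_0_l, Rminus_0_r, <- Series_scal_l. apply Series_ext.
    intros n. unfold Re; simpl. ring.
  - rewrite Rmult_0_l, Rplus_0_r, <- Series_scal_l. apply Series_ext.
    intros n. unfold Im; simpl. ring.
Qed.

Lemma CSeries_shift a : a 0%nat = RtoC 0 -> CSeries a = CSeries (fun n => a (S n)).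
Proof.
  intros h. unfold CSeries. f_equal.
  - apply (Series_incr_1_aux (fun n => Re (a n))). now rewrite h.
  - apply (Series_incr_1_aux (fun n => Im (a n))). now rewrite h.
Qed.

Lemma CSeries_zero a : (forall n, a n = RtoC 0) -> CSeries a = RtoC 0.
Proof.
  intros h. rewrite (CSeries_single 0); [apply h | intros; apply h].
Qed.

Lemma Cconj_R (r : R) : Cconj (RtoC r) = RtoC r.
Proof. unfold Cconj, RtoC; simpl. f_equal. lra. Qed.

Lemma annih_basis_0 : annih (basis 0) = fun _ => RtoC 0.
Proof.
  apply functional_extensionality. intros m. unfold annih; simpl. ring.
Qed.

Lemma annih_basis_S n :
  annih (basis (S n)) = fun m => Cmult (RtoC (sqrt (INR (S n)))) (basis n m).
Proof.
  apply functional_extensionality. intros m. unfold annih; cbn -[INR].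
  destruct (Nat.eqb_spec m n) as [->|]; [reflexivity | ring].
Qed.

Lemma creat_basis n :
  creat (basis n) = fun m => Cmult (RtoC (sqrt (INR (S n)))) (basis (S n) m).
Proof.
  apply functional_extensionality. intros [|m]; cbn -[INR]; [ring|].
  destruct (Nat.eqb_spec m n) as [->|]; [reflexivity | ring].
Qed.

Lemma nc_eval_zero P : nc_eval P (fun _ => RtoC 0) = fun _ => RtoC 0.
Proof.
  transitivity (nc_eval P (fun n => Cmult (RtoC 0) (basis 0 n))).
  - f_equal. apply functional_extensionality. intros; ring.
  - rewrite nc_eval_scal. apply functional_extensionality. intros; ring.
Qed.

Section orthogonality.

Context (beta s : R) (hb : 0 < beta) (hs01 : 0 <= s <= 1).

Local Notation emb := (emb beta s hb hs01).

(** The mean occupation number of the thermal state [rho]. *)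
Definition nu : R := exp (- beta) / (1 - exp (- beta)).
Definition left_ratio : R := exp (- beta * s).
Definition right_ratio : R := exp (- beta * (1 - s)).
Definition mode1 : R := left_ratio * (1 + nu).
Definition mode2 : R := right_ratio * (1 + nu).

Lemma nu_pos : 0 < nu.
Proof. assert (h := exp_neg_lt1 beta hb). apply Rdiv_lt_0_compat; lra. Qed.

Lemma ratio_mul : left_ratio * right_ratio = exp (- beta).
Proof. unfold left_ratio, right_ratio. rewrite <- exp_plus. f_equal. ring. Qed.

Lemma mode1_pos : 0 < mode1.
Proof. assert (h := nu_pos). apply Rmult_lt_0_compat; [apply exp_pos | lra]. Qed.

Lemma mode2_pos : 0 < mode2.
Proof. assert (h := nu_pos). apply Rmult_lt_0_compat; [apply exp_pos | lra]. Qed.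

Lemma mode1_alt : nu / right_ratio = mode1.
Proof.
  assert (h := exp_neg_lt1 beta hb). assert (hr := exp_pos (- beta * (1 - s))).
  fold right_ratio in hr.
  unfold mode1, nu. apply (Rmult_eq_reg_r right_ratio); [|lra].
  rewrite <- ratio_mul in *. field. lra.
Qed.

Lemma mode2_alt : nu / left_ratio = mode2.
Proof.
  assert (h := exp_neg_lt1 beta hb). assert (hr := exp_pos (- beta * s)).
  fold left_ratio in hr.
  unfold mode2, nu. apply (Rmult_eq_reg_r left_ratio); [|lra].
  rewrite <- ratio_mul in *. field. lra.
Qed.

Lemma weight_sq_S_r n m : weight beta s n (S m) ^ 2 = left_ratio * weight beta s n m ^ 2.
Proof.
  rewrite !weight_sq by trivial. unfold left_ratio. rewrite S_INR.
  replace (- beta * (s * (INR m + 1) + (1 - s) * INR n)) with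
    (- beta * s + - beta * (s * INR m + (1 - s) * INR n)) by ring.
  rewrite exp_plus. ring.
Qed.

Lemma weight_sq_S_l n m : weight beta s (S n) m ^ 2 = right_ratio * weight beta s n m ^ 2.
Proof.
  rewrite !weight_sq by trivial. unfold right_ratio. rewrite S_INR.
  replace (- beta * (s * INR m + (1 - s) * (INR n + 1))) with
    (- beta * (1 - s) + - beta * (s * INR m + (1 - s) * INR n)) by ring.
  rewrite exp_plus. ring.
Qed.

Lemma hs_ip_emb P Q : hs_ip (emb P) (emb Q) = CSeries (fun n => CSeries (fun m =>
  Cmult (RtoC (weight beta s n m ^ 2))
    (Cmult (Cconj (nc_eval P (basis n) m)) (nc_eval Q (basis n) m)))).
Proof.
  unfold hs_ip. apply CSeries_ext. intros n. unfold fock_ip. apply CSeries_ext. intros m.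
  change (Cmult (Cconj (ent (emb P) n m)) (ent (emb Q) n m) = Cmult (RtoC (weight beta s n m ^ 2))
    (Cmult (Cconj (nc_eval P (basis n) m)) (nc_eval Q (basis n) m))).
  rewrite !ent_emb, Cmult_conj, Cconj_R. simpl. rewrite Rmult_1_r, RtoC_mult. ring.
Qed.

(** This is [a rho^s = exp (- beta s) rho^s a] under the trace. The sum over rows is shifted by one,
    its first term being zero because the range of [a^dagger] is orthogonal to [e_0]. *)
Lemma ip_creat_left P Q : hs_ip (emb (nc_mul nc_creat P)) (emb Q) =
  Cmult (RtoC left_ratio) (hs_ip (emb P) (emb (nc_mul nc_annih Q))).
Proof.
  rewrite !hs_ip_emb, <- CSeries_scal_R. apply CSeries_ext. intros n.
  rewrite CSeries_shift.
  - rewrite <- CSeries_scal_R. apply CSeries_ext. intros m.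
    rewrite weight_sq_S_r. cbn [nc_eval creat]. unfold annih.
    rewrite Cmult_conj, Cconj_R, RtoC_mult. ring.
  - simpl. rewrite Cconj_R. ring.
Qed.

Lemma ip_annih_right P Q : hs_ip (emb (nc_mul P nc_annih)) (emb Q) =
  Cmult (RtoC right_ratio) (hs_ip (emb P) (emb (nc_mul Q nc_creat))).
Proof.
  rewrite !hs_ip_emb, <- CSeries_scal_R. rewrite CSeries_shift.
  - apply CSeries_ext. intros n. rewrite <- CSeries_scal_R. apply CSeries_ext. intros m.
    rewrite weight_sq_S_l. cbn [nc_eval]. rewrite annih_basis_S, creat_basis, !nc_eval_scal.
    rewrite Cmult_conj, Cconj_R, RtoC_mult. ring.
  - apply CSeries_zero. intros m. cbn [nc_eval].
    rewrite annih_basis_0, nc_eval_zero, Cconj_R. ring.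
Qed.

Lemma ip_creat_right P Q : hs_ip (emb (nc_mul P nc_creat)) (emb Q) =
  Cmult (RtoC (/ right_ratio)) (hs_ip (emb P) (emb (nc_mul Q nc_annih))).
Proof.
  rewrite (ip_conj _ hs_ip_inner (emb Q) (emb (nc_mul P nc_creat))),
    (ip_conj _ hs_ip_inner (emb (nc_mul Q nc_annih)) (emb P)), ip_annih_right.
  rewrite Cmult_conj, Cconj_R, Cmult_assoc, <- RtoC_mult, Rinv_l.
  - ring.
  - apply Rgt_not_eq, exp_pos.
Qed.

Lemma ip_annih_left P Q : hs_ip (emb (nc_mul nc_annih P)) (emb Q) =
  Cmult (RtoC (/ left_ratio)) (hs_ip (emb P) (emb (nc_mul nc_creat Q))).
Proof.
  rewrite (ip_conj _ hs_ip_inner (emb Q) (emb (nc_mul nc_annih P))),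
    (ip_conj _ hs_ip_inner (emb (nc_mul nc_creat Q)) (emb P)), ip_creat_left.
  rewrite Cmult_conj, Cconj_R, Cmult_assoc, <- RtoC_mult, Rinv_l.
  - ring.
  - apply Rgt_not_eq, exp_pos.
Qed.

Definition wick (j k : nat) : hs := emb (ordered (- nu) j k).

Lemma wick_S_l j k : scal (RtoC (INR (S j))) (wick (S j) k) =
  plus (scal (RtoC (1 + nu)) (emb (nc_mul nc_creat (ordered (- nu) j k))))
    (scal (RtoC (- nu)) (emb (nc_mul (ordered (- nu) j k) nc_creat))).
Proof.
  apply hs_ext_ent. intros n m. rewrite ent_plus, !ent_scal. unfold wick. rewrite !ent_emb.
  cbn [nc_eval]. assert (h := creat1_oev (- nu) j k (basis n) m). unfold oev in h.
  replace (1 - - nu) with (1 + nu) in h by ring.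
  transitivity (Cmult (RtoC (weight beta s n m))
    (Cmult (RtoC (INR (S j))) (nc_eval (ordered (- nu) (S j) k) (basis n) m))); [ring|].
  rewrite h. ring.
Qed.

Lemma wick_S_r j k : scal (RtoC (INR (S k))) (wick j (S k)) =
  plus (scal (RtoC (1 + nu)) (emb (nc_mul (ordered (- nu) j k) nc_annih)))
    (scal (RtoC (- nu)) (emb (nc_mul nc_annih (ordered (- nu) j k)))).
Proof.
  apply hs_ext_ent. intros n m. rewrite ent_plus, !ent_scal. unfold wick. rewrite !ent_emb.
  cbn [nc_eval]. assert (h := creat2_oev (- nu) j k (basis n) m). unfold oev in h.
  replace (1 - - nu) with (1 + nu) in h by ring.
  transitivity (Cmult (RtoC (weight beta s n m))
    (Cmult (RtoC (INR (S k))) (nc_eval (ordered (- nu) j (S k)) (basis n) m))); [ring|].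
  rewrite h. ring.
Qed.

Lemma wick_annih_comm j k : minus (emb (nc_mul nc_annih (ordered (- nu) j k)))
    (emb (nc_mul (ordered (- nu) j k) nc_annih)) =
  match j with O => zero | S j' => wick j' k end.
Proof.
  apply hs_ext_ent. intros n m. rewrite ent_minus, !ent_emb. cbn [nc_eval].
  assert (h := annih_oev_comm (- nu) j k (basis n) m). unfold oev in h. rewrite h.
  destruct j; cbn [prev].
  - rewrite ent_zero. ring.
  - unfold wick. rewrite ent_emb. ring.
Qed.

Lemma wick_creat_comm j k : minus (emb (nc_mul (ordered (- nu) j k) nc_creat))
    (emb (nc_mul nc_creat (ordered (- nu) j k))) =
  match k with O => zero | S k' => wick j k' end.
Proof.
  apply hs_ext_ent. intros n m. rewrite ent_minus, !ent_emb. cbn [nc_eval].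
  assert (h := oev_creat_comm (- nu) j k (basis n) m). unfold oev in h. rewrite h.
  destruct k; cbn [prev].
  - rewrite ent_zero. ring.
  - unfold wick. rewrite ent_emb. ring.
Qed.

(** After [wick_S_l], the ladder operators are moved to the second argument with coefficients
    [(1 + nu) left_ratio] and [nu / right_ratio]. Both equal [mode1], by definition and by
    [mode1_alt], so what remains is [mode1] times the commutator with [a], which lowers [j']. *)
Lemma wick_ip_S_l j k j' k' : Cmult (RtoC (INR (S j))) (hs_ip (wick (S j) k) (wick j' k')) =
  Cmult (RtoC mode1) (prev (fun j' => hs_ip (wick j k) (wick j' k')) j').
Proof.
  transitivity (Cmult (RtoC mode1) (hs_ip (wick j k)
    (match j' with O => zero | S j' => wick j' k' end))).
  - rewrite <- (Cconj_R (INR (S j))), <- (ip_scal_l _ hs_ip_inner), wick_S_l.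
    rewrite (ip_plus_l _ hs_ip_inner), !(ip_scal_l _ hs_ip_inner), !Cconj_R.
    rewrite <- wick_annih_comm, ip_minus_r. unfold wick at 1 2.
    rewrite ip_creat_left, ip_creat_right. fold (wick j k).
    replace (RtoC mode1) with (Cmult (RtoC (1 + nu)) (RtoC left_ratio)) at 1
      by (rewrite <- RtoC_mult; f_equal; unfold mode1; ring).
    unfold wick.
    transitivity (Cminus (Cmult (Cmult (RtoC (1 + nu)) (RtoC left_ratio))
        (hs_ip (emb (ordered (- nu) j k)) (emb (nc_mul nc_annih (ordered (- nu) j' k')))))
      (Cmult (RtoC mode1)
        (hs_ip (emb (ordered (- nu) j k)) (emb (nc_mul (ordered (- nu) j' k') nc_annih))))).
    + rewrite <- mode1_alt. unfold Rdiv. rewrite RtoC_mult, RtoC_opp. ring.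
    + replace (RtoC mode1) with (Cmult (RtoC (1 + nu)) (RtoC left_ratio))
        by (rewrite <- RtoC_mult; f_equal; unfold mode1; ring). ring.
  - destruct j'; cbn [prev]; trivial. now rewrite (ip_zero_r _ hs_ip_inner).
Qed.

Lemma wick_ip_S_r j k j' k' : Cmult (RtoC (INR (S k))) (hs_ip (wick j (S k)) (wick j' k')) =
  Cmult (RtoC mode2) (prev (fun k' => hs_ip (wick j k) (wick j' k')) k').
Proof.
  transitivity (Cmult (RtoC mode2) (hs_ip (wick j k)
    (match k' with O => zero | S k' => wick j' k' end))).
  - rewrite <- (Cconj_R (INR (S k))), <- (ip_scal_l _ hs_ip_inner), wick_S_r.
    rewrite (ip_plus_l _ hs_ip_inner), !(ip_scal_l _ hs_ip_inner), !Cconj_R.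
    rewrite <- wick_creat_comm, ip_minus_r. unfold wick.
    rewrite ip_annih_right, ip_annih_left.
    transitivity (Cminus (Cmult (Cmult (RtoC (1 + nu)) (RtoC right_ratio))
        (hs_ip (emb (ordered (- nu) j k)) (emb (nc_mul (ordered (- nu) j' k') nc_creat))))
      (Cmult (RtoC mode2)
        (hs_ip (emb (ordered (- nu) j k)) (emb (nc_mul nc_creat (ordered (- nu) j' k')))))).
    + rewrite <- mode2_alt. unfold Rdiv. rewrite RtoC_mult, RtoC_opp. ring.
    + replace (RtoC mode2) with (Cmult (RtoC (1 + nu)) (RtoC right_ratio))
        by (rewrite <- RtoC_mult; f_equal; unfold mode2; ring). ring.
  - destruct k'; cbn [prev]; trivial. now rewrite (ip_zero_r _ hs_ip_inner).
Qed.

Definition wick_norm2 (j k : nat) : R := mode1 ^ j * mode2 ^ k / (INR (fact j) * INR (fact k)).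

Lemma wick_norm2_pos j k : 0 < wick_norm2 j k.
Proof.
  apply Rdiv_lt_0_compat; apply Rmult_lt_0_compat;
    (apply pow_lt; apply mode1_pos || apply mode2_pos) || apply INR_fact_lt_0.
Qed.

Lemma wick_norm2_S_l j k : INR (S j) * wick_norm2 (S j) k = mode1 * wick_norm2 j k.
Proof.
  unfold wick_norm2. rewrite fact_simpl, mult_INR. simpl pow.
  assert (h1 := INR_fact_lt_0 j). assert (h2 := INR_fact_lt_0 k).
  assert (h3 := not_0_INR (S j) ltac:(lia)). field. repeat split; lra.
Qed.

Lemma wick_norm2_S_r j k : INR (S k) * wick_norm2 j (S k) = mode2 * wick_norm2 j k.
Proof.
  unfold wick_norm2. rewrite fact_simpl, mult_INR. simpl pow.
  assert (h1 := INR_fact_lt_0 j). assert (h2 := INR_fact_lt_0 k).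
  assert (h3 := not_0_INR (S k) ltac:(lia)). field. repeat split; lra.
Qed.

Lemma rho_normalized : is_series (fun n => (1 - exp (- beta)) * exp (- beta * INR n)) 1.
Proof.
  assert (h := exp_neg_lt1 beta hb).
  apply is_series_ext with (fun n => (1 - exp (- beta)) * exp (- beta) ^ n).
  - intros n. f_equal. rewrite <- Rpower_pow by apply exp_pos. unfold Rpower.
    rewrite ln_exp. f_equal. ring.
  - replace 1 with ((1 - exp (- beta)) * / (1 - exp (- beta))) at 1 by (field; lra).
    apply (is_series_scal (K := R_AbsRing) (V := R_NormedModule)).
    apply is_series_geom. rewrite Rabs_pos_eq; lra.
Qed.

Lemma wick_ip_00 : hs_ip (wick 0 0) (wick 0 0) = RtoC 1.
Proof.
  unfold wick. rewrite hs_ip_emb.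
  transitivity (CSeries (fun n => RtoC ((1 - exp (- beta)) * exp (- beta * INR n)))).
  - apply CSeries_ext. intros n. rewrite (CSeries_single n).
    + simpl. rewrite Nat.eqb_refl, !Cmult_1_l, Cconj_R, Cmult_1_l, Cmult_1_r.
      change (RtoC (weight beta s n n ^ 2) = RtoC ((1 - exp (- beta)) * exp (- beta * INR n))).
      rewrite weight_sq by trivial. do 3 f_equal. ring.
    + intros m hm. simpl. apply Nat.eqb_neq in hm. rewrite hm. ring.
  - unfold CSeries, RtoC; simpl. f_equal.
    + apply is_series_unique, rho_normalized.
    + apply is_series_unique, (Series_single 0 (fun _ => 0)). trivial.
Qed.

Lemma Cmult_reg_INR (n : nat) (x y : C) :
  Cmult (RtoC (INR (S n))) x = Cmult (RtoC (INR (S n))) y -> x = y.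
Proof.
  intros h. rewrite <- (Cmult_1_l x), <- (Cmult_1_l y), <- (INR_S_inv n).
  transitivity (Cmult (RtoC (/ INR (S n))) (Cmult (RtoC (INR (S n))) x)); [ring|].
  rewrite h. ring.
Qed.

(** Each recursion lowers an index of both arguments. If one of them is already at zero, [prev]
    makes the product vanish; when it is the first argument, the recursion is applied to the second
    one by conjugation. Otherwise the descent ends at the trace of [rho]. *)
Lemma wick_ip j k j' k' : hs_ip (wick j k) (wick j' k') =
  if (Nat.eqb j j' && Nat.eqb k k')%bool then RtoC (wick_norm2 j k) else RtoC 0.
Proof.
  assert (hzero : forall k j' k', hs_ip (wick 0 k) (wick (S j') k') = RtoC 0).
  { intros l j1 k1. apply (Cmult_reg_INR j1).
    rewrite (ip_conj _ hs_ip_inner (wick (S j1) k1) (wick 0 l)).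
    rewrite <- (Cconj_R (INR (S j1))), <- Cmult_conj, wick_ip_S_l. cbn [prev].
    rewrite Cmult_0_r, !Cconj_R. ring. }
  revert j'. induction j as [|j IH]; intros [|j']; cbn [Nat.eqb andb].
  - revert k'. induction k as [|k IHk]; intros [|k']; cbn [Nat.eqb].
    + rewrite wick_ip_00. f_equal. unfold wick_norm2. simpl. field.
    + apply (Cmult_reg_INR k').
      rewrite (ip_conj _ hs_ip_inner (wick 0 (S k')) (wick 0 0)).
      rewrite <- (Cconj_R (INR (S k'))), <- Cmult_conj, wick_ip_S_r. cbn [prev].
      rewrite Cmult_0_r, !Cconj_R. ring.
    + apply (Cmult_reg_INR k). rewrite wick_ip_S_r. cbn [prev]. ring.
    + apply (Cmult_reg_INR k). rewrite wick_ip_S_r. cbn [prev]. rewrite IHk.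
      destruct (Nat.eqb k k'); [|ring].
      rewrite <- !RtoC_mult. f_equal. symmetry. apply wick_norm2_S_r.
  - apply hzero.
  - apply (Cmult_reg_INR j). rewrite wick_ip_S_l. cbn [prev]. ring.
  - apply (Cmult_reg_INR j). rewrite wick_ip_S_l. cbn [prev]. rewrite IH.
    destruct (Nat.eqb j j' && Nat.eqb k k')%bool; [|ring].
    rewrite <- !RtoC_mult. f_equal. symmetry. apply wick_norm2_S_l.
Qed.

Lemma wick_ip_diag j k : hs_ip (wick j k) (wick j k) = RtoC (wick_norm2 j k).
Proof. now rewrite wick_ip, !Nat.eqb_refl. Qed.

Lemma wick_ip_neq j k j' k' : j <> j' \/ k <> k' -> hs_ip (wick j k) (wick j' k') = RtoC 0.
Proof.
  intros h. rewrite wick_ip.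
  destruct (Nat.eqb_spec j j'), (Nat.eqb_spec k k'); simpl; trivial. lia.
Qed.

End orthogonality.

(** * Completeness of the Wick ordered monomials *)

Definition unit_entry (n m : nat) (n' m' : nat) : C :=
  if (Nat.eqb n' n && Nat.eqb m' m)%bool then RtoC 1 else RtoC 0.

Lemma unit_entry_bounded n m : exists c, forall A B, box (unit_entry n m) A B <= c.
Proof.
  assert (h1 : forall n', 0 <= Series (fun m' => Cmod (unit_entry n m n' m') ^ 2) /\
    ex_series (fun m' => Cmod (unit_entry n m n' m') ^ 2) /\
    (n' <> n -> Series (fun m' => Cmod (unit_entry n m n' m') ^ 2) = 0)).
  { intros n'.
    assert (hs : is_series (fun m' => Cmod (unit_entry n m n' m') ^ 2)
                   (Cmod (unit_entry n m n' m) ^ 2)).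
    { apply (Series_single m (fun m' => Cmod (unit_entry n m n' m') ^ 2)).
      intros k hk. unfold unit_entry. apply Nat.eqb_neq in hk. rewrite hk, Bool.andb_false_r.
      rewrite Cmod_0. ring. }
    rewrite (is_series_unique _ _ hs). repeat split.
    - apply pow2_ge_0.
    - eexists; exact hs.
    - intros hn. unfold unit_entry. apply Nat.eqb_neq in hn. rewrite hn. simpl.
      rewrite Cmod_0. ring. }
  exists (Series (fun n' => Series (fun m' => Cmod (unit_entry n m n' m') ^ 2))).
  intros A B.
  apply Rle_trans with (sum_f_R0 (fun n' => Series (fun m' => Cmod (unit_entry n m n' m') ^ 2)) A).
  - apply sum_Rle. intros n' _. apply partial_sum_le_Series; [intros; apply pow2_ge_0 | apply h1].
  - apply partial_sum_le_Series; [intros; apply h1|].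
    eexists. apply (Series_single n). intros k hk. now apply h1.
Qed.

Definition matrix_unit (n m : nat) : hs := mat_hs _ (unit_entry_bounded n m).

Lemma ent_matrix_unit n m n' m' : ent (matrix_unit n m) n' m' = unit_entry n m n' m'.
Proof. apply ent_mat_hs. Qed.

Lemma ip_matrix_unit n m Y : hs_ip (matrix_unit n m) Y = ent Y n m.
Proof.
  unfold hs_ip. rewrite (CSeries_single n).
  - unfold fock_ip. rewrite (CSeries_single m).
    + change (Cmult (Cconj (ent (matrix_unit n m) n m)) (ent Y n m) = ent Y n m).
      rewrite ent_matrix_unit. unfold unit_entry. rewrite !Nat.eqb_refl. simpl.
      rewrite Cconj_R. ring.
    + intros k hk.
      change (Cmult (Cconj (ent (matrix_unit n m) n k)) (ent Y n k) = RtoC 0).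
      rewrite ent_matrix_unit. unfold unit_entry. apply Nat.eqb_neq in hk.
      rewrite hk, Bool.andb_false_r, Cconj_R. ring.
  - intros k hk. apply CSeries_zero. intros l.
    change (Cmult (Cconj (ent (matrix_unit n m) k l)) (ent Y k l) = RtoC 0).
    rewrite ent_matrix_unit. unfold unit_entry. apply Nat.eqb_neq in hk.
    rewrite hk. simpl. rewrite Cconj_R. ring.
Qed.

Lemma hs_lim_plus X Y x y : hs_lim X x -> hs_lim Y y ->
  hs_lim (fun K => plus (X K) (Y K)) (plus x y).
Proof.
  intros h1 h2. unfold hs_lim.
  apply is_lim_seq_0_le with (fun K => hs_norm (minus (X K) x) + hs_norm (minus (Y K) y)).
  - intros K. split; [apply ip_norm_ge0|].
    replace (minus (plus (X K) (Y K)) (plus x y)) with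
      (plus (minus (X K) x) (minus (Y K) y)) by hs_ring.
    apply (ip_norm_triangle _ hs_ip_inner).
  - replace 0 with (0 + 0) by lra. now apply is_lim_seq_plus'.
Qed.

Lemma hs_lim_scal (c : C) X x : hs_lim X x -> hs_lim (fun K => scal c (X K)) (scal c x).
Proof.
  intros h. unfold hs_lim.
  apply is_lim_seq_0_le with (fun K => Cmod c * hs_norm (minus (X K) x)).
  - intros K. split; [apply ip_norm_ge0|].
    match goal with |- hs_norm ?a <= _ =>
      replace a with (scal c (minus (X K) x) : hs) by hs_ring end.
    exact (ip_norm_scal _ hs_ip_inner c (minus (X K) x)).
  - now apply is_lim_seq_scal_0.
Qed.

Lemma hs_lim_hsum (X : nat -> nat -> hs) (x : nat -> hs) N :
  (forall n, hs_lim (X n) (x n)) -> hs_lim (fun K => hsum (fun n => X n K) N) (hsum x N).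
Proof. intros h. induction N; simpl; [apply h|]. now apply hs_lim_plus. Qed.

Definition finite_section (Y : hs) (A : nat) : hs :=
  hsum (fun n => hsum (fun m => scal (ent Y n m) (matrix_unit n m)) A) A.

Lemma ent_finite_section Y A n m :
  (n <= A)%nat -> (m <= A)%nat -> ent (finite_section Y A) n m = ent Y n m.
Proof.
  intros hn hm. unfold finite_section. rewrite ent_hsum, (csum_single _ n A hn).
  - rewrite ent_hsum, (csum_single _ m A hm).
    + rewrite ent_scal, ent_matrix_unit. unfold unit_entry. rewrite !Nat.eqb_refl. simpl. ring.
    + intros k _ hk. rewrite ent_scal, ent_matrix_unit. unfold unit_entry.
      apply not_eq_sym, Nat.eqb_neq in hk. rewrite hk, Bool.andb_false_r. ring.
  - intros k _ hk. rewrite ent_hsum. apply csum_zero. intros l _.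
    rewrite ent_scal, ent_matrix_unit. unfold unit_entry.
    apply not_eq_sym, Nat.eqb_neq in hk. rewrite hk. simpl. ring.
Qed.

Lemma norm2_plus_orth (x y : hs) : hs_ip x y = RtoC 0 ->
  hs_norm (plus x y) ^ 2 = hs_norm x ^ 2 + hs_norm y ^ 2.
Proof.
  intros h. rewrite !(ip_norm_sq _ hs_ip_inner).
  rewrite (ip_plus_r _ hs_ip_inner), !(ip_plus_l _ hs_ip_inner), h.
  rewrite (ip_conj _ hs_ip_inner x y), h. unfold Re; simpl. ring.
Qed.

(** The squared norm is the supremum of the boxes. If some box comes within [eps ^ 2] of it, a
    section containing this box leaves a residual, orthogonal to the section, of norm below [eps];
    if none does, [norm_le_box] gives a norm that is too small. *)
Lemma finite_section_approx Y (eps : R) : 0 < eps ->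
  exists A, hs_norm (minus Y (finite_section Y A)) < eps.
Proof.
  intros he. destruct (classic (exists A B, hs_norm Y ^ 2 - eps ^ 2 < box (ent Y) A B))
    as [[A [B h]]|h].
  - exists (Nat.max A B). set (M := Nat.max A B).
    assert (h1 : hs_norm Y ^ 2 =
      hs_norm (finite_section Y M) ^ 2 + hs_norm (minus Y (finite_section Y M)) ^ 2).
    { rewrite <- norm2_plus_orth; [do 2 f_equal; hs_ring|].
      assert (h0 : forall g, (exists n m, (n <= M)%nat /\ (m <= M)%nat /\ g = matrix_unit n m) ->
        hs_ip g (minus Y (finite_section Y M)) = hs_ip g zero).
      { intros g (n & m & hn & hm & ->). rewrite !ip_matrix_unit, ent_minus, ent_finite_section by trivial.
        rewrite ent_zero. ring. }
      rewrite (span_ip_eq _ _ _ h0); [apply (ip_zero_r _ hs_ip_inner)|].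
      apply span_hsum. intros n hn. apply span_hsum. intros m hm. apply span_scal, span_gen.
      now exists n, m. }
    assert (h2 := box_le_norm (finite_section Y M) A B).
    replace (box (ent (finite_section Y M)) A B) with (box (ent Y) A B) in h2.
    2: { unfold box. apply sum_eq; intros n hn. apply sum_eq; intros m hm.
         now rewrite ent_finite_section by lia. }
    apply Rsqr_incrst_0; [|apply ip_norm_ge0|lra]. rewrite !Rsqr_pow2. lra.
  - assert (h1 : hs_norm Y ^ 2 <= hs_norm Y ^ 2 - eps ^ 2).
    { apply norm_le_box. intros A B. apply Rnot_lt_le. intros h1. apply h. now exists A, B. }
    assert (0 < eps ^ 2) by (apply pow_lt; lra). lra.
Qed.

(** * Sums over the triangles j + k <= K *)

Definition tsum (u : nat -> nat -> R) (K : nat) : R :=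
  sum_f_R0 (fun N => sum_f_R0 (fun j => u j (N - j)%nat) N) K.
Definition ctsum (u : nat -> nat -> C) (K : nat) : C :=
  csum (fun N => csum (fun j => u j (N - j)%nat) N) K.
Definition htsum (u : nat -> nat -> hs) (K : nat) : hs :=
  hsum (fun N => hsum (fun j => u j (N - j)%nat) N) K.

Lemma tsum_ext u v K : (forall j k, u j k = v j k) -> tsum u K = tsum v K.
Proof. intros h. apply sum_eq; intros N _. apply sum_eq; intros; apply h. Qed.

Lemma tsum_zero u K : (forall j k, u j k = 0) -> tsum u K = 0.
Proof. intros h. apply sum_eq_R0; intros N _. apply sum_eq_R0; intros; apply h. Qed.

Lemma tsum_plus u v K : tsum (fun j k => u j k + v j k) K = tsum u K + tsum v K.
Proof.
  unfold tsum. rewrite <- plus_sum. apply sum_eq; intros N _. apply plus_sum.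
Qed.

Lemma tsum_scal c u K : tsum (fun j k => c * u j k) K = c * tsum u K.
Proof.
  unfold tsum. rewrite scal_sum. apply sum_eq; intros N _. rewrite Rmult_comm, scal_sum.
  apply sum_eq; intros; ring.
Qed.

Lemma sum_f_R0_first (a : nat -> R) N : sum_f_R0 a (S N) = a 0%nat + sum_f_R0 (fun n => a (S n)) N.
Proof. apply (decomp_sum a (S N)). lia. Qed.

(** Dropping the vanishing edge of the triangle lowers the degree bound by one; this is why [S K]
    and [K] both occur in the kernel recursions. *)
Lemma tsum_shift_l u K : (forall k, u 0%nat k = 0) ->
  tsum u (S K) = tsum (fun j k => u (S j) k) K.
Proof.
  intros h. unfold tsum. rewrite sum_f_R0_first. cbn [sum_f_R0 Nat.sub].
  rewrite h, Rplus_0_l. apply sum_eq; intros N _.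
  change (sum_f_R0 (fun j => u j (S N - j)%nat) (S N) = sum_f_R0 (fun j => u (S j) (N - j)%nat) N).
  rewrite sum_f_R0_first, h, Rplus_0_l. reflexivity.
Qed.

Lemma tsum_shift_r u K : (forall j, u j 0%nat = 0) ->
  tsum u (S K) = tsum (fun j k => u j (S k)) K.
Proof.
  intros h. unfold tsum. rewrite sum_f_R0_first. cbn [sum_f_R0 Nat.sub].
  rewrite h, Rplus_0_l. apply sum_eq; intros N _.
  rewrite Nat.sub_diag, h, Rplus_0_r.
  apply sum_eq; intros j hj. f_equal. destruct j; lia.
Qed.

Lemma ctsum_RtoC u K : ctsum (fun j k => RtoC (u j k)) K = RtoC (tsum u K).
Proof.
  assert (h : forall v N, csum (fun n => RtoC (v n)) N = RtoC (sum_f_R0 v N)).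
  { intros v N. induction N; simpl; trivial. now rewrite IHN, RtoC_plus. }
  unfold ctsum, tsum. rewrite <- h. apply csum_ext. intros N _.
  apply (h (fun j => u j (N - j)%nat)).
Qed.

Lemma ctsum_ext u v K : (forall j k, u j k = v j k) -> ctsum u K = ctsum v K.
Proof. intros h. apply csum_ext; intros N _. apply csum_ext; intros; apply h. Qed.

Lemma ent_htsum u K n m : ent (htsum u K) n m = ctsum (fun j k => ent (u j k) n m) K.
Proof.
  unfold htsum, ctsum. rewrite ent_hsum. apply csum_ext. intros. apply ent_hsum.
Qed.

Lemma ip_htsum x u K : hs_ip x (htsum u K) = ctsum (fun j k => hs_ip x (u j k)) K.
Proof.
  unfold htsum, ctsum. rewrite ip_hsum_r. apply csum_ext. intros. apply ip_hsum_r.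
Qed.

(** * Projections onto bounded degree and their kernels *)

Section completeness.

Context (beta s : R) (hb : 0 < beta) (hs01 : 0 <= s <= 1).

Local Notation wick := (wick beta s hb hs01).
Local Notation wick_norm2 := (wick_norm2 beta s).
Local Notation nu := (nu beta).
Local Notation weight := (weight beta s).

Definition graded (K : nat) (Y : hs) : Prop := exists j k, (j + k <= K)%nat /\ Y = wick j k.

Definition wick_proj (K : nat) (Y : hs) : hs :=
  htsum (fun j k => scal (Cmult (RtoC (/ wick_norm2 j k)) (hs_ip (wick j k) Y)) (wick j k)) K.

Lemma wick_proj_span K Y : span (graded K) (wick_proj K Y).
Proof.
  apply span_hsum. intros N hN. apply span_hsum. intros j hj. apply span_scal, span_gen.
  exists j, (N - j)%nat. split; trivial. lia.
Qed.

Lemma ip_wick_proj K Y j k : (j + k <= K)%nat ->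
  hs_ip (wick j k) (wick_proj K Y) = hs_ip (wick j k) Y.
Proof.
  intros h. unfold wick_proj. rewrite ip_htsum. unfold ctsum.
  rewrite (csum_single _ (j + k) K h).
  - rewrite (csum_single _ j) by
      (lia || (intros i hi hne; rewrite (ip_scal_r _ hs_ip_inner), wick_ip_neq by lia; ring)).
    rewrite (ip_scal_r _ hs_ip_inner). replace (j + k - j)%nat with k by lia.
    rewrite wick_ip_diag.
    transitivity (Cmult (Cmult (RtoC (/ wick_norm2 j k)) (RtoC (wick_norm2 j k)))
      (hs_ip (wick j k) Y)); [ring|].
    rewrite <- RtoC_mult, Rinv_l; [ring|].
    apply Rgt_not_eq, (wick_norm2_pos beta s hb).
  - intros N hN hne. apply csum_zero. intros i hi.
    rewrite (ip_scal_r _ hs_ip_inner), wick_ip_neq by lia. ring.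
Qed.

Lemma span_ip_wick_proj K Y x : span (graded K) x -> hs_ip x (wick_proj K Y) = hs_ip x Y.
Proof.
  apply span_ip_eq. intros g (j & k & h & ->). now apply ip_wick_proj.
Qed.

Lemma wick_proj_unique K Y Z : span (graded K) Z ->
  (forall j k, (j + k <= K)%nat -> hs_ip (wick j k) Z = hs_ip (wick j k) Y) -> wick_proj K Y = Z.
Proof.
  intros hZ h. apply (span_eq (graded K)); trivial; [apply wick_proj_span|].
  intros g (j & k & hjk & ->). rewrite h by trivial. now apply ip_wick_proj.
Qed.

Lemma wick_proj_plus K X Y : wick_proj K (plus X Y) = plus (wick_proj K X) (wick_proj K Y).
Proof.
  apply wick_proj_unique; [apply span_plus; apply wick_proj_span|].
  intros. now rewrite !(ip_plus_r _ hs_ip_inner), !ip_wick_proj.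
Qed.

Lemma wick_proj_scal K (c : C) Y : wick_proj K (scal c Y) = scal c (wick_proj K Y).
Proof.
  apply wick_proj_unique; [apply span_scal; apply wick_proj_span|].
  intros. now rewrite !(ip_scal_r _ hs_ip_inner), !ip_wick_proj.
Qed.

Lemma wick_proj_hsum K u N : wick_proj K (hsum u N) = hsum (fun n => wick_proj K (u n)) N.
Proof. induction N; simpl; trivial. now rewrite wick_proj_plus, IHN. Qed.

Lemma wick_proj_best K Y Z : span (graded K) Z ->
  hs_norm (minus Y (wick_proj K Y)) <= hs_norm (minus Y Z).
Proof.
  intros hZ. apply Rsqr_incr_0_var; [|apply ip_norm_ge0]. rewrite !Rsqr_pow2.
  replace (minus Y Z) with (plus (plus (wick_proj K Y) (scal (Copp (RtoC 1)) Z))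
    (minus Y (wick_proj K Y))) by hs_ring.
  rewrite norm2_plus_orth.
  - assert (h := pow2_ge_0 (hs_norm (plus (wick_proj K Y) (scal (Copp (RtoC 1)) Z)))). lra.
  - rewrite ip_minus_r, span_ip_wick_proj; [ring|].
    apply span_plus; [apply wick_proj_span | now apply span_scal].
Qed.

Lemma norm2_residual K Y :
  hs_norm (minus Y (wick_proj K Y)) ^ 2 = Re (hs_ip Y Y) - Re (hs_ip Y (wick_proj K Y)).
Proof.
  rewrite (ip_norm_sq _ hs_ip_inner).
  assert (h : hs_ip (wick_proj K Y) (minus Y (wick_proj K Y)) = RtoC 0).
  { rewrite ip_minus_r, (span_ip_wick_proj K Y (wick_proj K Y)) by apply wick_proj_span. ring. }
  rewrite (hs_minus_scal Y (wick_proj K Y)) at 1.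
  rewrite (ip_plus_l _ hs_ip_inner), (ip_scal_l _ hs_ip_inner), h, ip_minus_r.
  unfold Re; simpl. ring.
Qed.

(* Row [m], column [n] *)
Definition ord_ent (j k n m : nat) : R := Re (oev (- nu) j k (basis n) m).

Lemma ord_ent_RtoC j k n m : oev (- nu) j k (basis n) m = RtoC (ord_ent j k n m).
Proof.
  assert (h := oev_conj (- nu) j k (basis n) m).
  replace (fun n0 => Cconj (basis n n0)) with (coef (basis n)) in h.
  - apply Ceq; [reflexivity|]. apply (f_equal Im) in h. rewrite im_conj in h.
    transitivity 0; [lra | reflexivity].
  - apply functional_extensionality. intros i. simpl.
    destruct (Nat.eqb i n); now rewrite Cconj_R.
Qed.

Lemma ent_wick j k n m : ent (wick j k) n m = RtoC (weight n m * ord_ent j k n m).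
Proof. unfold wick. rewrite ent_emb, RtoC_mult, <- ord_ent_RtoC. reflexivity. Qed.

(* [lower u n] is sqrt n * u (n - 1), without truncation at [n = 0]. *)
Definition lower (u : nat -> R) (n : nat) : R :=
  match n with O => 0 | S n' => sqrt (INR n) * u n' end.
Definition prevR (u : nat -> R) (n : nat) : R := match n with O => 0 | S n' => u n' end.

Lemma re_scal (r : R) (z : C) : Re (Cmult (RtoC r) z) = r * Re z.
Proof. unfold Re, Cmult, RtoC; simpl. ring. Qed.

Lemma re_creat_oev j k n m : Re (creat (oev (- nu) j k (basis n)) m) = lower (ord_ent j k n) m.
Proof. destruct m; [reflexivity|]. cbn [creat lower]. apply re_scal. Qed.

Lemma re_annih_oev j k n m :
  Re (annih (oev (- nu) j k (basis n)) m) = sqrt (INR (S m)) * ord_ent j k n (S m).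
Proof. apply re_scal. Qed.

Lemma re_oev_creat j k n m :
  Re (oev (- nu) j k (creat (basis n)) m) = sqrt (INR (S n)) * ord_ent j k (S n) m.
Proof. unfold oev. rewrite creat_basis, nc_eval_scal. apply re_scal. Qed.

Lemma re_oev_annih j k n m :
  Re (oev (- nu) j k (annih (basis n)) m) = lower (fun n => ord_ent j k n m) n.
Proof.
  unfold oev. destruct n.
  - rewrite annih_basis_0, nc_eval_zero. reflexivity.
  - rewrite annih_basis_S, nc_eval_scal. apply re_scal.
Qed.

Lemma re_prev (u : nat -> C) n : Re (prev u n) = prevR (fun n => Re (u n)) n.
Proof. destruct n; reflexivity. Qed.

Lemma ord_ent_row j k n m : sqrt (INR (S m)) * ord_ent j k n (S m) =
  lower (fun n => ord_ent j k n m) n + prevR (fun j => ord_ent j k n m) j.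
Proof.
  rewrite <- re_annih_oev, annih_oev_comm. change (Re (Cplus ?x ?y)) with (Re x + Re y).
  now rewrite re_oev_annih, re_prev.
Qed.

Lemma ord_ent_col j k n m : sqrt (INR (S n)) * ord_ent j k (S n) m =
  lower (ord_ent j k n) m + prevR (fun k => ord_ent j k n m) k.
Proof.
  rewrite <- re_oev_creat, oev_creat_comm. change (Re (Cplus ?x ?y)) with (Re x + Re y).
  now rewrite re_creat_oev, re_prev.
Qed.

Lemma ord_ent_S_l j k n m : INR (S j) * ord_ent (S j) k n m =
  (1 + nu) * lower (ord_ent j k n) m - nu * (sqrt (INR (S n)) * ord_ent j k (S n) m).
Proof.
  unfold ord_ent at 1. rewrite <- re_scal, creat1_oev.
  change (Re (Cplus ?x ?y)) with (Re x + Re y).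
  rewrite !re_scal, re_creat_oev, re_oev_creat. ring.
Qed.

Lemma ord_ent_S_r j k n m : INR (S k) * ord_ent j (S k) n m =
  (1 + nu) * lower (fun n => ord_ent j k n m) n - nu * (sqrt (INR (S m)) * ord_ent j k n (S m)).
Proof.
  unfold ord_ent at 1. rewrite <- re_scal, creat2_oev.
  change (Re (Cplus ?x ?y)) with (Re x + Re y).
  rewrite !re_scal, re_annih_oev, re_oev_annih. ring.
Qed.

(* The matrix entries of [wick_proj K], divided by the weights.  The commutators of the Wick
   ordered monomials with a and a^dagger give recursions in [(n', m')], so that completeness
   propagates from [n' = m' = 0], where Parseval's identity is a geometric series. *)
Definition kernel (K n' m' n m : nat) : R :=
  tsum (fun j k => / wick_norm2 j k * (ord_ent j k n' m' * ord_ent j k n m)) K.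

Lemma ent_proj_unit K n' m' n m :
  ent (wick_proj K (matrix_unit n' m')) n m = RtoC (weight n' m' * weight n m * kernel K n' m' n m).
Proof.
  unfold wick_proj, kernel. rewrite ent_htsum, <- tsum_scal, <- ctsum_RtoC.
  apply ctsum_ext. intros j k.
  rewrite ent_scal, (ip_conj _ hs_ip_inner (matrix_unit n' m')), ip_matrix_unit, !ent_wick, Cconj_R.
  rewrite <- !RtoC_mult. f_equal. ring.
Qed.

(** [ord_ent_row] splits the left side into a sum that moves [n'] and a sum that lowers [j] in the
    primed entry. In the second one [j] is reindexed, and [ord_ent_S_l] expresses the raised
    unprimed entry by neighbouring entries in [(n, m)]; the quotient of consecutive norms supplies
    the factor [INR (S j) / mode1]. *)
Lemma kernel_row K n' m' n m :
  sqrt (INR (S m')) * kernel (S K) n' (S m') n m =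
  lower (fun n' => kernel (S K) n' m' n m) n' +
  (/ left_ratio beta s * lower (fun m => kernel K n' m' n m) m -
   right_ratio beta s * (sqrt (INR (S n)) * kernel K n' m' (S n) m)).
Proof.
  unfold kernel at 1. rewrite <- tsum_scal.
  rewrite (tsum_ext _ (fun j k =>
    / wick_norm2 j k * (lower (fun n' => ord_ent j k n' m') n' * ord_ent j k n m) +
    / wick_norm2 j k * (prevR (fun j => ord_ent j k n' m') j * ord_ent j k n m))).
  2: { intros j k. rewrite <- Rmult_plus_distr_l, <- Rmult_plus_distr_r, <- ord_ent_row. ring. }
  rewrite tsum_plus. f_equal.
  - destruct n' as [|n']; simpl lower.
    + rewrite tsum_zero; [ring | intros; ring].
    + unfold kernel. rewrite <- tsum_scal. apply tsum_ext. intros; ring.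
  - rewrite tsum_shift_l by (intros; simpl; ring). simpl prevR.
    assert (hl := Rgt_not_eq _ _ (exp_pos (- beta * s))). fold (left_ratio beta s) in hl.
    assert (hr := Rgt_not_eq _ _ (exp_pos (- beta * (1 - s)))). fold (right_ratio beta s) in hr.
    assert (hnu := nu_pos beta hb).
    rewrite (tsum_ext _ (fun j k =>
      / left_ratio beta s * (/ wick_norm2 j k * (ord_ent j k n' m' * lower (ord_ent j k n) m)) +
      (- right_ratio beta s * sqrt (INR (S n))) *
      (/ wick_norm2 j k * (ord_ent j k n' m' * ord_ent j k (S n) m)))).
    + rewrite tsum_plus, !tsum_scal. fold (kernel K n' m' (S n) m).
      replace (tsum (fun j k => / wick_norm2 j k * (ord_ent j k n' m' * lower (ord_ent j k n) m)) K)
        with (lower (fun m => kernel K n' m' n m) m); [ring|].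
      destruct m as [|m]; simpl lower.
      * rewrite tsum_zero; [ring | intros; ring].
      * unfold kernel. rewrite <- tsum_scal. apply tsum_ext. intros; ring.
    + intros j k.
      assert (h1 := wick_norm2_S_l beta s j k).
      assert (h2 := wick_norm2_pos beta s hb j k).
      assert (h3 := wick_norm2_pos beta s hb (S j) k).
      assert (h4 := ord_ent_S_l j k n m).
      assert (h5 := not_0_INR (S j) ltac:(lia)).
      assert (h6 := mode1_pos beta s hb).
      assert (h7 := mode1_alt beta s hb).
      assert (h8 : wick_norm2 (S j) k = mode1 beta s * wick_norm2 j k / INR (S j)).
      { rewrite <- h1. field. trivial. }
      rewrite h8.
      replace (/ (mode1 beta s * wick_norm2 j k / INR (S j)) *
        (ord_ent j k n' m' * ord_ent (S j) k n m)) with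
        (/ wick_norm2 j k * (ord_ent j k n' m' *
          (/ mode1 beta s * (INR (S j) * ord_ent (S j) k n m)))) by (field; lra).
      rewrite h4.
      (* The two expressions for [mode1] are used here, one in each term, and remove [nu] from the
         recursion. *)
      assert (h9 : / mode1 beta s * (1 + nu) = / left_ratio beta s).
      { unfold mode1. field. split; lra. }
      assert (h10 : / mode1 beta s * nu = right_ratio beta s).
      { rewrite <- h7. field. split; lra. }
      replace (/ mode1 beta s * ((1 + nu) * lower (ord_ent j k n) m -
        nu * (sqrt (INR (S n)) * ord_ent j k (S n) m))) with
        ((/ mode1 beta s * (1 + nu)) * lower (ord_ent j k n) m -
         (/ mode1 beta s * nu) * (sqrt (INR (S n)) * ord_ent j k (S n) m)) by ring.
      rewrite h9, h10. ring.
Qed.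

Lemma kernel_col K n' m' n m :
  sqrt (INR (S n')) * kernel (S K) (S n') m' n m =
  lower (fun m' => kernel (S K) n' m' n m) m' +
  (/ right_ratio beta s * lower (fun n => kernel K n' m' n m) n -
   left_ratio beta s * (sqrt (INR (S m)) * kernel K n' m' n (S m))).
Proof.
  unfold kernel at 1. rewrite <- tsum_scal.
  rewrite (tsum_ext _ (fun j k =>
    / wick_norm2 j k * (lower (fun m' => ord_ent j k n' m') m' * ord_ent j k n m) +
    / wick_norm2 j k * (prevR (fun k => ord_ent j k n' m') k * ord_ent j k n m))).
  2: { intros j k. rewrite <- Rmult_plus_distr_l, <- Rmult_plus_distr_r, <- ord_ent_col. ring. }
  rewrite tsum_plus. f_equal.
  - destruct m' as [|m']; simpl lower.
    + rewrite tsum_zero; [ring | intros; ring].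
    + unfold kernel. rewrite <- tsum_scal. apply tsum_ext. intros; ring.
  - rewrite tsum_shift_r by (intros; simpl; ring). simpl prevR.
    assert (hl := Rgt_not_eq _ _ (exp_pos (- beta * s))). fold (left_ratio beta s) in hl.
    assert (hr := Rgt_not_eq _ _ (exp_pos (- beta * (1 - s)))). fold (right_ratio beta s) in hr.
    assert (hnu := nu_pos beta hb).
    rewrite (tsum_ext _ (fun j k =>
      / right_ratio beta s *
        (/ wick_norm2 j k * (ord_ent j k n' m' * lower (fun n => ord_ent j k n m) n)) +
      (- left_ratio beta s * sqrt (INR (S m))) *
      (/ wick_norm2 j k * (ord_ent j k n' m' * ord_ent j k n (S m))))).
    + rewrite tsum_plus, !tsum_scal. fold (kernel K n' m' n (S m)).
      replace (tsum (fun j k => / wick_norm2 j k *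
        (ord_ent j k n' m' * lower (fun n => ord_ent j k n m) n)) K)
        with (lower (fun n => kernel K n' m' n m) n); [ring|].
      destruct n as [|n]; simpl lower.
      * rewrite tsum_zero; [ring | intros; ring].
      * unfold kernel. rewrite <- tsum_scal. apply tsum_ext. intros; ring.
    + intros j k.
      assert (h1 := wick_norm2_S_r beta s j k).
      assert (h2 := wick_norm2_pos beta s hb j k).
      assert (h4 := ord_ent_S_r j k n m).
      assert (h5 := not_0_INR (S k) ltac:(lia)).
      assert (h6 := mode2_pos beta s hb).
      assert (h7 := mode2_alt beta s hb).
      assert (h8 : wick_norm2 j (S k) = mode2 beta s * wick_norm2 j k / INR (S k)).
      { rewrite <- h1. field. trivial. }
      rewrite h8.
      replace (/ (mode2 beta s * wick_norm2 j k / INR (S k)) *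
        (ord_ent j k n' m' * ord_ent j (S k) n m)) with
        (/ wick_norm2 j k * (ord_ent j k n' m' *
          (/ mode2 beta s * (INR (S k) * ord_ent j (S k) n m)))) by (field; lra).
      rewrite h4.
      assert (h9 : / mode2 beta s * (1 + nu) = / right_ratio beta s).
      { unfold mode2. field. split; lra. }
      assert (h10 : / mode2 beta s * nu = left_ratio beta s).
      { rewrite <- h7. field. split; lra. }
      replace (/ mode2 beta s * ((1 + nu) * lower (fun n => ord_ent j k n m) n -
        nu * (sqrt (INR (S m)) * ord_ent j k n (S m)))) with
        ((/ mode2 beta s * (1 + nu)) * lower (fun n => ord_ent j k n m) n -
         (/ mode2 beta s * nu) * (sqrt (INR (S m)) * ord_ent j k n (S m))) by ring.
      rewrite h9, h10. ring.
Qed.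

End completeness.

Lemma sum_f_R0_single (a : nat -> R) n N : (n <= N)%nat ->
  (forall k, (k <= N)%nat -> k <> n -> a k = 0) -> sum_f_R0 a N = a n.
Proof.
  induction N as [|N IH]; intros hn h; simpl.
  - now replace n with 0%nat by lia.
  - destruct (Nat.eq_dec n (S N)) as [->|].
    + rewrite sum_eq_R0; [ring|]. intros; apply h; lia.
    + rewrite IH, (h (S N)); [ring | lia | lia | lia | intros; apply h; lia].
Qed.

Lemma is_series_even (a : nat -> R) (l : R) :
  is_series (fun n => a (2 * n)%nat) l -> (forall n, a (2 * n + 1)%nat = 0) -> is_series a l.
Proof.
  intros h1 h2.
  assert (h : is_pseries a 1 (l + 1 * 0)).
  { apply is_pseries_odd_even; apply is_pseries_R.
    - apply is_series_ext with (2 := h1). intros n.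
      replace (1 ^ 2) with 1 by ring. rewrite pow1. symmetry. apply Rmult_1_r.
    - apply is_series_ext with (fun _ : nat => 0).
      + intros n. rewrite h2. symmetry. apply Rmult_0_l.
      + apply (Series_single 0 (fun _ => 0)). trivial. }
  apply is_pseries_R in h. rewrite Rmult_0_r, Rplus_0_r in h.
  apply is_series_ext with (2 := h). intros n. rewrite pow1. apply Rmult_1_r.
Qed.

Lemma is_lim_seq_of_sq (u : nat -> R) : (forall K, 0 <= u K) ->
  is_lim_seq (fun K => u K ^ 2) 0 -> is_lim_seq u 0.
Proof.
  intros h0 h. apply is_lim_seq_spec. apply is_lim_seq_spec in h. intros eps.
  assert (he : 0 < eps ^ 2) by (apply pow_lt, cond_pos).
  destruct (h (mkposreal _ he)) as [N hN]. exists N. intros n hn. specialize (hN n hn).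
  simpl in hN. rewrite Rminus_0_r in *. rewrite Rabs_pos_eq by apply h0.
  assert (hp := pow2_ge_0 (u n)). simpl in hp. rewrite Rabs_pos_eq in hN by lra.
  apply Rsqr_incrst_0; [|apply h0|apply Rlt_le, cond_pos]. rewrite !Rsqr_pow2. simpl. lra.
Qed.

Lemma is_lim_seq_lower (u : nat -> nat -> R) (l : nat -> R) (n : nat) :
  (forall i, n = S i -> is_lim_seq (fun K => u K i) (l i)) ->
  is_lim_seq (fun K => lower (u K) n) (lower l n).
Proof.
  intros h. destruct n as [|n]; cbn [lower]; [apply is_lim_seq_const|].
  apply (is_lim_seq_scal_l (fun K => u K n) (sqrt (INR (S n))) (l n)). now apply h.
Qed.

(** * Convergence of the projections to the identity *)

Section convergence.

Context (beta s : R) (hb : 0 < beta) (hs01 : 0 <= s <= 1).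

Local Notation wick := (wick beta s hb hs01).
Local Notation wick_norm2 := (wick_norm2 beta s).
Local Notation nu := (nu beta).
Local Notation weight := (weight beta s).
Local Notation kernel := (kernel beta s).
Local Notation ord_ent := (ord_ent beta).
Local Notation wick_proj := (wick_proj beta s hb hs01).
Local Notation graded := (graded beta s hb hs01).

(** The kernel of the identity operator after division by the two weights, as in [ent_proj_unit]. *)
Definition kernel_lim (n' m' n m : nat) : R :=
  if (Nat.eqb n n' && Nat.eqb m m')%bool then / weight n m ^ 2 else 0.

Lemma ratio_neq0 : left_ratio beta s <> 0 /\ right_ratio beta s <> 0.
Proof. split; apply Rgt_not_eq, exp_pos. Qed.

Lemma weight_neq0 n m : weight n m <> 0.
Proof. apply Rgt_not_eq, weight_pos. Qed.

(** The identity satisfies the recursion of [kernel_row]: the left side equals the term with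
    [left_ratio], and the other two terms cancel. *)
Lemma kernel_lim_row n' m' n m :
  sqrt (INR (S m')) * kernel_lim n' (S m') n m =
  lower (fun n' => kernel_lim n' m' n m) n' +
  (/ left_ratio beta s * lower (fun m => kernel_lim n' m' n m) m -
   right_ratio beta s * (sqrt (INR (S n)) * kernel_lim n' m' (S n) m)).
Proof.
  destruct ratio_neq0 as [hl hr]. unfold kernel_lim.
  rewrite weight_sq_S_l by trivial.
  assert (h1 : sqrt (INR (S m')) * (if (Nat.eqb n n' && Nat.eqb m (S m'))%bool
      then / weight n m ^ 2 else 0) =
    / left_ratio beta s * lower (fun m =>
      if (Nat.eqb n n' && Nat.eqb m m')%bool then / weight n m ^ 2 else 0) m).
  { destruct m as [|m]; cbn [lower Nat.eqb]; [rewrite Bool.andb_false_r; ring|].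
    rewrite weight_sq_S_r by trivial. assert (hw := weight_neq0 n m).
    destruct (Nat.eqb n n'), (Nat.eqb_spec m m') as [->|]; simpl andb; cbn iota; try ring.
    field; auto. }
  assert (h2 : right_ratio beta s * (sqrt (INR (S n)) * (if (Nat.eqb (S n) n' && Nat.eqb m m')%bool
      then / (right_ratio beta s * weight n m ^ 2) else 0)) =
    lower (fun n' => if (Nat.eqb n n' && Nat.eqb m m')%bool then / weight n m ^ 2 else 0) n').
  { assert (hw := weight_neq0 n m).
    destruct n' as [|n']; cbn [lower Nat.eqb andb]; cbn iota; [ring|].
    destruct (Nat.eqb_spec n n') as [->|], (Nat.eqb m m'); simpl andb; cbn iota; try ring.
    field; auto. }
  rewrite h1, h2. ring.
Qed.

Lemma kernel_lim_col n' m' n m :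
  sqrt (INR (S n')) * kernel_lim (S n') m' n m =
  lower (fun m' => kernel_lim n' m' n m) m' +
  (/ right_ratio beta s * lower (fun n => kernel_lim n' m' n m) n -
   left_ratio beta s * (sqrt (INR (S m)) * kernel_lim n' m' n (S m))).
Proof.
  destruct ratio_neq0 as [hl hr]. unfold kernel_lim.
  rewrite weight_sq_S_r by trivial.
  assert (h1 : sqrt (INR (S n')) * (if (Nat.eqb n (S n') && Nat.eqb m m')%bool
      then / weight n m ^ 2 else 0) =
    / right_ratio beta s * lower (fun n =>
      if (Nat.eqb n n' && Nat.eqb m m')%bool then / weight n m ^ 2 else 0) n).
  { destruct n as [|n]; cbn [lower Nat.eqb andb]; cbn iota; [ring|].
    rewrite weight_sq_S_l by trivial. assert (hw := weight_neq0 n m).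
    destruct (Nat.eqb_spec n n') as [->|], (Nat.eqb m m'); simpl andb; cbn iota; try ring.
    field; auto. }
  assert (h2 : left_ratio beta s * (sqrt (INR (S m)) * (if (Nat.eqb n n' && Nat.eqb (S m) m')%bool
      then / (left_ratio beta s * weight n m ^ 2) else 0)) =
    lower (fun m' => if (Nat.eqb n n' && Nat.eqb m m')%bool then / weight n m ^ 2 else 0) m').
  { assert (hw := weight_neq0 n m).
    destruct m' as [|m']; cbn [lower Nat.eqb]; [rewrite Bool.andb_false_r; ring|].
    destruct (Nat.eqb n n'), (Nat.eqb_spec m m') as [->|]; simpl andb; cbn iota; try ring.
    field; auto. }
  rewrite h1, h2. ring.
Qed.

Definition kernel_cv (n' m' : nat) : Prop :=
  forall n m, is_lim_seq (fun K => kernel K n' m' n m) (kernel_lim n' m' n m).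

Lemma is_lim_seq_div_l (c l : R) (u : nat -> R) :
  c <> 0 -> is_lim_seq (fun K => c * u (S K)) (c * l) -> is_lim_seq u l.
Proof.
  intros hc h. apply is_lim_seq_incr_1.
  apply is_lim_seq_ext with (fun K => / c * (c * u (S K))); [intros; field; trivial|].
  replace (Finite l) with (Rbar_mult (/ c) (c * l)) by (simpl; f_equal; field; trivial).
  now apply is_lim_seq_scal_l.
Qed.

Lemma sqrt_INR_S_neq0 n : sqrt (INR (S n)) <> 0.
Proof. apply Rgt_not_eq, sqrt_lt_R0, lt_0_INR. lia. Qed.

(** The second hypothesis is empty for [n' = 0], where [lower] drops the corresponding term of the
    recursion. *)
Lemma kernel_cv_row n' m' : kernel_cv n' m' -> (forall i, n' = S i -> kernel_cv i m') ->
  kernel_cv n' (S m').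
Proof.
  intros h1 h2 n m. apply (is_lim_seq_div_l (sqrt (INR (S m')))); [apply sqrt_INR_S_neq0|].
  rewrite kernel_lim_row.
  apply is_lim_seq_ext with (2 := is_lim_seq_plus' _ _ _ _
    (is_lim_seq_lower (fun K n' => kernel (S K) n' m' n m) (fun n' => kernel_lim n' m' n m) n'
      (fun i hi => proj1 (is_lim_seq_incr_1 _ _) (h2 i hi n m)))
    (is_lim_seq_minus' _ _ _ _
      (is_lim_seq_scal_l _ (/ left_ratio beta s) _
        (is_lim_seq_lower (fun K m => kernel K n' m' n m) (fun m => kernel_lim n' m' n m) m
          (fun i _ => h1 n i)))
      (is_lim_seq_scal_l _ (right_ratio beta s) _
        (is_lim_seq_scal_l _ (sqrt (INR (S n))) _ (h1 (S n) m))))).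
  intros K. symmetry. now apply kernel_row.
Qed.

Lemma kernel_cv_col n' m' : kernel_cv n' m' -> (forall i, m' = S i -> kernel_cv n' i) ->
  kernel_cv (S n') m'.
Proof.
  intros h1 h2 n m. apply (is_lim_seq_div_l (sqrt (INR (S n')))); [apply sqrt_INR_S_neq0|].
  rewrite kernel_lim_col.
  apply is_lim_seq_ext with (2 := is_lim_seq_plus' _ _ _ _
    (is_lim_seq_lower (fun K m' => kernel (S K) n' m' n m) (fun m' => kernel_lim n' m' n m) m'
      (fun i hi => proj1 (is_lim_seq_incr_1 _ _) (h2 i hi n m)))
    (is_lim_seq_minus' _ _ _ _
      (is_lim_seq_scal_l _ (/ right_ratio beta s) _
        (is_lim_seq_lower (fun K n => kernel K n' m' n m) (fun n => kernel_lim n' m' n m) n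
          (fun i _ => h1 i m)))
      (is_lim_seq_scal_l _ (left_ratio beta s) _
        (is_lim_seq_scal_l _ (sqrt (INR (S m))) _ (h1 n (S m)))))).
  intros K. symmetry. now apply kernel_col.
Qed.

(** Between vacuum vectors the two exponentials of ladder operators contribute 1, so that only
    [exp (- nu x y)] is left. *)
Lemma ord_ent_00 j k : ord_ent j k 0 0 = if Nat.eqb j k then (- nu) ^ j / INR (fact j) else 0.
Proof.
  assert (hrec : forall j k, INR (S j) * ord_ent (S j) k 0 0 =
    - nu * prevR (fun k => ord_ent j k 0 0) k).
  { intros i l. rewrite ord_ent_S_l, ord_ent_col. simpl lower. ring. }
  revert k. induction j as [|j IH]; intros k.
  - destruct k as [|k]; cbn [Nat.eqb].
    + unfold ord_ent. rewrite oev_00. simpl. field.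
    + apply (Rmult_eq_reg_l (INR (S k))); [|apply not_0_INR; lia].
      rewrite ord_ent_S_r, ord_ent_row. simpl. ring.
  - apply (Rmult_eq_reg_l (INR (S j))); [|apply not_0_INR; lia]. rewrite hrec.
    destruct k as [|k]; cbn [prevR Nat.eqb]; [ring|]. rewrite IH.
    destruct (Nat.eqb j k); [|ring].
    rewrite fact_simpl, mult_INR. simpl pow. field. split.
    + apply INR_fact_neq_0.
    + apply not_0_INR; lia.
Qed.

(** Only the terms with [j = k] survive, that is, even total degree. Since [nu^2 / (mode1 mode2) =
    left_ratio right_ratio], they form the geometric series of ratio [exp (- beta)], whose sum is
    the inverse of the squared weight at the origin. *)
Lemma kernel_00 : is_lim_seq (fun K => kernel K 0 0 0 0) (/ weight 0 0 ^ 2).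
Proof.
  assert (hq := exp_neg_lt1 beta hb).
  assert (hterm : forall j, / wick_norm2 j j * (ord_ent j j 0 0 * ord_ent j j 0 0) =
    exp (- beta) ^ j).
  { intros j. rewrite ord_ent_00, Nat.eqb_refl, <- (ratio_mul beta s).
    unfold wick_norm2. rewrite <- mode1_alt, <- mode2_alt by trivial.
    destruct ratio_neq0 as [hl hr]. assert (hn := nu_pos beta hb).
    unfold Rdiv. rewrite !Rpow_mult_distr, !pow_inv.
    replace ((- nu) ^ j * / INR (fact j) * ((- nu) ^ j * / INR (fact j))) with
      (nu ^ j * nu ^ j * (/ INR (fact j) * / INR (fact j))).
    - field. repeat split; try apply pow_nonzero; trivial; try lra.
      apply INR_fact_neq_0.
    - replace (- nu) with (-1 * nu) by ring. rewrite Rpow_mult_distr.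
      transitivity ((-1) ^ j * (-1) ^ j * (nu ^ j * nu ^ j * (/ INR (fact j) * / INR (fact j))));
        [|ring].
      rewrite <- (Rpow_mult_distr (-1) (-1)). replace (-1 * -1) with 1 by ring. rewrite pow1. ring. }
  set (c := fun N => sum_f_R0 (fun j => / wick_norm2 j (N - j) *
    (ord_ent j (N - j) 0 0 * ord_ent j (N - j) 0 0)) N).
  assert (hc : is_series c (/ (1 - exp (- beta)))).
  { apply is_series_even.
    - apply is_series_ext with (fun n => exp (- beta) ^ n).
      + intros n. unfold c. rewrite (sum_f_R0_single _ n); [|lia|].
        * replace (2 * n - n)%nat with n by lia. symmetry. apply hterm.
        * intros k hk hne. rewrite ord_ent_00.
          destruct (Nat.eqb_spec k (2 * n - k)); [lia | ring].
      + apply is_series_geom. rewrite Rabs_pos_eq; lra.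
    - intros n. apply sum_eq_R0. intros k hk. rewrite ord_ent_00.
      destruct (Nat.eqb_spec k (2 * n + 1 - k)); [lia | ring]. }
  replace (weight 0 0 ^ 2) with (1 - exp (- beta)).
  - apply is_lim_seq_ext with (2 := hc). intros K. apply sum_n_Reals.
  - rewrite weight_sq by trivial. simpl INR. rewrite !Rmult_0_r, Rplus_0_r, Rmult_0_r, exp_0. ring.
Qed.

(** The squared distance from the matrix unit to its projection is [1 - weight ^ 2 * kernel], so one
    diagonal value of the kernel decides norm convergence. *)
Lemma matrix_unit_approx n m :
  is_lim_seq (fun K => kernel K n m n m) (/ weight n m ^ 2) ->
  hs_lim (fun K => wick_proj K (matrix_unit n m)) (matrix_unit n m).
Proof.
  intros h. unfold hs_lim. apply is_lim_seq_of_sq; [intros; apply ip_norm_ge0|].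
  apply is_lim_seq_ext with (fun K => 1 - weight n m ^ 2 * kernel K n m n m).
  - intros K. rewrite hs_norm_minus_sym.
    rewrite norm2_residual, !ip_matrix_unit, ent_proj_unit, ent_matrix_unit.
    unfold unit_entry. rewrite !Nat.eqb_refl. unfold Re; simpl. ring.
  - replace 0 with (1 - weight n m ^ 2 * / weight n m ^ 2) by (field; apply weight_neq0).
    apply is_lim_seq_minus'; [apply is_lim_seq_const|].
    now apply (is_lim_seq_scal_l _ (weight n m ^ 2) (/ weight n m ^ 2)).
Qed.

Lemma kernel_cv_all n m : kernel_cv n m.
Proof.
  (* One diagonal value gives norm convergence for the matrix unit at the origin, and norm
     convergence gives the limits of all its other entries. *)
  assert (h00 : kernel_cv 0 0).
  { intros n' m'. assert (h := hs_lim_ent _ _ n' m' (matrix_unit_approx 0 0 kernel_00)).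
    destruct h as [h _].
    assert (hw := weight_neq0 0 0). assert (hw' := weight_neq0 n' m').
    assert (h' := is_lim_seq_scal_l _ (/ (weight 0 0 * weight n' m')) _ h).
    replace (Finite (kernel_lim 0 0 n' m')) with
      (Rbar_mult (/ (weight 0 0 * weight n' m')) (Re (ent (matrix_unit 0 0) n' m'))).
    - apply is_lim_seq_ext with (2 := h'). intros K. rewrite ent_proj_unit. unfold Re; simpl. field; auto.
    - rewrite ent_matrix_unit. unfold unit_entry, kernel_lim. simpl. f_equal.
      destruct (Nat.eqb_spec n' 0) as [->|], (Nat.eqb_spec m' 0) as [->|]; simpl; field; auto. }
  (* With [m' = 0] the column recursion has no [lower] term in the primed index. Once every [n] is
     reached there, the row recursion raises [m] for all [n] at once. *)
  assert (hcol : forall n, kernel_cv n 0).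
  { induction n0 as [|i IH]; trivial. apply kernel_cv_col; trivial. discriminate. }
  revert n. induction m as [|m IH]; trivial.
  intros n. now apply kernel_cv_row.
Qed.

(** The projection of a finite section of [Y] lies in the span of degree at most [K], so best
    approximation compares it with the projection of [Y]. *)
Lemma wick_proj_cv (Y : hs) : hs_lim (fun K => wick_proj K Y) Y.
Proof.
  apply is_lim_seq_spec. intros eps.
  destruct (finite_section_approx Y (eps / 2)) as [A hA]. { generalize (cond_pos eps); lra. }
  assert (h : hs_lim (fun K => wick_proj K (finite_section Y A)) (finite_section Y A)).
  { unfold finite_section at 2. eapply is_lim_seq_ext; [|apply hs_lim_hsum; intros n; apply hs_lim_hsum;
      intros m; apply (hs_lim_scal (ent Y n m)), matrix_unit_approx].
    - intros K. simpl. do 2 f_equal. unfold finite_section. rewrite wick_proj_hsum.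
      apply hsum_ext. intros n _. rewrite wick_proj_hsum. apply hsum_ext. intros m _.
      symmetry. apply wick_proj_scal.
    - assert (hk := kernel_cv_all n m n m). unfold kernel_lim in hk.
      now rewrite !Nat.eqb_refl in hk. }
  apply is_lim_seq_spec in h.
  assert (he : 0 < eps / 2) by (generalize (cond_pos eps); lra).
  destruct (h (mkposreal _ he)) as [N hN]. exists N. intros K hK. specialize (hN K hK).
  simpl in hN. rewrite Rminus_0_r, Rabs_pos_eq in hN by apply ip_norm_ge0.
  rewrite Rminus_0_r, Rabs_pos_eq by apply ip_norm_ge0.
  rewrite hs_norm_minus_sym in hN. rewrite hs_norm_minus_sym.
  eapply Rle_lt_trans; [apply (wick_proj_best _ _ _ _ K Y (wick_proj K (finite_section Y A)));
    apply wick_proj_span|].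
  eapply Rle_lt_trans.
  - replace (minus Y (wick_proj K (finite_section Y A))) with
      (plus (minus Y (finite_section Y A)) (minus (finite_section Y A) (wick_proj K (finite_section Y A)))) by hs_ring.
    apply (ip_norm_triangle _ hs_ip_inner).
  - lra.
Qed.

Lemma wick_total (Y Z : hs) : (forall j k, hs_ip (wick j k) Y = hs_ip (wick j k) Z) -> Y = Z.
Proof.
  intros h.
  assert (hd : hs_ip (minus Y Z) (minus Y Z) = RtoC 0).
  { apply (Clim_unique (fun K => hs_ip (minus Y Z) (wick_proj K (minus Y Z)))).
    - apply hs_lim_ip, wick_proj_cv.
    - apply Clim_ext with (fun _ => RtoC 0); [|apply Clim_const].
      intros K. rewrite (wick_proj_unique _ _ _ _ K (minus Y Z) zero).
      + symmetry. apply (ip_zero_r _ hs_ip_inner).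
      + constructor.
      + intros j k _. rewrite ip_minus_r, h.
        transitivity (RtoC 0); [apply (ip_zero_r _ hs_ip_inner) | ring]. }
  apply (ip_def _ hs_ip_inner) in hd.
  replace Y with (plus (minus Y Z) Z) by hs_ring. rewrite hd. hs_ring.
Qed.

End convergence.

(** * Homogeneous components of the Weyl operators *)

(** [x^j y^k] at [x = z] and [y = - conj z], the coefficients of [a^dagger] and [a] in the exponent
    of [W(z)]. *)
Definition mono (z : C) (j k : nat) : C := Cmult (Cpow z j) (Cpow (Copp (Cconj z)) k).

Lemma mono_S_l z j k : mono z (S j) k = Cmult z (mono z j k).
Proof. unfold mono. rewrite Cpow_S. ring. Qed.

Lemma mono_S_r z j k : mono z j (S k) = Cmult (Copp (Cconj z)) (mono z j k).
Proof. unfold mono. rewrite Cpow_S. ring. Qed.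

Lemma mono_real_scal (r : R) z j k :
  mono (Cmult (RtoC r) z) j k = Cmult (RtoC (r ^ (j + k))) (mono z j k).
Proof.
  unfold mono. rewrite Cmult_conj, Cconj_R.
  replace (Copp (Cmult (RtoC r) (Cconj z))) with (Cmult (RtoC r) (Copp (Cconj z))) by ring.
  rewrite !Cpow_mult_l, pow_add, RtoC_mult, !RtoC_pow. ring.
Qed.

Lemma Cmod_mono z j k : Cmod (mono z j k) = Cmod z ^ (j + k).
Proof.
  unfold mono. rewrite Cmod_mult, !Cmod_pow, Cmod_opp, Cmod_conj, pow_add. reflexivity.
Qed.

Definition diag (A : nat -> nat -> C) (K : nat) : C := csum (fun j => A j (K - j)%nat) K.

Lemma diag_ext A B K : (forall j k, A j k = B j k) -> diag A K = diag B K.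
Proof. intros h. apply csum_ext. intros; apply h. Qed.

Lemma diag_scal c A K : diag (fun j k => Cmult c (A j k)) K = Cmult c (diag A K).
Proof. apply (csum_scal c (fun j => A j (K - j)%nat)). Qed.

Lemma diag_plus A B K : diag (fun j k => Cplus (A j k) (B j k)) K = Cplus (diag A K) (diag B K).
Proof. apply (csum_plus (fun j => A j (K - j)%nat) (fun j => B j (K - j)%nat)). Qed.

(** Euler's identity for homogeneous polynomials, with the factors [x] and [y] absorbed into [A]. *)
Lemma diag_euler A K :
  Cplus (diag (fun j k => Cmult (RtoC (INR (S j))) (A (S j) k)) K)
    (diag (fun j k => Cmult (RtoC (INR (S k))) (A j (S k))) K) =
  Cmult (RtoC (INR (S K))) (diag A (S K)).
Proof.
  unfold diag at 3. rewrite <- csum_scal.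
  rewrite (csum_ext _ (fun j => Cplus (Cmult (RtoC (INR j)) (A j (S K - j)%nat))
    (Cmult (RtoC (INR (S K - j))) (A j (S K - j)%nat)))).
  2: { intros j hj. replace (INR (S K)) with (INR j + INR (S K - j)).
       - rewrite RtoC_plus. ring.
       - rewrite <- plus_INR. f_equal. lia. }
  rewrite csum_plus. f_equal.
  - rewrite csum_first.
    change (diag (fun j k => Cmult (RtoC (INR (S j))) (A (S j) k)) K) with
      (csum (fun j => Cmult (RtoC (INR (S j))) (A (S j) (S K - S j)%nat)) K).
    simpl. ring.
  - cbn [csum]. rewrite Nat.sub_diag.
    rewrite (csum_ext (fun j => Cmult (RtoC (INR (S K - j))) (A j (S K - j)%nat))
      (fun j => Cmult (RtoC (INR (S (K - j)))) (A j (S (K - j))))).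
    + unfold diag. simpl INR at 3. ring.
    + intros j hj. now replace (S K - j)%nat with (S (K - j)) by lia.
Qed.

Lemma diag_prev_l A K : diag (fun j k => prev (fun j => A j k) j) K = prev (diag A) K.
Proof.
  destruct K as [|K]; [reflexivity|]. unfold diag. rewrite csum_first. cbn [prev].
  rewrite Cplus_0_l. reflexivity.
Qed.

Lemma diag_prev_r A K : diag (fun j k => prev (A j) k) K = prev (diag A) K.
Proof.
  destruct K as [|K]; [reflexivity|]. unfold diag. cbn [csum]. rewrite Nat.sub_diag. cbn [prev].
  rewrite Cplus_0_r. apply csum_ext. intros j hj.
  now replace (S K - j)%nat with (S (K - j)) by lia.
Qed.

Lemma creat_csum (g : nat -> nat -> C) N m :
  creat (fun m => csum (fun j => g j m) N) m = csum (fun j => creat (g j) m) N.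
Proof.
  destruct m as [|m]; simpl.
  - symmetry. now apply csum_zero.
  - now rewrite csum_scal.
Qed.

Lemma annih_csum (g : nat -> nat -> C) N m :
  annih (fun m => csum (fun j => g j m) N) m = csum (fun j => annih (g j) m) N.
Proof. unfold annih. now rewrite csum_scal. Qed.

Definition layer (tau : R) (z : C) (K : nat) (x : nat -> C) (m : nat) : C :=
  diag (fun j k => Cmult (mono z j k) (oev tau j k x m)) K.

(** With [E] the generating function, [x = z] and [y = - conj z], the formulas for [a^dagger E] and
    [a E] give the Euler operator applied to [E] plus [(1 - 2 tau) x y E], where [x y = - |z|^2].
    For [tau = 1/2] the correction vanishes, so that the layers are the terms of the exponential
    series of [W(z)]. *)
Lemma weyl_exponent_layer tau z K x m : weyl_exponent z (layer tau z K x) m =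
  Cplus (Cmult (RtoC (INR (S K))) (layer tau z (S K) x m))
    (Cmult (RtoC ((2 * tau - 1) * Cmod z ^ 2)) (prev (fun K => layer tau z K x m) K)).
Proof.
  unfold weyl_exponent, layer at 1 2, diag at 1 2.
  rewrite (creat_csum (fun j m => Cmult (mono z j (K - j)) (oev tau j (K - j) x m))).
  rewrite (annih_csum (fun j m => Cmult (mono z j (K - j)) (oev tau j (K - j) x m))).
  set (A := fun j k => Cmult (mono z j k) (oev tau j k x m)).
  rewrite (csum_ext _ (fun j => (fun j k => Cmult (mono z j k) (creat (oev tau j k x) m)) j (K - j)%nat)).
  2: { intros j _. now rewrite creat_scal. }
  rewrite (csum_ext (fun j => annih _ m)
    (fun j => (fun j k => Cmult (mono z j k) (annih (oev tau j k x) m)) j (K - j)%nat)).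
  2: { intros j _. now rewrite annih_scal. }
  fold (diag (fun j k => Cmult (mono z j k) (creat (oev tau j k x) m)) K).
  fold (diag (fun j k => Cmult (mono z j k) (annih (oev tau j k x) m)) K).
  unfold layer. fold A. rewrite <- diag_euler.
  replace (prev (fun K => diag A K) K) with (prev (diag A) K) by reflexivity.
  transitivity (Cplus
    (diag (fun j k => Cplus (Cmult (RtoC (INR (S j))) (A (S j) k))
       (Cmult (RtoC (tau * Cmod z ^ 2)) (prev (A j) k))) K)
    (diag (fun j k => Cplus (Cmult (RtoC (INR (S k))) (A j (S k)))
       (Cmult (RtoC ((tau - 1) * Cmod z ^ 2)) (prev (fun j => A j k) j))) K)).
  - unfold Cminus.
    transitivity (Cplus (Cmult z (diag (fun j k => Cmult (mono z j k) (creat (oev tau j k x) m)) K))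
     (Cmult (Copp (Cconj z)) (diag (fun j k => Cmult (mono z j k) (annih (oev tau j k x) m)) K)));
     [ring|].
    rewrite <- !diag_scal. f_equal.
    + apply diag_ext. intros j k. rewrite creat_oev. unfold A.
      rewrite RtoC_mult, Cmod2_conj, mono_S_l.
      destruct k; cbn [prev]; [|rewrite mono_S_r]; ring.
    + apply diag_ext. intros j k. rewrite annih_oev. unfold A.
      rewrite RtoC_mult, Cmod2_conj, mono_S_r, !RtoC_minus.
      destruct j; cbn [prev]; [|rewrite mono_S_l]; ring.
  - rewrite !diag_plus, !diag_scal, (diag_prev_l A), (diag_prev_r A).
    replace ((2 * tau - 1) * Cmod z ^ 2) with (tau * Cmod z ^ 2 + (tau - 1) * Cmod z ^ 2) by ring.
    rewrite (RtoC_plus (tau * Cmod z ^ 2)). ring.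
Qed.

Lemma layer_0 tau z x m : layer tau z 0 x m = x m.
Proof. unfold layer, diag, mono; simpl. rewrite oev_00. ring. Qed.

Lemma layer_real_scal tau (r : R) z K x m :
  layer tau (Cmult (RtoC r) z) K x m = Cmult (RtoC (r ^ K)) (layer tau z K x m).
Proof.
  unfold layer, diag. rewrite <- csum_scal. apply csum_ext. intros j hj.
  rewrite mono_real_scal. replace (j + (K - j))%nat with K by lia. ring.
Qed.

Lemma weyl_exponent_iter z n K m : Nat.iter K (weyl_exponent z) (basis n) m =
  Cmult (RtoC (INR (fact K))) (layer (/ 2) z K (basis n) m).
Proof.
  revert m. induction K as [|K IH]; intros m.
  - rewrite layer_0. simpl. ring.
  - cbn [Nat.iter nat_rect].
    change (weyl_exponent z (Nat.iter K (weyl_exponent z) (basis n)) m =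
      Cmult (RtoC (INR (fact (S K)))) (layer (/ 2) z (S K) (basis n) m)).
    replace (Nat.iter K (weyl_exponent z) (basis n)) with
      (fun m => Cmult (RtoC (INR (fact K))) (layer (/ 2) z K (basis n) m))
      by (apply functional_extensionality; intros; now rewrite IH).
    unfold weyl_exponent. rewrite creat_scal, annih_scal.
    assert (h := weyl_exponent_layer (/ 2) z K (basis n) m). unfold weyl_exponent in h.
    transitivity (Cmult (RtoC (INR (fact K))) (Cminus (Cmult z (creat (layer (/ 2) z K (basis n)) m))
      (Cmult (Cconj z) (annih (layer (/ 2) z K (basis n)) m)))); [ring|].
    rewrite h. replace ((2 * / 2 - 1) * Cmod z ^ 2) with 0 by field.
    rewrite fact_simpl, mult_INR, RtoC_mult. ring.
Qed.

(* The power series coefficients of exp (c r^2) in r *)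
Fixpoint exp2_coef (c : R) (i : nat) {struct i} : R :=
  match i with
  | O => 1
  | S O => 0
  | S (S i') => 2 * c / INR i * exp2_coef c i'
  end.

Lemma exp2_coef_SS c i : INR (S (S i)) * exp2_coef c (S (S i)) = 2 * c * exp2_coef c i.
Proof. cbn [exp2_coef]. field. apply not_0_INR. lia. Qed.

Lemma exp2_coef_ge0 c i : 0 <= c -> 0 <= exp2_coef c i.
Proof.
  intros hc. assert (h : 0 <= exp2_coef c i /\ 0 <= exp2_coef c (S i)); [|tauto].
  induction i as [|i [h1 h2]]; [simpl; lra|]. split; trivial.
  cbn [exp2_coef]. apply Rmult_le_pos; trivial. apply Rmult_le_pos; [lra|].
  apply Rlt_le, Rinv_0_lt_compat, lt_0_INR. lia.
Qed.

Lemma exp2_coef_series c : is_series (exp2_coef c) (exp c).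
Proof.
  apply is_series_even.
  - apply is_series_ext with (fun n => / INR (fact n) * c ^ n).
    + induction n as [|n IH]; [simpl; field|].
      replace (2 * S n)%nat with (S (S (2 * n))) by lia.
      apply (Rmult_eq_reg_l (INR (S (S (2 * n))))); [|apply not_0_INR; lia].
      rewrite exp2_coef_SS, <- IH, fact_simpl, mult_INR.
      replace (INR (S (S (2 * n)))) with (2 * INR (S n)).
      * simpl pow. field. split; [apply INR_fact_neq_0 | apply not_0_INR; lia].
      * rewrite !S_INR, mult_INR. simpl INR. ring.
    + exact (proj1 (is_pseries_R _ _ _) (is_exp_Reals c)).
  - induction n as [|n IH]; [reflexivity|].
    replace (2 * S n + 1)%nat with (S (S (2 * n + 1))) by lia.
    cbn [exp2_coef]. rewrite IH. ring.
Qed.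

(** Passing from order [1/2] to order [tau] multiplies the generating function by [exp ((tau - 1/2)
    x y) = exp ((1/2 - tau) |z|^2)], and a factor of even degree in [z] convolves the layers with
    [exp2_coef]. Both sides satisfy the recursion of [weyl_exponent_layer], which determines degree
    [K + 1] from degrees [K] and [K - 1]. *)
Lemma layer_reorder tau z x K : forall m, layer tau z K x m =
  csum (fun i => Cmult (RtoC (exp2_coef ((/ 2 - tau) * Cmod z ^ 2) i))
    (layer (/ 2) z (K - i) x m)) K.
Proof.
  revert K. set (c := (/ 2 - tau) * Cmod z ^ 2).
  set (F := fun K m => csum (fun i => Cmult (RtoC (exp2_coef c i)) (layer (/ 2) z (K - i) x m)) K).
  assert (hF : forall K m, weyl_exponent z (F K) m =
    Cminus (Cmult (RtoC (INR (S K))) (F (S K) m))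
      (Cmult (RtoC (2 * c)) (prev (fun K => F K m) K))).
  { intros K m. unfold weyl_exponent, F at 1 2.
    rewrite (creat_csum (fun i m => Cmult (RtoC (exp2_coef c i)) (layer (/ 2) z (K - i) x m))).
    rewrite (annih_csum (fun i m => Cmult (RtoC (exp2_coef c i)) (layer (/ 2) z (K - i) x m))).
    transitivity (csum (fun i => Cmult (RtoC (exp2_coef c i))
      (weyl_exponent z (layer (/ 2) z (K - i) x) m)) K).
    { unfold weyl_exponent, Cminus.
      replace (Copp (Cmult (Cconj z) (csum (fun j => annih (fun m => Cmult (RtoC (exp2_coef c j))
          (layer (/ 2) z (K - j) x m)) m) K))) with
        (Cmult (Copp (Cconj z)) (csum (fun j => annih (fun m => Cmult (RtoC (exp2_coef c j))
          (layer (/ 2) z (K - j) x m)) m) K)) by ring.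
      rewrite <- !csum_scal, <- csum_plus. apply csum_ext. intros i _.
      rewrite creat_scal, annih_scal. ring. }
    rewrite (csum_ext _ (fun i => Cmult (RtoC (INR (S K - i)))
      (Cmult (RtoC (exp2_coef c i)) (layer (/ 2) z (S K - i) x m)))).
    2: { intros i hi. rewrite weyl_exponent_layer.
         replace ((2 * / 2 - 1) * Cmod z ^ 2) with 0 by field.
         replace (S K - i)%nat with (S (K - i)) by lia. ring. }
    unfold F at 1. rewrite <- csum_scal.
    rewrite (csum_ext (fun n => Cmult (RtoC (INR (S K))) _) (fun i =>
      Cplus (Cmult (RtoC (INR (S K - i)))
        (Cmult (RtoC (exp2_coef c i)) (layer (/ 2) z (S K - i) x m)))
      (Cmult (RtoC (INR i * exp2_coef c i)) (layer (/ 2) z (S K - i) x m)))).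
    2: { intros i hi. replace (INR (S K)) with (INR (S K - i) + INR i).
         - rewrite RtoC_plus, RtoC_mult. ring.
         - rewrite <- plus_INR. f_equal. lia. }
    rewrite csum_plus.
    set (G := fun i => Cmult (RtoC (INR i * exp2_coef c i)) (layer (/ 2) z (S K - i) x m)).
    assert (hG : csum G (S K) = Cmult (RtoC (2 * c)) (prev (fun K => F K m) K)).
    { assert (hG0 : G 0%nat = RtoC 0) by (unfold G; simpl INR; rewrite Rmult_0_l; ring).
      assert (hG1 : G 1%nat = RtoC 0) by (unfold G; simpl exp2_coef; rewrite Rmult_0_r; ring).
      destruct K as [|K]; cbn [prev].
      - cbn [csum]. rewrite hG0, hG1. ring.
      - rewrite !csum_first, hG0, hG1. unfold F. rewrite <- csum_scal, !Cplus_0_l.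
        apply csum_ext. intros i hi. unfold G. rewrite exp2_coef_SS, RtoC_mult.
        replace (S (S K) - S (S i))%nat with (K - i)%nat by lia. ring. }
    rewrite hG. cbn [csum]. rewrite Nat.sub_diag. simpl (INR 0). ring. }
  assert (h : forall K, (forall m, layer tau z K x m = F K m) /\
                        (forall m, layer tau z (S K) x m = F (S K) m)).
  { induction K as [|k [h1 h2]].
    - assert (h0 : forall m, layer tau z 0 x m = F 0%nat m).
      { intros m. unfold F. simpl. rewrite !layer_0. ring. }
      split; trivial. intros m. apply (Cmult_reg_INR 0).
      assert (h1 := hF 0%nat m). assert (h2 := weyl_exponent_layer tau z 0 x m).
      replace (layer tau z 0 x) with (F 0%nat) in h2
        by (apply functional_extensionality; intros; now rewrite h0).
      rewrite h1 in h2. cbn [prev] in h2.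
      transitivity (Cplus (Cmult (RtoC (INR 1)) (layer tau z 1 x m))
        (Cmult (RtoC ((2 * tau - 1) * Cmod z ^ 2)) (RtoC 0))); [ring|].
      rewrite <- h2. ring.
    - split; trivial. intros m. apply (Cmult_reg_INR (S k)).
      assert (h3 := hF (S k) m). assert (h4 := weyl_exponent_layer tau z (S k) x m).
      replace (layer tau z (S k) x) with (F (S k)) in h4
        by (apply functional_extensionality; intros; now rewrite h2).
      rewrite h3 in h4. cbn [prev] in h4. rewrite h1 in h4.
      replace ((2 * tau - 1) * Cmod z ^ 2) with (- (2 * c)) in h4 by (unfold c; field).
      rewrite RtoC_opp in h4.
      transitivity (Cplus (Cplus (Cmult (RtoC (INR (S (S k)))) (layer tau z (S (S k)) x m))
        (Cmult (Copp (RtoC (2 * c))) (F k m))) (Cmult (RtoC (2 * c)) (F k m))); [ring|].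
      rewrite <- h4. ring. }
  intros K m. apply h.
Qed.

Lemma Clim_csum (a : nat -> C) (l : C) : Clim (csum a) l <->
  is_series (fun n => Re (a n)) (Re l) /\ is_series (fun n => Im (a n)) (Im l).
Proof.
  split; intros [h1 h2]; split.
  - apply is_lim_seq_ext with (2 := h1). intros K. now rewrite re_csum, sum_n_Reals.
  - apply is_lim_seq_ext with (2 := h2). intros K. now rewrite im_csum, sum_n_Reals.
  - apply is_lim_seq_ext with (2 := h1 : is_lim_seq (sum_n (fun n => Re (a n))) (Re l)).
    intros K. now rewrite re_csum, sum_n_Reals.
  - apply is_lim_seq_ext with (2 := h2 : is_lim_seq (sum_n (fun n => Im (a n))) (Im l)).
    intros K. now rewrite im_csum, sum_n_Reals.
Qed.

Lemma Clim_csum_ext a b l : (forall n, a n = b n) -> Clim (csum a) l -> Clim (csum b) l.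
Proof. intros h. apply Clim_ext. intros K. now apply csum_ext. Qed.

Lemma coef_le_norm (x : fock) m : Cmod (x m) <= norm x.
Proof.
  apply Rsqr_incr_0_var; [|apply norm_ge_0]. rewrite !Rsqr_pow2, fock_norm2.
  eapply Rle_trans; [|apply (partial_sum_le_Series _ m); [intros; apply pow2_ge_0 | apply coef_sq]].
  apply (term_le_sum_f_R0 (fun n => Cmod (x n) ^ 2)); [lia|]. intros; apply pow2_ge_0.
Qed.

Lemma coef_sum_n (u : nat -> fock) K m : sum_n u K m = csum (fun k => u k m) K.
Proof.
  induction K as [|K IH]; [now rewrite sum_O|]. rewrite sum_Sn. simpl. now rewrite <- IH.
Qed.

Lemma weyl_layer_series z W n m : is_weyl z W ->
  Clim (csum (fun K => layer (/ 2) z K (basis n) m)) (W (basis n) m).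
Proof.
  intros hW. destruct (hW n) as [u [hu hs]].
  apply Clim_csum_ext with (fun K => u K m).
  { intros K. rewrite hu, weyl_exponent_iter, Cmult_assoc, <- RtoC_mult, Rinv_l; [ring|].
    apply INR_fact_neq_0. }
  apply Clim_of_Cmod. apply is_lim_seq_spec. intros eps.
  destruct (hs _ (locally_ball (W (basis n)) eps)) as [N hN]. exists N. intros K hK.
  specialize (hN K hK). change (norm (minus (sum_n u K) (W (basis n))) < eps) in hN.
  rewrite Rminus_0_r, Rabs_pos_eq by apply Cmod_ge_0.
  eapply Rle_lt_trans; [|exact hN]. rewrite <- coef_sum_n.
  exact (coef_le_norm (minus (sum_n u K) (W (basis n))) m).
Qed.

Lemma im_scal (r : R) (z : C) : Im (Cmult (RtoC r) z) = r * Im z.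
Proof. unfold Im, Cmult, RtoC; simpl. ring. Qed.

Lemma CV_radius_ge (a : nat -> R) (r : R) : ex_series (fun n => a n * r ^ n) ->
  Rbar_le (Rabs r) (CV_radius a).
Proof.
  intros h. apply Rbar_not_lt_le. intros h1.
  apply (CV_disk_outside a r h1). now apply ex_series_lim_0.
Qed.

Lemma abs_series_of_radius (a : nat -> R) : ex_series (fun n => a n * 2 ^ n) ->
  ex_series (fun n => Rabs (a n)).
Proof.
  intros h. apply CV_radius_ge in h.
  assert (h1 : Rbar_lt (Rabs 1) (CV_radius a)).
  { eapply Rbar_lt_le_trans; [|exact h]. simpl. rewrite !Rabs_pos_eq; lra. }
  generalize (CV_disk_inside a 1 h1). apply ex_series_ext. intros n. now rewrite pow1, Rmult_1_r.
Qed.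

(** By [layer_reorder] this is the Cauchy product of the series of [exp c] with the Weyl layers. *)
Lemma ordered_layer_series tau z (W : C -> bounded_op) n m : tau <= / 2 ->
  (forall z, is_weyl z (W z)) ->
  Clim (csum (fun K => layer tau z K (basis n) m))
    (Cmult (RtoC (exp ((/ 2 - tau) * Cmod z ^ 2))) (W z (basis n) m)).
Proof.
  intros ht hW. set (c := (/ 2 - tau) * Cmod z ^ 2).
  assert (hc : 0 <= c) by (apply Rmult_le_pos; [lra | apply pow2_ge_0]).
  assert (he := exp2_coef_series c).
  assert (hea : ex_series (fun n => Rabs (exp2_coef c n))).
  { apply ex_series_ext with (exp2_coef c); [|now exists (exp c)].
    intros i. symmetry. now apply Rabs_pos_eq, exp2_coef_ge0. }
  assert (h1 := weyl_layer_series z (W z) n m (hW z)).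
  (* Layers scale like [r^K], so convergence at [2 z] puts [z] inside the disk of convergence and
     gives the absolute convergence that the Cauchy product needs. *)
  assert (h2 := weyl_layer_series (Cmult (RtoC 2) z) (W (Cmult (RtoC 2) z)) n m (hW _)).
  rewrite Clim_csum in h1, h2 |- *. destruct h1 as [h1 h1'], h2 as [h2 h2'].
  assert (h3 : ex_series (fun K => Rabs (Re (layer (/ 2) z K (basis n) m)))).
  { apply abs_series_of_radius. eexists. apply is_series_ext with (2 := h2). intros K.
    rewrite layer_real_scal, re_scal. apply Rmult_comm. }
  assert (h3' : ex_series (fun K => Rabs (Im (layer (/ 2) z K (basis n) m)))).
  { apply abs_series_of_radius. eexists. apply is_series_ext with (2 := h2'). intros K.
    rewrite layer_real_scal, im_scal. apply Rmult_comm. }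
  rewrite re_scal, im_scal. split.
  - apply is_series_ext with (2 := is_series_mult _ _ _ _ he h1 hea h3). intros K.
    rewrite layer_reorder, re_csum. apply sum_eq. intros i _. now rewrite re_scal.
  - apply is_series_ext with (2 := is_series_mult _ _ _ _ he h1' hea h3'). intros K.
    rewrite layer_reorder, im_csum. apply sum_eq. intros i _. now rewrite im_scal.
Qed.

Lemma pow_fact_le (x : R) (n : nat) : 0 <= x -> x ^ n / INR (fact n) <= exp x.
Proof.
  intros hx. eapply Rle_trans; [|apply (exp_ge_taylor x n hx)].
  apply (term_le_sum_f_R0 (fun k => x ^ k / INR (fact k))); [lia|].
  intros k. apply Rmult_le_pos; [now apply pow_le|].
  apply Rlt_le, Rinv_0_lt_compat, INR_fact_lt_0.
Qed.

Lemma INR_S_le_pow2 n : INR (S n) <= 2 ^ n.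
Proof.
  induction n as [|n IH]; [simpl; lra|]. rewrite S_INR. simpl pow.
  assert (1 <= 2 ^ n) by (apply pow_R1_Rle; lra). lra.
Qed.

(** * Expansion of the embedded Weyl operators in Wick monomials *)

Section expansion.

Context (beta s : R) (hb : 0 < beta) (hs01 : 0 <= s <= 1).

Local Notation wick := (wick beta s hb hs01).
Local Notation wick_norm2 := (wick_norm2 beta s).
Local Notation nu := (nu beta).
Local Notation weight := (weight beta s).

Definition wick_layer (z : C) (K : nat) : hs :=
  hsum (fun j => scal (mono z j (K - j)) (wick j (K - j))) K.

Lemma ent_wick_layer z K n m :
  ent (wick_layer z K) n m = Cmult (RtoC (weight n m)) (layer (- nu) z K (basis n) m).
Proof.
  unfold wick_layer, layer, diag. rewrite ent_hsum, <- csum_scal. apply csum_ext. intros j _.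
  rewrite ent_scal. unfold wick. rewrite ent_emb. unfold oev. ring.
Qed.

Lemma norm_wick j k : hs_norm (wick j k) ^ 2 = wick_norm2 j k.
Proof. rewrite (ip_norm_sq _ hs_ip_inner), wick_ip_diag. reflexivity. Qed.

(** The left side is one term of the binomial expansion of the right side. *)
Lemma wick_norm2_le j k : wick_norm2 j k <=
  (mode1 beta s + mode2 beta s) ^ (j + k) / INR (fact (j + k)).
Proof.
  assert (h1 := mode1_pos beta s hb). assert (h2 := mode2_pos beta s hb).
  assert (hf := INR_fact_lt_0 (j + k)).
  rewrite binomial. apply (Rmult_le_reg_r (INR (fact (j + k)))); trivial.
  unfold Rdiv at 1. rewrite Rmult_assoc, Rinv_l, Rmult_1_r by lra.
  eapply Rle_trans; [|apply (term_le_sum_f_R0 (fun i => Binomial.C (j + k) i * mode1 beta s ^ i *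
    mode2 beta s ^ (j + k - i)) j); [lia|]].
  - unfold wick_norm2, Binomial.C. replace (j + k - j)%nat with k by lia.
    right. field. split; apply INR_fact_neq_0.
  - intros i. repeat apply Rmult_le_pos; try (apply pow_le; lra).
    + apply pos_INR.
    + apply Rlt_le, Rinv_0_lt_compat, Rmult_lt_0_compat; apply INR_fact_lt_0.
Qed.

Lemma norm_wick_layer z : exists c, forall K, hs_norm (wick_layer z K) <= c * (/ 2) ^ K.
Proof.
  set (X := Cmod z ^ 2 * (mode1 beta s + mode2 beta s)).
  assert (h1 := mode1_pos beta s hb). assert (h2 := mode2_pos beta s hb).
  assert (hz := Cmod_ge_0 z).
  assert (hX : 0 <= X) by (apply Rmult_le_pos; [apply pow2_ge_0 | lra]).
  exists (exp (8 * X)). intros K.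
  (* The squared norm of a summand is at most [X^K / K! = (1/16)^K (16 X)^K / K!], hence at most
     [(1/16)^K exp (16 X)]; its square root gives the constants 8 and 1/4. The [K + 1] summands cost
     a factor [2^K]. *)
  apply Rle_trans with (INR (S K) * (exp (8 * X) * (/ 4) ^ K)).
  - unfold wick_layer. eapply Rle_trans; [apply norm_hsum_le|].
    rewrite (Rmult_comm (INR (S K))), <- (sum_cte _ K). apply sum_Rle. intros j hj.
    eapply Rle_trans; [apply (ip_norm_scal _ hs_ip_inner)|].
    change (abs (mono z j (K - j))) with (Cmod (mono z j (K - j))). rewrite Cmod_mono.
    apply Rsqr_incr_0_var.
    + rewrite !Rsqr_pow2, !Rpow_mult_distr, norm_wick.
      eapply Rle_trans; [apply Rmult_le_compat_l; [apply pow2_ge_0 | apply wick_norm2_le]|].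
      replace (j + (K - j))%nat with K by lia.
      replace ((Cmod z ^ K) ^ 2 * ((mode1 beta s + mode2 beta s) ^ K / INR (fact K))) with
        (((/ 4) ^ K) ^ 2 * ((16 * X) ^ K / INR (fact K))).
      * rewrite (Rmult_comm (exp (8 * X) ^ 2)). apply Rmult_le_compat_l; [apply pow2_ge_0|].
        eapply Rle_trans; [apply pow_fact_le; lra|]. right. simpl.
        rewrite Rmult_1_r, <- exp_plus. f_equal. ring.
      * unfold X. rewrite !Rpow_mult_distr, <- !pow_mult, !(Nat.mul_comm K), !pow_mult.
        unfold Rdiv. rewrite <- !Rmult_assoc, <- !Rpow_mult_distr.
        replace ((/ 4) ^ 2 * 16) with 1 by field. rewrite Rmult_1_l. reflexivity.
    + apply Rmult_le_pos; [apply Rlt_le, exp_pos | apply pow_le; lra].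
  - replace ((/ 2) ^ K) with (2 ^ K * (/ 4) ^ K).
    + assert (h := INR_S_le_pow2 K). assert (he := exp_pos (8 * X)).
      assert (hp : 0 <= (/ 4) ^ K) by (apply pow_le; lra).
      replace (exp (8 * X) * (2 ^ K * (/ 4) ^ K)) with (2 ^ K * (exp (8 * X) * (/ 4) ^ K)) by ring.
      apply Rmult_le_compat_r; trivial. apply Rmult_le_pos; lra.
    + rewrite <- Rpow_mult_distr. f_equal. field.
Qed.

(** The thermal state has [Tr (rho W(z)) = exp (- covariance |z|^2 / 2)]; moreover
    [covariance / 2 = 1/2 - tau] at the Wick order [tau = - nu]. *)
Definition covariance : R := 1 + 2 * nu.

(* The vectors [exp (covariance |z|^2 / 2) rho^{s/2} W(z) rho^{(1-s)/2}] are the exponential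
   vectors of the Fock space spanned by the [wick j k]. *)
Lemma weyl_expansion (W : C -> bounded_op) (z : C) : (forall z, is_weyl z (W z)) ->
  exists Z : hs, is_embedding beta s
    (fun n => scal (RtoC (exp (covariance / 2 * Cmod z ^ 2))) (W z) (basis n)) Z /\
    hs_lim (hsum (wick_layer z)) Z.
Proof.
  intros hW. destruct (norm_wick_layer z) as [c hc].
  set (x := weighted beta s
    (fun n => scal (RtoC (exp (covariance / 2 * Cmod z ^ 2))) (W z) (basis n))).
  destruct (hs_series (wick_layer z) (fun K => c * (/ 2) ^ K) x) as [Z [h1 h2]]; trivial.
  - apply ex_series_scal_R, ex_series_geom. rewrite Rabs_pos_eq; lra.
  - intros n m.
    assert (h := ordered_layer_series (- nu) z W n m
      ltac:(generalize (nu_pos beta hb); lra) hW).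
    apply Clim_csum_ext with (fun K => Cmult (RtoC (weight n m)) (layer (- nu) z K (basis n) m)).
    { intros; symmetry; apply ent_wick_layer. }
    apply Clim_ext with (fun K => Cmult (RtoC (weight n m))
      (csum (fun K => layer (- nu) z K (basis n) m) K)).
    { intros; symmetry; apply csum_scal. }
    unfold x, weighted. replace (covariance / 2) with (/ 2 - - nu) by (unfold covariance; field).
    destruct h as [h h']. split.
    + rewrite re_scal. apply is_lim_seq_ext with (2 := is_lim_seq_scal_l _ (weight n m) _ h).
      intros; symmetry; apply re_scal.
    + rewrite im_scal. apply is_lim_seq_ext with (2 := is_lim_seq_scal_l _ (weight n m) _ h').
      intros; symmetry; apply im_scal.
  - exists Z. split; trivial. now apply is_embedding_ent.
Qed.

End expansion.

(** * The drift flow *)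

Lemma re_drift g z : Re (drift g z) = drift_matrix g 0 0 * Re z + drift_matrix g 0 1 * Im z.
Proof.
  destruct z as [x y]. unfold drift, drift_matrix. destruct (kappa g) as [k1 k2].
  unfold Re, Im, Ci, RtoC, Cmult, Cplus, Cminus, Copp, Cconj; simpl. ring.
Qed.

Lemma im_drift g z : Im (drift g z) = drift_matrix g 1 0 * Re z + drift_matrix g 1 1 * Im z.
Proof.
  destruct z as [x y]. unfold drift, drift_matrix. destruct (kappa g) as [k1 k2].
  unfold Re, Im, Ci, RtoC, Cmult, Cplus, Cminus, Copp, Cconj; simpl. ring.
Qed.

Lemma drift_bounded g : exists M, 0 <= M /\ forall z, Cmod (drift g z) <= M * Cmod z.
Proof.
  exists (Cmod (Cminus (Cmult Ci (RtoC (Omega g))) (RtoC (gamma g))) + Cmod (Cmult Ci (kappa g))).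
  split; [apply Rplus_le_le_0_compat; apply Cmod_ge_0|]. intros z. unfold drift.
  eapply Rle_trans; [apply Cmod_triangle|].
  rewrite (Cmod_mult _ z), (Cmod_mult _ (Cconj z)), Cmod_conj. right. ring.
Qed.

Lemma drift_iter_bound g M z : 0 <= M -> (forall z, Cmod (drift g z) <= M * Cmod z) ->
  forall k, Cmod (Nat.iter k (drift g) z) <= M ^ k * Cmod z.
Proof.
  intros h0 hM k. induction k as [|k IH]; simpl; [lra|].
  eapply Rle_trans; [apply hM|]. rewrite Rmult_assoc. now apply Rmult_le_compat_l.
Qed.

Lemma CV_radius_exp_type (a : nat -> R) (M c : R) : 0 <= M ->
  (forall k, Rabs (a k) <= c * (M ^ k / INR (fact k))) -> CV_radius a = p_infty.
Proof.
  intros hM ha.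
  assert (h : forall r, 0 <= r -> Rbar_le r (CV_radius a)).
  { intros r hr. rewrite <- (Rabs_pos_eq r hr) at 1. apply CV_radius_ge.
    apply (ex_series_le (K := R_AbsRing) (V := R_CompleteNormedModule)) with
      (fun k => c * (/ INR (fact k) * (M * r) ^ k)).
    - intros k. change (Rabs (a k * r ^ k) <= c * (/ INR (fact k) * (M * r) ^ k)).
      rewrite Rabs_mult, Rpow_mult_distr, (Rabs_pos_eq (r ^ k)) by now apply pow_le.
      replace (c * (/ INR (fact k) * (M ^ k * r ^ k))) with (c * (M ^ k / INR (fact k)) * r ^ k)
        by (unfold Rdiv; ring).
      apply Rmult_le_compat_r; [now apply pow_le | apply ha].
    - apply ex_series_scal_R. eexists.
      exact (proj1 (is_pseries_R _ _ _) (is_exp_Reals (M * r))). }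
  assert (h0 := h 0 (Rle_refl 0)).
  destruct (CV_radius a) as [r| |]; trivial; simpl in *.
  - specialize (h (r + 1) ltac:(lra)). simpl in h. lra.
  - contradiction.
Qed.

Definition re_coef (g : gaussian_data) (z : C) (k : nat) : R :=
  Re (Nat.iter k (drift g) z) / INR (fact k).
Definition im_coef (g : gaussian_data) (z : C) (k : nat) : R :=
  Im (Nat.iter k (drift g) z) / INR (fact k).

Lemma coef_radius g z : CV_radius (re_coef g z) = p_infty /\ CV_radius (im_coef g z) = p_infty.
Proof.
  destruct (drift_bounded g) as [M [h0 hM]].
  assert (h := drift_iter_bound g M z h0 hM).
  split; apply (CV_radius_exp_type _ M (Cmod z)); trivial; intros k;
    unfold re_coef, im_coef, Rdiv; rewrite Rabs_mult;
    rewrite (Rabs_pos_eq (/ INR (fact k))) by apply Rlt_le, Rinv_0_lt_compat, INR_fact_lt_0;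
    rewrite <- Rmult_assoc; apply Rmult_le_compat_r;
    try (apply Rlt_le, Rinv_0_lt_compat, INR_fact_lt_0);
    rewrite (Rmult_comm (Cmod z)); (eapply Rle_trans; [|apply h]).
  - apply re_le_Cmod.
  - eapply Rle_trans; [|apply Rmax_Cmod]. apply Rmax_r.
Qed.

Lemma re_drift_flow g r z : Re (drift_flow g r z) = PSeries (re_coef g z) r.
Proof.
  apply Series_ext. intros k. rewrite re_scal. unfold re_coef, Rdiv. ring.
Qed.

Lemma im_drift_flow g r z : Im (drift_flow g r z) = PSeries (im_coef g z) r.
Proof.
  apply Series_ext. intros k. rewrite im_scal. unfold im_coef, Rdiv. ring.
Qed.

Lemma PSeries_derive_coef (a b c : nat -> R) (p q r : R) :
  CV_radius a = p_infty -> CV_radius b = p_infty -> CV_radius c = p_infty ->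
  (forall k, PS_derive a k = p * b k + q * c k) ->
  is_derive (PSeries a) r (p * PSeries b r + q * PSeries c r).
Proof.
  intros ha hb hc h.
  assert (hex : forall u, CV_radius u = p_infty -> ex_pseries u r).
  { intros u hu. apply CV_radius_inside. now rewrite hu. }
  replace (p * PSeries b r + q * PSeries c r) with (PSeries (PS_derive a) r).
  - apply is_derive_PSeries. now rewrite ha.
  - rewrite <- !PSeries_scal, <- PSeries_plus.
    + apply PSeries_ext. intros k. rewrite h. reflexivity.
    + apply ex_pseries_scal; [apply Rmult_comm | now apply hex].
    + apply ex_pseries_scal; [apply Rmult_comm | now apply hex].
Qed.

Lemma re_drift_flow_derive g r z :
  is_derive (fun r => Re (drift_flow g r z)) r (Re (drift g (drift_flow g r z))).
Proof.
  destruct (coef_radius g z) as [h1 h2].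
  apply is_derive_ext with (PSeries (re_coef g z)); [intros; symmetry; apply re_drift_flow|].
  rewrite re_drift, re_drift_flow, im_drift_flow.
  apply PSeries_derive_coef; trivial. intros k. unfold PS_derive, re_coef, im_coef.
  simpl Nat.iter. rewrite re_drift, fact_simpl, mult_INR. field. split.
  - apply INR_fact_neq_0.
  - apply not_0_INR. lia.
Qed.

Lemma im_drift_flow_derive g r z :
  is_derive (fun r => Im (drift_flow g r z)) r (Im (drift g (drift_flow g r z))).
Proof.
  destruct (coef_radius g z) as [h1 h2].
  apply is_derive_ext with (PSeries (im_coef g z)); [intros; symmetry; apply im_drift_flow|].
  rewrite im_drift, re_drift_flow, im_drift_flow.
  apply PSeries_derive_coef; trivial. intros k. unfold PS_derive, re_coef, im_coef.
  simpl Nat.iter. rewrite im_drift, fact_simpl, mult_INR. field. split.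
  - apply INR_fact_neq_0.
  - apply not_0_INR. lia.
Qed.

Lemma drift_flow_0 g z : drift_flow g 0 z = z.
Proof.
  apply Ceq; [rewrite re_drift_flow | rewrite im_drift_flow]; rewrite PSeries_0;
    unfold re_coef, im_coef; simpl; field.
Qed.

Lemma drift_real_scal g (c : R) z : drift g (Cmult (RtoC c) z) = Cmult (RtoC c) (drift g z).
Proof. unfold drift. rewrite Cmult_conj, Cconj_R. ring. Qed.

Lemma drift_flow_real_scal g r (c : R) z :
  drift_flow g r (Cmult (RtoC c) z) = Cmult (RtoC c) (drift_flow g r z).
Proof.
  unfold drift_flow. rewrite <- CSeries_scal_R. apply CSeries_ext. intros k.
  replace (Nat.iter k (drift g) (Cmult (RtoC c) z)) with
    (Cmult (RtoC c) (Nat.iter k (drift g) z)); [ring|].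
  induction k as [|k IH]; simpl; trivial. rewrite <- IH. symmetry. apply drift_real_scal.
Qed.

(** * The Lyapunov equation and the Weyl factor *)

Lemma standardized_ratio g beta : standardized g beta ->
  0 < v_sq g /\ exp (- beta) * v_sq g = u_sq g.
Proof.
  intros [_ hb hpos _].
  (* [ln] takes the value 0 outside the positive reals, which [0 < beta] rules out; division by zero
     is excluded in the same way below. *)
  assert (hr : 0 < u_sq g / v_sq g).
  { apply Rnot_le_lt. intros h. unfold ln in hb.
    destruct (Rlt_dec 0 (u_sq g / v_sq g)); lra. }
  assert (hv : v_sq g <> 0).
  { intros h. unfold Rdiv in hr. rewrite h, Rinv_0 in hr. lra. }
  assert (hv0 : 0 <= v_sq g) by (unfold v_sq; apply Rplus_le_le_0_compat; apply pow2_ge_0).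
  split; [lra|]. rewrite hb, Ropp_involutive, exp_ln by trivial. field. trivial.
Qed.

Lemma tanh_half beta : tanh (beta / 2) = (1 - exp (- beta)) / (1 + exp (- beta)).
Proof.
  unfold tanh, sinh, cosh.
  replace (exp (- beta)) with (exp (- (beta / 2)) * exp (- (beta / 2)))
    by (rewrite <- exp_plus; f_equal; field).
  rewrite (exp_Ropp (beta / 2)).
  assert (h := exp_pos (beta / 2)). set (e := exp (beta / 2)) in *.
  field. repeat split; nra.
Qed.

(* Invariance of the covariance form under the drift and the diffusion *)
Lemma lyapunov_equation g beta z : standardized g beta ->
  Re (Cmult (Cconj z) (diffusion g z)) =
  - (covariance beta) * (2 * (Re z * Re (drift g z) + Im z * Im (drift g z))).
Proof.
  intros hstd. destruct (standardized_ratio g beta hstd) as [hv hu].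
  assert (hq := exp_neg_lt1 beta (std_pos _ _ hstd)).
  assert (hk := std_kappa _ _ hstd). rewrite tanh_half in hk.
  rewrite re_drift, im_drift. unfold drift_matrix.
  assert (hg : gamma g = / 2 * (v_sq g - u_sq g)) by (unfold gamma, v_sq, u_sq; ring).
  rewrite hg, <- hu. clear hg.
  set (q := exp (- beta)) in *.
  (* The covariance is the reciprocal of [tanh (beta / 2)]. Hence the standardized [kappa] matches
     the part of the diffusion in [conj z], while [2 gamma = (1 - q) v_sq] matches the part in
     [z]. *)
  assert (hc : covariance beta = (1 + q) / (1 - q)) by (unfold covariance, nu; fold q; field; lra).
  rewrite hc. clear hc.
  replace (Cmult (Cconj z) (diffusion g z)) with
    (Cplus (Cmult (RtoC ((1 + q) * v_sq g)) (Cmult (Cconj z) z))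
      (Cmult (RtoC 2) (Cmult (Cplus (Cmult (u1 g) (v1 g)) (Cmult (u2 g) (v2 g)))
        (Cmult (Cconj z) (Cconj z))))).
  2: { unfold diffusion. replace ((1 + q) * v_sq g) with (u_sq g + v_sq g) by (rewrite <- hu; ring).
       unfold u_sq, v_sq. rewrite !RtoC_plus. ring. }
  assert (hk1 := f_equal Re hk). assert (hk2 := f_equal Im hk). clear hk.
  set (uv := Cplus (Cmult (u1 g) (v1 g)) (Cmult (u2 g) (v2 g))) in *.
  destruct z as [x y]. destruct uv as [p r].
  unfold Re, Im, Ci, RtoC, Cmult, Cplus, Cconj in *; simpl in *.
  rewrite hk1, hk2. field. lra.
Qed.

Lemma ex_derive_drift_flow g r z :
  ex_derive (fun r => Re (drift_flow g r z)) r /\ ex_derive (fun r => Im (drift_flow g r z)) r.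
Proof.
  split; eexists; [apply re_drift_flow_derive | apply im_drift_flow_derive].
Qed.

Lemma is_derive_sum_sq (X Y : R -> R) (c r x' y' : R) :
  is_derive X r x' -> is_derive Y r y' ->
  is_derive (fun r => c * (X r * X r + Y r * Y r)) r (c * (2 * (X r * x' + Y r * y'))).
Proof.
  intros hX hY. auto_derive.
  - repeat split; eexists; exact hX || exact hY.
  - replace (Derive (fun x => X x) r) with x' by (symmetry; exact (is_derive_unique _ _ _ hX)).
    replace (Derive (fun x => Y x) r) with y' by (symmetry; exact (is_derive_unique _ _ _ hY)).
    ring.
Qed.

Lemma continuous_quadratic (X Y : R -> R) (r c a11 a12 a21 a22 : R) :
  ex_derive X r -> ex_derive Y r -> continuous (fun r => c *
    (2 * (X r * (a11 * X r + a12 * Y r) + Y r * (a21 * X r + a22 * Y r)))) r.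
Proof.
  intros hX hY. apply (ex_derive_continuous (K := R_AbsRing) (V := R_NormedModule)).
  auto_derive. repeat split; assumption.
Qed.

(** By the Lyapunov equation the integrand is the derivative of [- covariance |exp (r Z) z|^2], so
    that only the endpoints contribute; [zeta = 0] removes the phase. *)
Lemma weyl_factor_standardized g beta t z : standardized g beta ->
  weyl_factor g t z =
  RtoC (exp (covariance beta / 2 * Cmod (drift_flow g t z) ^ 2 -
    covariance beta / 2 * Cmod z ^ 2)).
Proof.
  intros hstd. unfold weyl_factor, polar_exp.
  rewrite (RInt_ext (fun r => Re (Cmult (Cconj (zeta g)) _)) (fun _ => 0)).
  2: { intros r _. rewrite (std_zeta _ _ hstd), Cconj_R, re_scal. exact (Rmult_0_l _). }
  rewrite RInt_const. change (scal (t - 0) 0) with ((t - 0) * 0). rewrite Rmult_0_r, cos_0, sin_0.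
  set (X := fun r => Re (drift_flow g r z)). set (Y := fun r => Im (drift_flow g r z)).
  set (f := fun r => - covariance beta * (X r * X r + Y r * Y r)).
  assert (hX : forall r, is_derive X r (Re (drift g (drift_flow g r z))))
    by (intros; apply re_drift_flow_derive).
  assert (hY : forall r, is_derive Y r (Im (drift g (drift_flow g r z))))
    by (intros; apply im_drift_flow_derive).
  assert (hI : is_RInt (fun r => Re (Cmult (Cconj (drift_flow g r z))
    (diffusion g (drift_flow g r z)))) 0 t (f t - f 0)).
  { apply (is_RInt_derive (V := R_CompleteNormedModule) f).
    - intros r _. rewrite (lyapunov_equation g beta) by trivial.
      exact (is_derive_sum_sq X Y _ r _ _ (hX r) (hY r)).
    - intros r _. apply continuous_ext with (fun r => - covariance beta *
        (2 * (X r * (drift_matrix g 0 0 * X r + drift_matrix g 0 1 * Y r) +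
              Y r * (drift_matrix g 1 0 * X r + drift_matrix g 1 1 * Y r)))).
      + intros r'. rewrite (lyapunov_equation g beta) by trivial.
        rewrite re_drift, im_drift. reflexivity.
      + apply continuous_quadratic; eexists; [apply hX | apply hY]. }
  rewrite (is_RInt_unique _ _ _ _ hI).
  replace (1, 0) with (RtoC 1) by reflexivity. rewrite Cmult_1_r. do 2 f_equal.
  unfold f, X, Y. rewrite drift_flow_0, !Cmod2_alt. field.
Qed.

(** * Power series, phases and right derivatives *)

(** Convergence at [r = 1] gives both series a positive radius, and the sums near 0 determine the
    coefficients. *)
Lemma real_power_series_unique (a b : nat -> R) :
  (forall r, exists l, is_series (fun K => r ^ K * a K) l /\ is_series (fun K => r ^ K * b K) l) ->
  forall K, a K = b K.
Proof.
  intros h K.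
  assert (hr : forall u : nat -> R, (forall r, exists l, is_series (fun K => r ^ K * u K) l) ->
    Rbar_lt 0 (CV_radius u)).
  { intros u hu. apply Rbar_lt_le_trans with (Rabs 1); [rewrite Rabs_R1; simpl; lra|].
    apply CV_radius_ge. destruct (hu 1) as [l hl]. exists l.
    apply is_series_ext with (2 := hl). intros; apply Rmult_comm. }
  apply PSeries_ext_recip.
  - apply hr. intros r. destruct (h r) as [l [h1 _]]. now exists l.
  - apply hr. intros r. destruct (h r) as [l [_ h2]]. now exists l.
  - apply filter_forall. intros r. destruct (h r) as [l [h1 h2]]. unfold PSeries.
    transitivity l; [|symmetry]; apply is_series_unique;
      [apply is_series_ext with (2 := h1) | apply is_series_ext with (2 := h2)];
      intros; apply Rmult_comm.
Qed.

Lemma power_series_unique (a b : nat -> C) :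
  (forall r : R, exists l, Clim (csum (fun K => Cmult (RtoC (r ^ K)) (a K))) l /\
                           Clim (csum (fun K => Cmult (RtoC (r ^ K)) (b K))) l) ->
  forall K, a K = b K.
Proof.
  intros h K. apply Ceq.
  - apply (real_power_series_unique (fun K => Re (a K)) (fun K => Re (b K))). intros r.
    destruct (h r) as [l [h1 h2]]. rewrite Clim_csum in h1, h2. exists (Re l). split.
    + apply is_series_ext with (2 := proj1 h1). intros; apply re_scal.
    + apply is_series_ext with (2 := proj1 h2). intros; apply re_scal.
  - apply (real_power_series_unique (fun K => Im (a K)) (fun K => Im (b K))). intros r.
    destruct (h r) as [l [h1 h2]]. rewrite Clim_csum in h1, h2. exists (Im l). split.
    + apply is_series_ext with (2 := proj2 h1). intros; apply im_scal.
    + apply is_series_ext with (2 := proj2 h2). intros; apply im_scal.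
Qed.

Definition phase (th : R) : C := (cos th, sin th).

Lemma phase_mult a b : Cmult (phase a) (phase b) = phase (a + b).
Proof.
  unfold phase, Cmult; simpl. rewrite cos_plus, sin_plus. f_equal. ring.
Qed.

Lemma phase_conj a : Cconj (phase a) = phase (- a).
Proof. unfold phase, Cconj; simpl. now rewrite cos_neg, sin_neg. Qed.

Lemma phase_pow a n : Cpow (phase a) n = phase (INR n * a).
Proof.
  induction n as [|n IH].
  - simpl. rewrite Rmult_0_l. unfold phase. now rewrite cos_0, sin_0.
  - rewrite Cpow_S, IH, phase_mult, S_INR. f_equal. ring.
Qed.

Lemma mono_phase th z j k :
  mono (Cmult (phase th) z) j k = Cmult (phase ((INR j - INR k) * th)) (mono z j k).
Proof.
  unfold mono. rewrite Cmult_conj, phase_conj.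
  replace (Copp (Cmult (phase (- th)) (Cconj z))) with
    (Cmult (phase (- th)) (Copp (Cconj z))) by ring.
  rewrite !Cpow_mult_l, !phase_pow.
  replace ((INR j - INR k) * th) with (INR j * th + INR k * - th) by ring.
  rewrite <- phase_mult. ring.
Qed.

Lemma phase_inj a b : phase a = phase b -> Rabs (a - b) < PI -> a = b.
Proof.
  intros h hab. injection h as h1 h2.
  assert (h3 : sin (a - b) = 0) by (rewrite sin_minus, h1, h2; ring).
  assert (h4 : sin (b - a) = 0) by (rewrite sin_minus, h1, h2; ring).
  apply Rabs_def2 in hab.
  destruct (Rtotal_order a b) as [hlt|[heq|hgt]]; trivial; exfalso.
  - assert (0 < sin (b - a)) by (apply sin_gt_0; lra). lra.
  - assert (0 < sin (a - b)) by (apply sin_gt_0; lra). lra.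
Qed.

Lemma mono_1_sq j k : Cmult (mono (RtoC 1) j k) (mono (RtoC 1) j k) = RtoC 1.
Proof.
  unfold mono. rewrite Cconj_R, Cpow_1_l, !Cmult_1_l, <- Cpow_mult_l.
  replace (Cmult (Copp (RtoC 1)) (Copp (RtoC 1))) with (RtoC 1) by ring. apply Cpow_1_l.
Qed.

(* The rotations z -> phase th * z separate the monomials of a given total degree. *)
Lemma span_mono_components (G : hs -> Prop) (w : nat -> hs) (K N : nat) : (N <= K)%nat ->
  forall mu : nat -> C,
  (forall z, span G (hsum (fun j => scal (Cmult (mu j) (mono z j (K - j))) (w j)) N)) ->
  forall j, (j <= N)%nat -> span G (scal (mu j) (w j)).
Proof.
  intros hNK.
  assert (hlast : forall (mu : C) j, span G (scal (Cmult mu (mono (RtoC 1) j (K - j))) (w j)) ->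
    span G (scal mu (w j))).
  { intros mu j h.
    replace mu with (Cmult (mono (RtoC 1) j (K - j)) (Cmult mu (mono (RtoC 1) j (K - j)))).
    - hs_as (scal (mono (RtoC 1) j (K - j)) (scal (Cmult mu (mono (RtoC 1) j (K - j))) (w j))).
      now apply span_scal.
    - transitivity (Cmult mu (Cmult (mono (RtoC 1) j (K - j)) (mono (RtoC 1) j (K - j)))); [ring|].
      rewrite mono_1_sq. ring. }
  induction N as [|N IH]; intros mu h.
  - intros j hj. replace j with 0%nat by lia. apply hlast. exact (h (RtoC 1)).
  (* The angles [(2 j - K) th] for [j <= K] differ from each other by at most 1, hence by less than
     [PI], so distinct [j] give distinct phases. *)
  - set (th := / INR (2 * S K)).
    set (lam := fun j => phase ((INR j - INR (K - j)) * th)).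
    assert (hth : 0 < th) by (apply Rinv_0_lt_compat, lt_0_INR; lia).
    assert (hdist : forall j, (j <= N)%nat -> Cminus (lam j) (lam (S N)) <> RtoC 0).
    { intros j hj h0. assert (h1 : lam j = lam (S N)).
      { transitivity (Cplus (Cminus (lam j) (lam (S N))) (lam (S N))); [ring|]. rewrite h0. ring. }
      apply phase_inj in h1.
      - apply Rmult_eq_reg_r in h1; [|lra].
        rewrite !minus_INR in h1 by lia.
        assert (h2 : INR j = INR (S N)) by lra. apply INR_eq in h2. lia.
      - replace ((INR j - INR (K - j)) * th - (INR (S N) - INR (K - S N)) * th) with
          (- (INR (2 * (S N - j)) * th)).
        + rewrite Rabs_Ropp, Rabs_pos_eq.
          * apply Rle_lt_trans with 1; [|generalize PI2_3_2; lra].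
            unfold th. apply (Rmult_le_reg_r (INR (2 * S K))); [apply lt_0_INR; lia|].
            rewrite Rmult_assoc, Rinv_l, Rmult_1_r, Rmult_1_l by (apply not_0_INR; lia).
            apply le_INR. lia.
          * apply Rmult_le_pos; [apply pos_INR | lra].
        + rewrite mult_INR, !minus_INR by lia. simpl (INR 2). ring. }
    (* The sum at the rotated point minus [lam (S N)] times the sum at [z] loses its last term; the
       others acquire the nonzero factors [lam j - lam (S N)], and the induction hypothesis applies
       with these absorbed into [mu]. *)
    assert (hlow : forall j, (j <= N)%nat -> span G (scal (mu j) (w j))).
    { intros j hj.
      assert (h1 : span G (scal (Cmult (mu j) (Cminus (lam j) (lam (S N)))) (w j))).
      { apply (IH ltac:(lia) (fun j => Cmult (mu j) (Cminus (lam j) (lam (S N))))); trivial.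
        intros z.
        replace (hsum (fun j => scal (Cmult (Cmult (mu j) (Cminus (lam j) (lam (S N))))
            (mono z j (K - j))) (w j)) N) with
          (plus (hsum (fun j => scal (Cmult (mu j) (mono (Cmult (phase th) z) j (K - j))) (w j)) (S N))
            (scal (Copp (lam (S N)))
              (hsum (fun j => scal (Cmult (mu j) (mono z j (K - j))) (w j)) (S N)))).
        - apply span_plus; [apply h | apply span_scal, h].
        - apply hs_ext_ent. intros n m. rewrite ent_plus, ent_scal, !ent_hsum.
          rewrite <- csum_scal, <- csum_plus. cbn [csum].
          replace (csum (fun k => ent (scal (Cmult (Cmult (mu k) (Cminus (lam k) (lam (S N))))
            (mono z k (K - k))) (w k)) n m) N) with
            (Cplus (csum (fun k => ent (scal (Cmult (Cmult (mu k) (Cminus (lam k) (lam (S N))))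
            (mono z k (K - k))) (w k)) n m) N) (RtoC 0)) by ring.
          f_equal.
          + apply csum_ext. intros i hi. rewrite !ent_scal, mono_phase. fold (lam i). ring.
          + rewrite !ent_scal, mono_phase. fold (lam (S N)). ring. }
      apply (eq_ind (scal (Cinv (Cminus (lam j) (lam (S N))))
        (scal (Cmult (mu j) (Cminus (lam j) (lam (S N)))) (w j))) (span G)).
      - now apply span_scal.
      - apply hs_ext_ent. intros. rewrite !ent_scal.
        field. now apply hdist. }
    intros j hj. destruct (Nat.eq_dec j (S N)) as [->|]; [|apply hlow; lia].
    apply hlast.
    apply (eq_ind (plus (hsum (fun j => scal (Cmult (mu j) (mono (RtoC 1) j (K - j))) (w j)) (S N))
      (scal (Copp (RtoC 1))
        (hsum (fun j => scal (Cmult (mu j) (mono (RtoC 1) j (K - j))) (w j)) N))) (span G)).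
    + apply span_plus; [apply h|]. apply span_scal, span_hsum. intros i hi.
      hs_as (scal (mono (RtoC 1) i (K - i)) (scal (mu i) (w i))). now apply span_scal, hlow.
    + cbn [hsum]. hs_ring.
Qed.

Definition cderivable (f : R -> C) (t : R) : Prop :=
  ex_derive (fun t => Re (f t)) t /\ ex_derive (fun t => Im (f t)) t.

Lemma cderivable_mult f g t : cderivable f t -> cderivable g t ->
  cderivable (fun t => Cmult (f t) (g t)) t.
Proof.
  intros [h1 h2] [h3 h4]. split.
  - apply (ex_derive_ext (fun t => Re (f t) * Re (g t) - Im (f t) * Im (g t))); [reflexivity|].
    apply (ex_derive_minus (K := R_AbsRing) (V := R_NormedModule));
      apply ex_derive_mult; assumption.
  - apply (ex_derive_ext (fun t => Re (f t) * Im (g t) + Im (f t) * Re (g t))); [reflexivity|].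
    apply (ex_derive_plus (K := R_AbsRing) (V := R_NormedModule));
      apply ex_derive_mult; assumption.
Qed.

Lemma cderivable_pow f t n : cderivable f t -> cderivable (fun t => Cpow (f t) n) t.
Proof.
  intros h. induction n as [|n IH].
  - split; simpl; apply ex_derive_const.
  - apply cderivable_mult; trivial.
Qed.

Lemma cderivable_mono g z j k t : cderivable (fun t => mono (drift_flow g t z) j k) t.
Proof.
  destruct (ex_derive_drift_flow g t z) as [h1 h2]. unfold mono.
  apply cderivable_mult; apply cderivable_pow; split; trivial.
  - apply (ex_derive_ext (fun t => - Re (drift_flow g t z))); [reflexivity|].
    now apply (ex_derive_opp (K := R_AbsRing) (V := R_NormedModule)).
  - apply (ex_derive_ext (fun t => Im (drift_flow g t z))); [|trivial].
    intros u. simpl. symmetry. apply Ropp_involutive.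
Qed.

Definition right_lim0 (e : R -> R) : Prop :=
  forall eps, 0 < eps -> exists d, 0 < d /\ forall t, 0 < t < d -> Rabs (e t) < eps.

Lemma Cmod_le_abs z : Cmod z <= Rabs (Re z) + Rabs (Im z).
Proof.
  assert (h1 := Rabs_pos (Re z)). assert (h2 := Rabs_pos (Im z)).
  apply Rsqr_incr_0_var; [|lra]. rewrite !Rsqr_pow2, Cmod2_alt.
  rewrite <- (pow2_abs (Re z)), <- (pow2_abs (Im z)). nra.
Qed.

Lemma cderivable_quotient f : cderivable f 0 -> exists d : C,
  right_lim0 (fun t => Cmod (Cminus (Cmult (RtoC (/ t)) (Cminus (f t) (f 0))) d)).
Proof.
  intros [[x hx] [y hy]]. exists (x, y). intros eps he.
  apply is_derive_Reals in hx, hy.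
  destruct (hx (eps / 2) ltac:(lra)) as [d1 h1]. destruct (hy (eps / 2) ltac:(lra)) as [d2 h2].
  exists (Rmin d1 d2). split; [apply Rmin_pos; apply cond_pos|]. intros t [ht0 ht].
  assert (ht1 : Rabs t < d1) by (rewrite Rabs_pos_eq by lra; eapply Rlt_le_trans; [exact ht|apply Rmin_l]).
  assert (ht2 : Rabs t < d2) by (rewrite Rabs_pos_eq by lra; eapply Rlt_le_trans; [exact ht|apply Rmin_r]).
  specialize (h1 t ltac:(lra) ht1). specialize (h2 t ltac:(lra) ht2).
  rewrite Rplus_0_l in h1, h2.
  rewrite Rabs_pos_eq by apply Cmod_ge_0.
  eapply Rle_lt_trans; [apply Cmod_le_abs|].
  change (Re (Cminus ?a ?b)) with (Re a - Re b). change (Im (Cminus ?a ?b)) with (Im a - Im b).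
  rewrite re_scal, im_scal.
  change (Re (Cminus ?a ?b)) with (Re a - Re b). change (Im (Cminus ?a ?b)) with (Im a - Im b).
  change (Re (x, y)) with x. change (Im (x, y)) with y.
  rewrite !(Rmult_comm (/ t)). unfold Rdiv in h1, h2. lra.
Qed.

Lemma right_lim0_hsum (e : nat -> R -> C) (w : nat -> hs) N :
  (forall j, right_lim0 (fun t => Cmod (e j t))) ->
  right_lim0 (fun t => hs_norm (hsum (fun j => scal (e j t) (w j)) N)).
Proof.
  intros h.
  assert (h1 : forall j, right_lim0 (fun t => hs_norm (scal (e j t) (w j)))).
  { intros j eps he. assert (hw := ip_norm_ge0 hs_ip (w j)).
    destruct (h j (eps / (hs_norm (w j) + 1))) as [d [hd h2]].
    { apply Rdiv_lt_0_compat; lra. }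
    exists d. split; trivial. intros t ht. specialize (h2 t ht).
    rewrite Rabs_pos_eq in * by (apply ip_norm_ge0 || apply Cmod_ge_0).
    eapply Rle_lt_trans; [apply (ip_norm_scal _ hs_ip_inner (e j t) (w j))|].
    change (abs (e j t)) with (Cmod (e j t)).
    apply Rle_lt_trans with (Cmod (e j t) * (hs_norm (w j) + 1)).
    - apply Rmult_le_compat_l; [apply Cmod_ge_0 | lra].
    - apply (Rmult_lt_compat_r (hs_norm (w j) + 1)) in h2; [|lra].
      replace eps with (eps / (hs_norm (w j) + 1) * (hs_norm (w j) + 1)) by (field; lra).
      exact h2. }
  induction N as [|N IH]; [apply h1|]. intros eps he.
  destruct (IH (eps / 2) ltac:(lra)) as [d1 [hd1 h2]].
  destruct (h1 (S N) (eps / 2) ltac:(lra)) as [d2 [hd2 h3]].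
  exists (Rmin d1 d2). split; [now apply Rmin_pos|]. intros t [ht0 ht].
  specialize (h2 t (conj ht0 (Rlt_le_trans _ _ _ ht (Rmin_l _ _)))).
  specialize (h3 t (conj ht0 (Rlt_le_trans _ _ _ ht (Rmin_r _ _)))).
  rewrite Rabs_pos_eq in h2, h3 |- * by apply ip_norm_ge0. cbn [hsum].
  eapply Rle_lt_trans; [apply (ip_norm_triangle _ hs_ip_inner)|]. lra.
Qed.

Lemma generator_right_lim (S : R -> hs -> hs) x y : generator S x y <->
  right_lim0 (fun t => hs_norm (minus (scal (RtoC (/ t)) (minus (S t x) x)) y)).
Proof.
  split.
  - intros h eps he.
    destruct (h _ (locally_ball y (mkposreal eps he))) as [d hd]. exists d.
    split; [apply cond_pos|]. intros t [ht0 ht].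
    rewrite Rabs_pos_eq by apply ip_norm_ge0. apply hd; trivial.
    change (Rabs (t - 0) < d). rewrite Rminus_0_r, Rabs_pos_eq; lra.
  - intros h P [eps hP]. destruct (h eps (cond_pos eps)) as [d [hd h1]].
    exists (mkposreal d hd). intros t ht ht0. apply hP.
    change (Rabs (t - 0) < d) in ht. rewrite Rminus_0_r, Rabs_pos_eq in ht by lra.
    specialize (h1 t (conj ht0 ht)). rewrite Rabs_pos_eq in h1 by apply ip_norm_ge0. exact h1.
Qed.

Lemma eq_0_of_le_mul_eps (c m : R) : 0 <= c -> 0 <= m ->
  (forall eps, 0 < eps -> c <= eps * m) -> c = 0.
Proof.
  intros hc hm h. apply Rle_antisym; trivial. apply Rnot_lt_le. intros h0.
  assert (h1 := h (c / (2 * (m + 1))) ltac:(apply Rdiv_lt_0_compat; lra)).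
  assert (h2 : c / (2 * (m + 1)) * m <= c / 2); [|lra].
  apply (Rmult_le_reg_r (2 * (m + 1))); [lra|].
  replace (c / (2 * (m + 1)) * m * (2 * (m + 1))) with (c * m) by (field; lra). nra.
Qed.

(** * The induced semigroup and its generator *)

Lemma generator_linear (S : R -> hs -> hs) : contraction_semigroup S ->
  forall (c : C) x x' y y', generator S x y -> generator S x' y' ->
  generator S (plus (scal c x) x') (plus (scal c y) y').
Proof.
  intros hS c x x' y y' h1 h2. apply generator_right_lim in h1, h2. apply generator_right_lim.
  set (u := fun t => minus (scal (RtoC (/ t)) (minus (S t x) x)) y) in *.
  set (v := fun t => minus (scal (RtoC (/ t)) (minus (S t x') x')) y') in *.
  intros eps he.
  assert (hc := Cmod_ge_0 c).
  destruct (h1 (eps / (2 * (Cmod c + 1)))) as [d1 [hd1 h3]]. { apply Rdiv_lt_0_compat; lra. }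
  destruct (h2 (eps / 2) ltac:(lra)) as [d2 [hd2 h4]].
  exists (Rmin d1 d2). split; [now apply Rmin_pos|]. intros t [ht0 ht].
  specialize (h3 t (conj ht0 (Rlt_le_trans _ _ _ ht (Rmin_l _ _)))).
  specialize (h4 t (conj ht0 (Rlt_le_trans _ _ _ ht (Rmin_r _ _)))).
  rewrite Rabs_pos_eq in h3, h4 |- * by apply ip_norm_ge0.
  change (hs_norm (u t) < eps / (2 * (Cmod c + 1))) in h3. change (hs_norm (v t) < eps / 2) in h4.
  destruct (cs_linear _ hS t (Rlt_le _ _ ht0)) as [hp hsc _].
  rewrite hp, hsc.
  match goal with |- hs_norm ?a < _ => replace a with (plus (scal c (u t)) (v t) : hs)
    by (unfold u, v; hs_ring) end.
  eapply Rle_lt_trans; [apply (ip_norm_triangle _ hs_ip_inner)|].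
  apply Rle_lt_trans with (Cmod c * hs_norm (u t) + hs_norm (v t)).
  { apply Rplus_le_compat_r. exact (ip_norm_scal _ hs_ip_inner c (u t)). }
  assert (h6 : Cmod c * hs_norm (u t) <= eps / 2).
  { apply Rle_trans with ((Cmod c + 1) * (eps / (2 * (Cmod c + 1)))); [|right; field; lra].
    apply Rmult_le_compat; try lra. apply ip_norm_ge0. }
  lra.
Qed.

Lemma generator_zero (S : R -> hs -> hs) : contraction_semigroup S -> generator S zero zero.
Proof.
  intros hS. apply generator_right_lim. intros eps he. exists 1. split; [lra|]. intros t [ht _].
  assert (h : S t zero = zero).
  { destruct (cs_linear _ hS t (Rlt_le _ _ ht)) as [_ hsc _].
    replace (zero : hs) with (scal (RtoC 0) (zero : hs)) at 1 by hs_ring.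
    rewrite hsc. hs_ring. }
  assert (hq : minus (scal (RtoC (/ t)) (minus (S t zero) zero)) zero = (zero : hs))
    by (rewrite h; hs_ring).
  rewrite Rabs_pos_eq by apply ip_norm_ge0.
  apply Rle_lt_trans with (hs_norm zero); [right; f_equal; exact hq|].
  rewrite (ip_norm_zero _ hs_ip_inner). exact he.
Qed.

Lemma generator_span (S : R -> hs -> hs) (G H : hs -> Prop) : contraction_semigroup S ->
  (forall x, G x -> exists v, span H v /\ generator S x v) ->
  forall x, span G x -> exists v, span H v /\ generator S x v.
Proof.
  intros hS h x hx. induction hx as [|c x y hx hy [v [hv1 hv2]]].
  - exists zero. split; [constructor | now apply generator_zero].
  - destruct (h x hx) as [u [hu1 hu2]]. exists (plus (scal c u) v). split.
    + apply span_plus; trivial. now apply span_scal.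
    + now apply generator_linear.
Qed.

Lemma generator_hsum (S : R -> hs -> hs) (c : nat -> C) (x y : nat -> hs) N :
  contraction_semigroup S -> (forall n, (n <= N)%nat -> generator S (x n) (y n)) ->
  generator S (hsum (fun n => scal (c n) (x n)) N) (hsum (fun n => scal (c n) (y n)) N).
Proof.
  intros hS. induction N as [|N IH]; intros h; cbn [hsum].
  - replace (scal (c 0%nat) (x 0%nat)) with (plus (scal (c 0%nat) (x 0%nat)) zero) by hs_ring.
    replace (scal (c 0%nat) (y 0%nat)) with (plus (scal (c 0%nat) (y 0%nat)) zero) by hs_ring.
    apply generator_linear; trivial; [apply h; lia | now apply generator_zero].
  - rewrite plus_comm, (plus_comm (hsum (fun n => scal (c n) (y n)) N)).
    apply generator_linear; trivial; [apply h; lia|]. apply IH. intros; apply h; lia.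
Qed.

(** The difference quotients of the orbit of [d] are orthogonal to [y], and so is their limit. This
    carries invariance of an orthogonal complement from the semigroup to the generator without any
    expansion of [d]. *)
Lemma generator_orth (S : R -> hs -> hs) (y d e : hs) : generator S d e ->
  (forall t, 0 <= t -> hs_ip y (S t d) = RtoC 0) -> hs_ip y d = RtoC 0 -> hs_ip y e = RtoC 0.
Proof.
  intros hg h0 h1. apply generator_right_lim in hg. apply Cmod_eq_0.
  apply (eq_0_of_le_mul_eps _ (hs_norm y)); [apply Cmod_ge_0 | apply ip_norm_ge0|].
  intros eps he. destruct (hg eps he) as [r [hr h2]].
  specialize (h2 (r / 2) ltac:(lra)). rewrite Rabs_pos_eq in h2 by apply ip_norm_ge0.
  set (q := scal (RtoC (/ (r / 2))) (minus (S (r / 2) d) d)) in *.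
  assert (hq : hs_ip y q = RtoC 0).
  { unfold q. rewrite (ip_scal_r _ hs_ip_inner), ip_minus_r, h0, h1 by lra. ring. }
  replace (hs_ip y e) with (Copp (hs_ip y (minus q e))) by (rewrite ip_minus_r, hq; ring).
  rewrite Cmod_opp. eapply Rle_trans; [apply (ip_CS _ hs_ip_inner)|].
  rewrite Rmult_comm. apply Rmult_le_compat_r; [apply ip_norm_ge0 | lra].
Qed.

Lemma adjoint_linear (A : graph hs) (c : C) x x' y y' :
  adjoint hs_ip A x y -> adjoint hs_ip A x' y' ->
  adjoint hs_ip A (plus (scal c x) x') (plus (scal c y) y').
Proof.
  intros h1 h2 u v huv.
  rewrite !(ip_plus_l _ hs_ip_inner), !(ip_scal_l _ hs_ip_inner).
  now rewrite (h1 u v huv), (h2 u v huv).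
Qed.

Lemma symmetric_adjoint_plus (A : graph hs) (D : hs -> Prop) :
  symmetric hs_ip (restrict (graph_plus (adjoint hs_ip A) A) D).
Proof.
  intros x v y w [_ (v1 & v2 & hv1 & hv2 & ->)] [_ (w1 & w2 & hw1 & hw2 & ->)].
  rewrite (ip_plus_l _ hs_ip_inner), (ip_plus_r _ hs_ip_inner).
  rewrite <- (hv1 y w2 hw2), (ip_conj _ hs_ip_inner y v2), (hw1 x v2 hv2).
  rewrite <- (ip_conj _ hs_ip_inner). apply Cplus_comm.
Qed.

Lemma graph_closure_ip (A : graph hs) (a b : hs) :
  (forall x y, A x y -> hs_ip a x = hs_ip b y) ->
  forall x y, graph_closure A x y -> hs_ip a x = hs_ip b y.
Proof.
  intros h x y hc.
  assert (h0 : Cminus (hs_ip a x) (hs_ip b y) = RtoC 0).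
  { apply Cmod_eq_0. apply (eq_0_of_le_mul_eps _ (hs_norm a + hs_norm b)).
    - apply Cmod_ge_0.
    - apply Rplus_le_le_0_compat; apply ip_norm_ge0.
    - intros eps he. destruct (hc (mkposreal eps he)) as (x' & y' & hA & hx & hy).
      change (hs_norm (minus x' x) < eps) in hx. change (hs_norm (minus y' y) < eps) in hy.
      replace (Cminus (hs_ip a x) (hs_ip b y)) with
        (Cplus (Copp (hs_ip a (minus x' x))) (hs_ip b (minus y' y))).
      2: { rewrite !ip_minus_r, (h x' y' hA). ring. }
      eapply Rle_trans; [apply Cmod_triangle|]. rewrite Cmod_opp, Rmult_plus_distr_l.
      apply Rplus_le_compat; (eapply Rle_trans; [apply (ip_CS _ hs_ip_inner)|]);
        rewrite Rmult_comm; apply Rmult_le_compat_r; apply ip_norm_ge0 || lra. }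
  transitivity (Cplus (Cminus (hs_ip a x) (hs_ip b y)) (hs_ip b y)); [ring|]. rewrite h0. ring.
Qed.

(** The identity is a closed condition on each of the two pairs separately, so [graph_closure_ip] is
    applied once for each. *)
Lemma symmetric_closure (A : graph hs) : symmetric hs_ip A ->
  forall x v y w, graph_closure A x v -> graph_closure A y w -> hs_ip v y = hs_ip x w.
Proof.
  intros hs x v y w hxv hyw. apply (graph_closure_ip A v x); trivial.
  intros y' w' hA. rewrite (ip_conj _ hs_ip_inner y' v), (ip_conj _ hs_ip_inner w' x).
  f_equal. symmetry. apply (graph_closure_ip A w' y'); trivial.
  intros x' v' hA'. symmetry. rewrite (ip_conj _ hs_ip_inner v' y'), (ip_conj _ hs_ip_inner x' w').
  f_equal. now apply hs.
Qed.

Lemma finite_choice (X : Type) (P : nat -> X -> Prop) N : (forall n, (n <= N)%nat -> exists y, P n y) ->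
  exists f, forall n, (n <= N)%nat -> P n (f n).
Proof.
  induction N as [|N IH]; intros h.
  - destruct (h 0%nat ltac:(lia)) as [y hy]. exists (fun _ => y). intros n hn.
    now replace n with 0%nat by lia.
  - destruct IH as [f hf]; [intros; apply h; lia|]. destruct (h (S N) ltac:(lia)) as [y hy].
    exists (fun n => if Nat.eqb n (S N) then y else f n). intros n hn.
    destruct (Nat.eqb_spec n (S N)) as [->|]; trivial. apply hf. lia.
Qed.

Section semigroup.

Context (g : gaussian_data) (beta : R) (W : C -> bounded_op) (T : R -> bounded_op -> bounded_op)
  (hW : forall z, is_weyl z (W z)) (hT : gaussian_qms g W T) (hstd : standardized g beta)
  (s : R) (hs01 : 0 <= s <= 1) (Ts : R -> hs -> hs) (hTs : induced_semigroup beta s T Ts).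

Local Notation hb := (std_pos g beta hstd).
Local Notation wick := (wick beta s hb hs01).
Local Notation wick_norm2 := (wick_norm2 beta s).
Local Notation wick_proj := (wick_proj beta s hb hs01).
Local Notation wick_layer := (wick_layer beta s hb hs01).
Local Notation graded := (graded beta s hb hs01).

(** Degree exactly [K], whereas [graded K] has degree at most [K]; the semigroup preserves each
    level by itself. *)
Definition level (K : nat) (Y : hs) : Prop := exists j, (j <= K)%nat /\ Y = wick j (K - j).

Lemma Ts_plus t x y : 0 <= t -> Ts t (plus x y) = plus (Ts t x) (Ts t y).
Proof. intros h. apply (linear_plus _ (cs_linear _ (proj1 hTs) t h)). Qed.

Lemma Ts_scal t (c : C) x : 0 <= t -> Ts t (scal c x) = scal c (Ts t x).
Proof. intros h. exact (linear_scal _ (cs_linear _ (proj1 hTs) t h) c x). Qed.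

Lemma Ts_minus t x y : 0 <= t -> Ts t (minus x y) = minus (Ts t x) (Ts t y).
Proof. intros h. now rewrite !hs_minus_scal, Ts_plus, Ts_scal. Qed.

Lemma Ts_hsum t u N : 0 <= t -> Ts t (hsum u N) = hsum (fun n => Ts t (u n)) N.
Proof. intros h. induction N; simpl; trivial. now rewrite Ts_plus, IHN. Qed.

Lemma Ts_lim t Y y : 0 <= t -> hs_lim Y y -> hs_lim (fun K => Ts t (Y K)) (Ts t y).
Proof.
  intros ht h. unfold hs_lim. apply is_lim_seq_0_le with (2 := h). intros K.
  split; [apply ip_norm_ge0|]. rewrite <- Ts_minus by trivial.
  exact (cs_contraction _ (proj1 hTs) t (minus (Y K) y) ht).
Qed.

Lemma Ts_exponential t z Z Z' : 0 <= t ->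
  is_embedding beta s
    (fun n => scal (RtoC (exp (covariance beta / 2 * Cmod z ^ 2))) (W z) (basis n)) Z ->
  is_embedding beta s
    (fun n => scal (RtoC (exp (covariance beta / 2 * Cmod (drift_flow g t z) ^ 2)))
      (W (drift_flow g t z)) (basis n)) Z' -> Ts t Z = Z'.
Proof.
  intros ht hZ hZ'. apply (proj2 hTs t _ _ ht) in hZ. destruct hT as [hq hw].
  rewrite (qms_scal _ hq) in hZ by trivial. rewrite hw in hZ by trivial.
  rewrite (weyl_factor_standardized g beta t z hstd) in hZ.
  apply (is_embedding_unique beta s _ _ _ hZ). intros n m. rewrite hZ'. do 2 f_equal.
  set (x := W (drift_flow g t z) (basis n) m).
  change (Cmult (RtoC (exp (covariance beta / 2 * Cmod (drift_flow g t z) ^ 2))) x =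
    Cmult (RtoC (exp (covariance beta / 2 * Cmod z ^ 2)))
      (Cmult (RtoC (exp (covariance beta / 2 * Cmod (drift_flow g t z) ^ 2 -
         covariance beta / 2 * Cmod z ^ 2))) x)).
  rewrite Cmult_assoc, <- RtoC_mult, <- exp_plus. do 3 f_equal. ring.
Qed.

Lemma wick_layer_real_scal (r : R) z K :
  wick_layer (Cmult (RtoC r) z) K = scal (RtoC (r ^ K)) (wick_layer z K).
Proof.
  apply hs_ext_ent. intros n m. rewrite ent_scal, !ent_wick_layer, layer_real_scal. ring.
Qed.

(** The exponential vectors at [r z], with [r] real, are power series in [r] whose coefficients are
    the layers at [z]. The drift flow is only real linear, so complex multiples of [z] would not do.
    Products with the total family [wick j k] reduce the comparison of coefficients to scalar power
    series. *)
Lemma Ts_wick_layer t z K : 0 <= t -> Ts t (wick_layer z K) = wick_layer (drift_flow g t z) K.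
Proof.
  intros ht. apply (wick_total beta s hb hs01). intros j k.
  apply (power_series_unique (fun K => hs_ip (wick j k) (Ts t (wick_layer z K)))
    (fun K => hs_ip (wick j k) (wick_layer (drift_flow g t z) K))).
  intros r.
  destruct (weyl_expansion beta s hb hs01 W (Cmult (RtoC r) z) hW) as [Z [h1 h2]].
  destruct (weyl_expansion beta s hb hs01 W (drift_flow g t (Cmult (RtoC r) z)) hW)
    as [Z' [h1' h2']].
  assert (hZ := Ts_exponential t _ Z Z' ht h1 h1').
  exists (hs_ip (wick j k) Z'). split.
  - rewrite <- hZ. generalize (hs_lim_ip (wick j k) _ _ (Ts_lim t _ _ ht h2)).
    apply Clim_ext. intros N. rewrite Ts_hsum, ip_hsum_r by trivial. apply csum_ext. intros i _.
    now rewrite wick_layer_real_scal, Ts_scal, (ip_scal_r _ hs_ip_inner).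
  - generalize (hs_lim_ip (wick j k) _ _ h2').
    apply Clim_ext. intros N. rewrite ip_hsum_r. apply csum_ext. intros i _.
    now rewrite drift_flow_real_scal, wick_layer_real_scal, (ip_scal_r _ hs_ip_inner).
Qed.

Lemma wick_layer_level z K : span (level K) (wick_layer z K).
Proof.
  apply span_hsum. intros j hj. apply span_scal, span_gen. now exists j.
Qed.

Lemma level_span_wick_layer K x :
  span (level K) x -> span (fun Y => exists z, Y = wick_layer z K) x.
Proof.
  intros hx. induction hx as [|c x y [j [hj ->]] hy IH]; [constructor|].
  apply span_plus; trivial. apply span_scal.
  hs_as (scal (RtoC 1) (wick j (K - j))).
  apply (span_mono_components _ (fun j => wick j (K - j)) K K (le_n K) (fun _ => RtoC 1)); trivial.
  intros z. apply span_gen. exists z. apply hsum_ext. intros i _. hs_ring.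
Qed.

(** The orbit stays in the finite-dimensional level [K], and its coordinates are monomials in the
    drift flow, hence differentiable at 0; their derivatives are the coordinates of [v]. *)
Lemma generator_wick_layer z K : exists v, span (level K) v /\ generator Ts (wick_layer z K) v.
Proof.
  destruct (finite_choice C (fun j d => right_lim0 (fun t =>
    Cmod (Cminus (Cmult (RtoC (/ t)) (Cminus (mono (drift_flow g t z) j (K - j))
      (mono (drift_flow g 0 z) j (K - j)))) d))) K) as [d hd].
  { intros j _. apply (cderivable_quotient (fun t => mono (drift_flow g t z) j (K - j))).
    apply cderivable_mono. }
  exists (hsum (fun j => scal (d j) (wick j (K - j))) K). split.
  { apply span_hsum. intros j hj. apply span_scal, span_gen. now exists j. }
  apply generator_right_lim. intros eps he.
  (* [right_lim0_hsum] asks for a limit at every index, while [d] is controlled up to [K] only;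
     beyond it the term is replaced by 0. *)
  destruct (right_lim0_hsum (fun j t => if Nat.leb j K then
    Cminus (Cmult (RtoC (/ t)) (Cminus (mono (drift_flow g t z) j (K - j))
      (mono (drift_flow g 0 z) j (K - j)))) (d j) else RtoC 0)
    (fun j => wick j (K - j)) K) with (eps := eps) as [r [hr h1]]; trivial.
  { intros j. destruct (Nat.leb_spec j K) as [hj|hj]; [now apply hd|].
    intros e0 he0. exists 1. split; [lra|]. intros. now rewrite Cmod_0, Rabs_R0. }
  exists r. split; trivial. intros t ht. specialize (h1 t ht).
  rewrite Ts_wick_layer by lra.
  match goal with |- Rabs (hs_norm ?a) < _ => match type of h1 with Rabs (hs_norm ?b) < _ =>
    replace a with b; trivial end end.
  apply hs_ext_ent. intros n m. unfold wick_layer.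
  rewrite !ent_minus, ent_scal, ent_minus, !ent_hsum. unfold Cminus at 3 4.
  transitivity (Cplus (Cmult (RtoC (/ t)) (Cplus
    (csum (fun k => ent (scal (mono (drift_flow g t z) k (K - k)) (wick k (K - k))) n m) K)
    (Cmult (Copp (RtoC 1))
      (csum (fun k => ent (scal (mono z k (K - k)) (wick k (K - k))) n m) K))))
    (Cmult (Copp (RtoC 1)) (csum (fun k => ent (scal (d k) (wick k (K - k))) n m) K))); [|ring].
  rewrite <- !csum_scal, <- csum_plus, <- csum_scal, <- csum_plus.
  apply csum_ext. intros j hj. apply Nat.leb_le in hj. rewrite hj, drift_flow_0, !ent_scal. ring.
Qed.

Lemma generator_level K x : span (level K) x -> exists v, span (level K) v /\ generator Ts x v.
Proof.
  intros hx. apply level_span_wick_layer in hx. revert x hx.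
  apply generator_span; [apply hTs|]. intros x [z ->]. apply generator_wick_layer.
Qed.

Lemma Ts_level t K x : 0 <= t -> span (level K) x -> span (level K) (Ts t x).
Proof.
  intros ht hx. apply level_span_wick_layer in hx.
  induction hx as [|c x y [z ->] hy IH].
  - replace (zero : hs) with (scal (RtoC 0) (zero : hs)) by hs_ring.
    rewrite Ts_scal by trivial. hs_as (zero : hs). constructor.
  - rewrite Ts_plus, Ts_scal, Ts_wick_layer by trivial.
    apply span_plus; trivial. apply span_scal, wick_layer_level.
Qed.

Lemma level_orth (j k K : nat) x : span (level K) x -> (j + k <> K)%nat -> hs_ip (wick j k) x = RtoC 0.
Proof.
  intros hx hne. induction hx as [|c x y [i [hi ->]] hy IH].
  - apply (ip_zero_r _ hs_ip_inner).
  - rewrite (ip_plus_r _ hs_ip_inner), (ip_scal_r _ hs_ip_inner), IH, wick_ip_neq by lia. ring.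
Qed.

(** Here completeness enters: [x] is the limit of its projections, whose components in level [j + k]
    are zero. The other components stay in their own levels under [Ts t], orthogonal to [wick j k],
    and [Ts t] is continuous. *)
Lemma Ts_level_orth t j k x : 0 <= t ->
  (forall i, (i <= j + k)%nat -> hs_ip (wick i (j + k - i)) x = RtoC 0) ->
  hs_ip (wick j k) (Ts t x) = RtoC 0.
Proof.
  intros ht hx.
  apply (Clim_unique (fun K => hs_ip (wick j k) (Ts t (wick_proj K x)))).
  - apply hs_lim_ip, Ts_lim, wick_proj_cv; trivial.
  - apply Clim_ext with (fun _ => RtoC 0); [|apply Clim_const]. intros K. symmetry.
    unfold wick_proj, htsum. rewrite Ts_hsum, ip_hsum_r by trivial. apply csum_zero.
    intros N _. rewrite Ts_hsum, ip_hsum_r by trivial. apply csum_zero. intros i hi.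
    rewrite Ts_scal, (ip_scal_r _ hs_ip_inner) by trivial.
    destruct (Nat.eq_dec N (j + k)) as [->|hne].
    + rewrite hx by trivial. ring.
    + rewrite (level_orth j k N); [ring | |lia].
      apply Ts_level; trivial. apply span_gen. now exists i.
Qed.

(** A vector [x] of the domain splits into its component [px] in level [K], which lies in the
    domain, and a remainder orthogonal to the level. By [Ts_level_orth] and [generator_orth], the
    generator sends the remainder to a vector orthogonal to [wick j k], so only the finite matrix of
    the generator on the level matters. *)
Lemma adjoint_generator_wick j k : exists w, span (level (j + k)) w /\
  adjoint hs_ip (generator Ts) (wick j k) w.
Proof.
  set (K := (j + k)%nat).
  destruct (finite_choice hs (fun i v => generator Ts (wick i (K - i)) v) K) as [D hD].
  { intros i hi. destruct (generator_level K (wick i (K - i))) as [v [_ hv]]; [|now exists v].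
    apply span_gen. now exists i. }
  (* The adjoint of this finite matrix applied to [wick j k], in an orthogonal basis that is not
     normalized. *)
  exists (hsum (fun i => scal (Cmult (RtoC (/ wick_norm2 i (K - i)))
    (Cconj (hs_ip (wick j k) (D i)))) (wick i (K - i))) K). split.
  { apply span_hsum. intros i hi. apply span_scal, span_gen. now exists i. }
  intros x v hxv.
  set (c := fun i => Cmult (RtoC (/ wick_norm2 i (K - i))) (hs_ip (wick i (K - i)) x)).
  set (px := hsum (fun i => scal (c i) (wick i (K - i))) K).
  set (pv := hsum (fun i => scal (c i) (D i)) K).
  assert (hp : generator Ts px pv) by (apply generator_hsum; [apply hTs | exact hD]).
  assert (hgen : generator Ts (minus x px) (minus v pv)).
  { rewrite (hs_minus_scal x px), (hs_minus_scal v pv), plus_comm, (plus_comm v).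
    apply generator_linear; trivial. apply hTs. }
  assert (horth : forall i, (i <= K)%nat -> hs_ip (wick i (K - i)) (minus x px) = RtoC 0).
  { intros i hi. rewrite ip_minus_r. unfold px. rewrite ip_hsum_r, (csum_single _ i K hi).
    - rewrite (ip_scal_r _ hs_ip_inner), wick_ip_diag. unfold c.
      transitivity (Cminus (hs_ip (wick i (K - i)) x)
        (Cmult (Cmult (RtoC (/ wick_norm2 i (K - i))) (RtoC (wick_norm2 i (K - i))))
          (hs_ip (wick i (K - i)) x))); [ring|].
      rewrite <- RtoC_mult, Rinv_l; [ring|]. apply Rgt_not_eq, (wick_norm2_pos beta s hb).
    - intros l hl hne. rewrite (ip_scal_r _ hs_ip_inner), wick_ip_neq by lia. ring. }
  assert (h0 : hs_ip (wick j k) (minus v pv) = RtoC 0).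
  { apply (generator_orth Ts _ _ _ hgen).
    - intros t ht. now apply Ts_level_orth.
    - replace k with (K - j)%nat by lia. apply horth. lia. }
  rewrite ip_minus_r in h0.
  transitivity (hs_ip (wick j k) pv).
  { transitivity (Cplus (Cminus (hs_ip (wick j k) v) (hs_ip (wick j k) pv))
      (hs_ip (wick j k) pv)); [ring|]. rewrite h0. ring. }
  rewrite (ip_conj _ hs_ip_inner x). unfold pv. rewrite !ip_hsum_r.
  assert (hconj : forall u N, Cconj (csum u N) = csum (fun n => Cconj (u n)) N).
  { intros u N. induction N as [|N IH]; simpl; trivial. now rewrite Cplus_conj, IH. }
  rewrite hconj. apply csum_ext. intros i hi.
  rewrite !(ip_scal_r _ hs_ip_inner), !Cmult_conj, Cconj_R, Cconj_conj.
  rewrite <- (ip_conj _ hs_ip_inner x). unfold c. ring.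
Qed.

Local Notation A := (graph_plus (adjoint hs_ip (generator Ts)) (generator Ts)).

Lemma symmetrized_graded K x : span (graded K) x -> exists v, span (graded K) v /\ A x v.
Proof.
  assert (hlev : forall j k v, (j + k <= K)%nat -> span (level (j + k)) v -> span (graded K) v).
  { intros j k v hjk. apply span_mono. intros y [i [hi ->]].
    exists i, (j + k - i)%nat. split; trivial. lia. }
  intros hx. induction hx as [|c x y [j [k [hjk ->]]] hy [v [hv (v1 & v2 & h1 & h2 & h3)]]].
  - exists zero. split; [constructor|]. exists zero, zero. repeat split.
    + intros u w _. rewrite (ip_conj _ hs_ip_inner w), (ip_conj _ hs_ip_inner u).
      now rewrite !(ip_zero_r _ hs_ip_inner).
    + apply generator_zero, hTs.
    + hs_ring.
  - destruct (adjoint_generator_wick j k) as [u1 [hu1 ha]].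
    destruct (generator_level (j + k) (wick j k)) as [u2 [hu2 hg]].
    { apply span_gen. exists j. split; [lia|]. f_equal. lia. }
    exists (plus (scal c (plus u1 u2)) v). split.
    + apply span_plus; trivial. apply span_scal, span_plus; now apply (hlev j k).
    + exists (plus (scal c u1) v1), (plus (scal c u2) v2). repeat split.
      * now apply adjoint_linear.
      * apply generator_linear; trivial. apply hTs.
      * rewrite h3. hs_ring.
Qed.

End semigroup.

(** * Embedded polynomials and the theorem *)

Section polynomials.

Context (beta s : R) (hb : 0 < beta) (hs01 : 0 <= s <= 1).

Local Notation wick := (wick beta s hb hs01).
Local Notation graded := (graded beta s hb hs01).
Local Notation weight := (weight beta s).

(* The columns of A when Y = rho^{s/2} A rho^{(1-s)/2} *)
Definition unweighted (Y : hs) (n m : nat) : C := Cmult (RtoC (/ weight n m)) (ent Y n m).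

Lemma unweighted_add (c : C) X Y n :
  unweighted (plus (scal c X) Y) n =
  fun m => Cplus (Cmult c (unweighted X n m)) (unweighted Y n m).
Proof.
  apply functional_extensionality. intros m. unfold unweighted. rewrite ent_plus, ent_scal. ring.
Qed.

Lemma unweighted_zero n : unweighted zero n = fun _ => RtoC 0.
Proof. apply functional_extensionality. intros m. unfold unweighted. rewrite ent_zero. ring. Qed.

Lemma unweighted_emb P n : unweighted (emb beta s hb hs01 P) n = nc_eval P (basis n).
Proof.
  apply functional_extensionality. intros m. unfold unweighted.
  rewrite ent_emb, Cmult_assoc, <- RtoC_mult, Rinv_l; [ring | apply weight_neq0].
Qed.

Lemma unweighted_wick j k n : unweighted (wick j k) n = oev (- nu beta) j k (basis n).
Proof. apply unweighted_emb. Qed.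

Lemma is_embedding_unweighted (A : nat -> nat -> C) Y :
  is_embedding beta s A Y <-> forall n, unweighted Y n = A n.
Proof.
  rewrite is_embedding_ent. unfold unweighted, weighted. split; intros h n.
  - apply functional_extensionality. intros m.
    rewrite h, Cmult_assoc, <- RtoC_mult, Rinv_l; [ring | apply weight_neq0].
  - intros m. rewrite <- h, Cmult_assoc, <- RtoC_mult, Rinv_r; [ring | apply weight_neq0].
Qed.

Lemma graded_mono K K' Y : (K <= K')%nat -> span (graded K) Y -> span (graded K') Y.
Proof.
  intros h. apply span_mono. intros y (j & k & hjk & ->). exists j, k. split; trivial. lia.
Qed.

Lemma graded_linear_op (F : (nat -> C) -> nat -> C) (K K' : nat) :
  (forall c x y, F (fun m => Cplus (Cmult c (x m)) (y m)) =
     fun m => Cplus (Cmult c (F x m)) (F y m)) ->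
  F (fun _ => RtoC 0) = (fun _ => RtoC 0) ->
  (forall j k, (j + k <= K)%nat -> exists Z, span (graded K') Z /\
     forall n, unweighted Z n = F (oev (- nu beta) j k (basis n))) ->
  forall Y, span (graded K) Y -> exists Z, span (graded K') Z /\
    forall n, unweighted Z n = F (unweighted Y n).
Proof.
  intros hF h0 h Y hY. induction hY as [|c x y (j & k & hjk & ->) hy [Z [hZ1 hZ2]]].
  - exists zero. split; [constructor|]. intros n. now rewrite unweighted_zero, h0.
  - destruct (h j k hjk) as [Z' [hZ'1 hZ'2]]. exists (plus (scal c Z') Z). split.
    + apply span_plus; trivial. now apply span_scal.
    + intros n. now rewrite !unweighted_add, unweighted_wick, hF, hZ2, hZ'2.
Qed.

(** By [annih_oev] and [creat_oev], left multiplication by a ladder operator raises the degree by at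
    most one. The bound [K'] does not depend on [Y], which lets products be handled by
    composition. *)
Lemma graded_nc_eval P : forall K, exists K', forall Y, span (graded K) Y ->
  exists Z, span (graded K') Z /\ forall n, unweighted Z n = nc_eval P (unweighted Y n).
Proof.
  assert (hadd : forall (a b : C) X Y j k j' k' K, (j + k <= K)%nat ->
    X = wick j k -> (Y = zero \/ (Y = wick j' k' /\ (j' + k' <= K)%nat)) ->
    span (graded K) (plus (scal a X) (scal b Y))).
  { intros a b X Y j k j' k' K hjk -> hY. apply span_plus; apply span_scal.
    - apply span_gen. now exists j, k.
    - destruct hY as [->|[-> h]]; [constructor|]. apply span_gen. now exists j', k'. }
  induction P as [c| | |P IHP Q IHQ|P IHP Q IHQ]; intros K.
  - exists K. intros Y hY. exists (scal c Y). split; [now apply span_scal|]. intros n.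
    apply functional_extensionality. intros m. unfold unweighted. cbn [nc_eval].
    rewrite ent_scal. ring.
  - exists (S K). apply (graded_linear_op annih).
    + intros c x y. now rewrite annih_plus, annih_scal.
    + apply (nc_eval_zero nc_annih).
    + intros j k hjk.
      exists (plus (scal (RtoC (INR (S k))) (wick j (S k)))
        (scal (RtoC (1 - - nu beta)) (match j with O => zero | S j' => wick j' k end))).
      split.
      * apply (hadd _ _ _ _ j (S k) (pred j) k); trivial; [lia|].
        destruct j; [now left|]. right. split; trivial. simpl. lia.
      * intros n. apply functional_extensionality. intros m. rewrite annih_oev.
        unfold unweighted. rewrite ent_plus, !ent_scal.
        change (oev (- nu beta) j (S k) (basis n) m) with (nc_eval (ordered (- nu beta) j (S k)) (basis n) m).
        rewrite <- (unweighted_emb (ordered (- nu beta) j (S k)) n).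
        destruct j; cbn [prev].
        -- rewrite ent_zero. unfold unweighted, wick. ring.
        -- rewrite <- unweighted_wick. unfold unweighted, wick. ring.
  - exists (S K). apply (graded_linear_op creat).
    + intros c x y. now rewrite creat_plus, creat_scal.
    + apply (nc_eval_zero nc_creat).
    + intros j k hjk.
      exists (plus (scal (RtoC (INR (S j))) (wick (S j) k))
        (scal (Copp (RtoC (- nu beta))) (match k with O => zero | S k' => wick j k' end))).
      split.
      * apply (hadd _ _ _ _ (S j) k j (pred k)); trivial; [lia|].
        destruct k; [now left|]. right. split; trivial. simpl. lia.
      * intros n. apply functional_extensionality. intros m. rewrite creat_oev.
        unfold unweighted. rewrite ent_plus, !ent_scal.
        change (oev (- nu beta) (S j) k (basis n) m) with (nc_eval (ordered (- nu beta) (S j) k) (basis n) m).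
        rewrite <- (unweighted_emb (ordered (- nu beta) (S j) k) n).
        destruct k; cbn [prev].
        -- rewrite ent_zero. unfold unweighted, wick. ring.
        -- rewrite <- unweighted_wick. unfold unweighted, wick. ring.
  - destruct (IHP K) as [K1 h1]. destruct (IHQ K) as [K2 h2]. exists (Nat.max K1 K2).
    intros Y hY. destruct (h1 Y hY) as [Z1 [hZ1 e1]]. destruct (h2 Y hY) as [Z2 [hZ2 e2]].
    exists (plus (scal (RtoC 1) Z1) Z2). split.
    + apply span_plus; [apply span_scal|]; [apply (graded_mono K1) | apply (graded_mono K2)];
        trivial; lia.
    + intros n. rewrite unweighted_add, e1, e2. cbn [nc_eval].
      apply functional_extensionality. intros m. ring.
  - destruct (IHQ K) as [K1 h1]. destruct (IHP K1) as [K2 h2]. exists K2.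
    intros Y hY. destruct (h1 Y hY) as [Z1 [hZ1 e1]]. destruct (h2 Z1 hZ1) as [Z2 [hZ2 e2]].
    exists Z2. split; trivial. intros n. cbn [nc_eval]. now rewrite e2, e1.
Qed.

Lemma embedded_polynomial_graded Y :
  embedded_polynomial beta s Y <-> exists K, span (graded K) Y.
Proof.
  split.
  - intros [P hP]. destruct (graded_nc_eval P 0) as [K hK].
    (* [wick 0 0] is the embedding of the identity, so acting on it with [P] gives the embedding of
       [P] itself. *)
    destruct (hK (wick 0 0)) as [Z [hZ1 hZ2]].
    { apply span_gen. now exists 0%nat, 0%nat. }
    exists K. replace Y with Z; trivial. apply (is_embedding_unique beta s _ _ _) with (2 := hP).
    apply is_embedding_unweighted. intros n. rewrite hZ2, unweighted_wick. f_equal.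
    apply functional_extensionality. intros m. apply oev_00.
  - intros [K hY]. induction hY as [|c x y (j & k & hjk & ->) hy [P hP]].
    + exists (nc_const (RtoC 0)). apply is_embedding_unweighted. intros n.
      rewrite unweighted_zero. apply functional_extensionality. intros m. simpl. ring.
    + exists (nc_add (nc_mul (nc_const c) (ordered (- nu beta) j k)) P).
      apply is_embedding_unweighted. rewrite is_embedding_unweighted in hP. intros n.
      rewrite unweighted_add, hP, unweighted_wick. reflexivity.
Qed.

End polynomials.

Theorem lemma4p3 (g : gaussian_data) (beta : R) (W : C -> bounded_op) (T : R -> bounded_op -> bounded_op)
    (hW : forall z, is_weyl z (W z))
    (hT : gaussian_qms g W T)
    (hstable : stable g)
    (hstd : standardized g beta)
    (hrho : unique_invariant_normal_state T (rho_state beta))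
    (hfaithful : faithful (rho_state beta))
    (s : R) (hs01 : 0 <= s <= 1)
    (Ts : R -> hs -> hs) (hTs : induced_semigroup beta s T Ts) :
  essentially_self_adjoint_on hs_ip
    (graph_plus (adjoint hs_ip (generator Ts)) (generator Ts))
    (embedded_polynomial beta s).
Proof.
  set (A := graph_plus (adjoint hs_ip (generator Ts)) (generator Ts)).
  set (D := embedded_polynomial beta s).
  set (proj := wick_proj beta s (std_pos g beta hstd) hs01).
  assert (hA := symmetrized_graded g beta W T hW hT hstd s hs01 Ts hTs). fold A in hA.
  assert (hspan : forall Y, D Y <-> exists K, span (graded beta s (std_pos g beta hstd) hs01 K) Y)
    by apply embedded_polynomial_graded.
  assert (hdom : forall x, D x -> dom A x).
  { intros x hx. apply hspan in hx. destruct hx as [K hK].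
    destruct (hA K x hK) as [v [_ hv]]. now exists v. }
  assert (hproj : forall K x, D (proj K x)).
  { intros K x. apply hspan. exists K. apply wick_proj_span. }
  assert (hcv : forall x (eps : posreal), exists N, forall K, (N <= K)%nat ->
    hs_norm (minus (proj K x) x) < eps).
  { intros x eps. assert (h := wick_proj_cv beta s (std_pos g beta hstd) hs01 x).
    apply is_lim_seq_spec in h. destruct (h eps) as [N hN]. exists N. intros K hK.
    specialize (hN K hK). rewrite Rminus_0_r, Rabs_pos_eq in hN by apply ip_norm_ge0. exact hN. }
  assert (hdense : dense D).
  { intros x eps. destruct (hcv x eps) as [N hN]. exists (proj N x).
    split; [apply hproj | exact (hN N (le_n N))]. }
  assert (hsym : symmetric hs_ip (restrict A D)) by apply symmetric_adjoint_plus.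
  assert (hcl : forall x v, D x -> A x v -> graph_closure (restrict A D) x v).
  { intros x v hx hv eps. exists x, v. split; [now split|]. split; apply ball_center. }
  split; [exact hdom|]. split; [exact hdense|]. split; [exact hsym|]. split.
  - intros x eps. destruct (hdense x eps) as [y [hy hxy]]. exists y. split; trivial.
    destruct (hdom y hy) as [v hv]. exists v. now apply hcl.
  - intros x y. split.
    + intros hxy u v huv. symmetry. now apply (symmetric_closure _ hsym).
    + intros hadj eps.
      destruct (hcv x eps) as [N1 h1]. destruct (hcv y eps) as [N2 h2].
      set (K := Nat.max N1 N2).
      destruct (hA K (proj K x) (wick_proj_span _ _ _ _ K x)) as [v [hv hAv]].
      (* Both vectors have degree at most [K], so it suffices to test against such an [e]. With
         [a = A e], which again has degree at most [K], symmetry and the projection property give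
         [<e, v> = <a, proj K x> = <a, x>], and the adjoint relation turns this into
         [<e, y> = <e, proj K y>]. *)
      assert (hvy : v = proj K y).
      { apply (span_eq (graded beta s (std_pos g beta hstd) hs01 K)); trivial;
          [apply wick_proj_span|].
        intros e he. assert (hes := span_gen _ e he). assert (hDe : D e) by (apply hspan; now exists K).
        destruct (hA K e hes) as [a [ha hAa]].
        rewrite <- (hsym e a (proj K x) v (conj hDe hAa) (conj (hproj K x) hAv)).
        unfold proj. rewrite !span_ip_wick_proj by trivial.
        rewrite (ip_conj _ hs_ip_inner x a), (ip_conj _ hs_ip_inner y e). f_equal.
        apply hadj. now apply hcl. }
      exists (proj K x), v. split; [now split|]. split.
      * apply h1. lia.
      * rewrite hvy. apply h2. lia.
Qed.
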